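(* Let $\Omega\subset\mathbb{R}^4$ be a domain with $H^3(\Omega,\mathbb{R})=0$ and $0\notin\Omega$. Then for any harmonic function $h\in C^\infty(\Omega,\mathbb{C})$ there is a pair of $1$-regular functions $f$ and $g$ on $\Omega$ such that $$h=L_0f+L_1g.$$ More precisely, there exist $f_0,f_1,g_0,g_1\in C^\infty(\Omega,\mathbb{C})$ such that $$h=(x_2+x_3i)f_0+(x_0+x_1i)f_1+(-x_0+x_1i)g_0+(x_2-x_3i)g_1$$ and $D(\mathbf{j}f_0-f_1)=D(\mathbf{j}g_0-g_1)=0$ on $\Omega$.
   Context: Coordinates on $\mathbb{R}^4$ are $(x_0,x_1,x_2,x_3)$. $\mathbb{H}$ denotes the quaternions with units $\mathbf{i},\mathbf{j},\mathbf{k}$, $\mathbf{i}^2=\mathbf{j}^2=\mathbf{k}^2=\mathbf{i}\mathbf{j}\mathbf{k}=-1$; $\mathbb{C}$ is embedded in $\mathbb{H}$ by identifying $i$ with $\mathbf{i}$. $D=\partial_{x_0}+\mathbf{i}\,\partial_{x_1}+\mathbf{j}\,\partial_{x_2}+\mathbf{k}\,\partial_{x_3}$ is the Cauchy-Fueter operator on $\mathbb{H}$-valued functions (units multiply on the left). Derivatives: $\nabla_0^{0'}=-\partial_{x_2}-i\partial_{x_3}$, $\nabla_0^{1'}=-\partial_{x_0}-i\partial_{x_1}$, $\nabla_1^{0'}=\partial_{x_0}-i\partial_{x_1}$, $\nabla_1^{1'}=-\partial_{x_2}+i\partial_{x_3}$. A function $f=(f_0,f_1)\in C^1(\Omega,\mathbb{C}^2)$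 is $1$-regular on $\Omega$ if $\nabla_A^{0'}f_0+\nabla_A^{1'}f_1=0$ on $\Omega$ for $A=0,1$. For $f=(f_0,f_1):\Omega\to\mathbb{C}^2$, the operators $L_0,L_1$ are $L_0f=(x_2+x_3i)f_0+(x_0+x_1i)f_1$ and $L_1f=(-x_0+x_1i)f_0+(x_2-x_3i)f_1$. *)

(* Defs.v *)
From HB Require Import structures.
From mathcomp Require Import all_boot all_order all_algebra.
From mathcomp Require Import complex.
From mathcomp Require Import all_classical all_reals all_analysis.

Set Implicit Arguments.
Unset Strict Implicit.
Unset Printing Implicit Defensive.

Import Order.TTheory GRing.Theory Num.Theory.
Import numFieldNormedType.Exports.

Local Open Scope classical_set_scope.
Local Open Scope ring_scope.
Local Open Scope complex_scope.

(* R^n is 'rV[R]_n, and x 0 i is the coordinate x_i. Functions on an open set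
   Omega are total functions of which only the values on Omega matter. *)

Section Differentiability.
Variables (R : realType) (n : nat).
Implicit Types (Omega : set 'rV[R]_n).

Definition partial (W : normedModType R) (i : 'I_n) (f : 'rV[R]_n -> W) :
  'rV[R]_n -> W := 'D_(delta_mx 0 i) f.

Fixpoint Ck (W : normedModType R) (k : nat) Omega (f : 'rV[R]_n -> W) : Prop :=
  (forall x, Omega x -> {for x, continuous f}) /\
  match k with
  | 0%N => True
  | k'.+1 => forall i : 'I_n,
      (forall x, Omega x -> derivable f x (delta_mx 0 i)) /\
      Ck k' Omega (partial i f)
  end.

Definition smooth (W : normedModType R) Omega (f : 'rV[R]_n -> W) : Prop :=
  forall k, Ck k Omega f.

Definition domain Omega : Prop :=
  [/\ open Omega, connected Omega & Omega !=set0].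

(* R[i] carries no normed module structure over R, so C-valued functions are
   differentiated through their real and imaginary parts. *)

Definition cCk (k : nat) Omega (f : 'rV[R]_n -> R[i]) : Prop :=
  Ck k Omega (fun x => complex.Re (f x) : R) /\
  Ck k Omega (fun x => complex.Im (f x) : R).

Definition csmooth Omega (f : 'rV[R]_n -> R[i]) : Prop :=
  forall k, cCk k Omega f.

Definition cpartial (i : 'I_n) (f : 'rV[R]_n -> R[i]) (x : 'rV[R]_n) : R[i] :=
  partial i (fun y => complex.Re (f y) : R) x +i*
  partial i (fun y => complex.Im (f y) : R) x.

Definition harmonic_on Omega (h : 'rV[R]_n -> R[i]) : Prop :=
  forall x, Omega x -> \sum_(i < n) cpartial i (cpartial i h) x = 0.

End Differentiability.

(* De Rham cohomology of an open subset of R^n. The form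
   sum_I w_I dx_I, where I = {i_1 < ... < i_k} and
   dx_I = dx_{i_1} /\ ... /\ dx_{i_k}, is given by its coefficients w I; in
   degree k only the w I with #|I| = k are relevant. *)
Section DeRham.
Variables (R : realType) (n : nat).
Implicit Types (Omega : set 'rV[R]_n) (w : {set 'I_n} -> 'rV[R]_n -> R).

Definition smooth_form (k : nat) Omega w : Prop :=
  forall I : {set 'I_n}, #|I| = k -> smooth Omega (w I : 'rV[R]_n -> R).

(* The sign is that of moving dx_j to its place in dx_J. *)
Definition ext_d w (J : {set 'I_n}) (x : 'rV[R]_n) : R :=
  \sum_(j in J) (-1) ^+ #|[set l in J | (l < j)%N]| *
    partial j (w (J :\ j)%SET : 'rV[R]_n -> R) x.

Definition form_eq (k : nat) Omega w w' : Prop :=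
  forall I : {set 'I_n}, #|I| = k -> forall x, Omega x -> w I x = w' I x.

Definition closed_form (k : nat) Omega w : Prop :=
  form_eq k.+1 Omega (ext_d w) (fun _ _ => 0).

Definition exact_form (k : nat) Omega w : Prop :=
  match k with
  | 0%N => form_eq 0 Omega w (fun _ _ => 0)
  | k'.+1 => exists2 v : {set 'I_n} -> 'rV[R]_n -> R,
      smooth_form k' Omega v & form_eq k Omega w (ext_d v)
  end.

(* H^k(Omega, R) = 0 *)
Definition deRham_vanishes (k : nat) Omega : Prop :=
  forall w, smooth_form k Omega w -> closed_form k Omega w ->
    exact_form k Omega w.

End DeRham.

(* The quaternion a + b i + c j + d k is the row vector (a, b, c, d). *)
Section Quaternions.
Variable R : realType.

Definition quat : normedModType R := 'rV[R]_4.

Definition mkquat (a b c d : R) : quat := \row_(i < 4) [:: a; b; c; d]`_i.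

Definition qmul (p q : quat) : quat :=
  let p0 := p 0 0 in let p1 := p 0 1 in let p2 := p 0 2 in let p3 := p 0 3 in
  let q0 := q 0 0 in let q1 := q 0 1 in let q2 := q 0 2 in let q3 := q 0 3 in
  mkquat (p0 * q0 - p1 * q1 - p2 * q2 - p3 * q3)
         (p0 * q1 + p1 * q0 + p2 * q3 - p3 * q2)
         (p0 * q2 - p1 * q3 + p2 * q0 + p3 * q1)
         (p0 * q3 + p1 * q2 - p2 * q1 + p3 * q0).

Definition q1 : quat := mkquat 1 0 0 0.
Definition qi : quat := mkquat 0 1 0 0.
Definition qj : quat := mkquat 0 0 1 0.
Definition qk : quat := mkquat 0 0 0 1.

Lemma qmul_units :
  [/\ qmul qi qi = - q1, qmul qj qj = - q1, qmul qk qk = - q1 &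
      qmul (qmul qi qj) qk = - q1].
Proof.
split; apply/rowP => -[[|[|[|[|m]]]] lt_m4] //; rewrite !mxE /=;
  by rewrite ?(mul0r, mulr0, mul1r, mulr1, subr0, sub0r, addr0, add0r, oppr0).
Qed.

Definition quat_of_complex (z : R[i]) : quat :=
  mkquat (complex.Re z) (complex.Im z) 0 0.

Definition cauchy_fueter (q : 'rV[R]_4 -> quat) (x : 'rV[R]_4) : quat :=
  partial 0 q x + qmul qi (partial 1 q x) + qmul qj (partial 2 q x) +
  qmul qk (partial 3 q x).

End Quaternions.

Section Regular.
Variable R : realType.
Implicit Types (phi : 'rV[R]_4 -> R[i]) (f : 'rV[R]_4 -> R[i] * R[i])
  (x : 'rV[R]_4).

(* nabla A A' is the operator with lower index A and upper index A'. *)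
Definition nabla (A A' : 'I_2) phi x : R[i] :=
  match val A, val A' with
  | 0%N, 0%N => - cpartial 2 phi x - 'i * cpartial 3 phi x
  | 0%N, _ => - cpartial 0 phi x - 'i * cpartial 1 phi x
  | _, 0%N => cpartial 0 phi x - 'i * cpartial 1 phi x
  | _, _ => - cpartial 2 phi x + 'i * cpartial 3 phi x
  end.

Definition regular1 (Omega : set 'rV[R]_4) f : Prop :=
  let f0 y := (f y).1 in
  let f1 y := (f y).2 in
  [/\ cCk 1 Omega f0, cCk 1 Omega f1 &
      forall (A : 'I_2) x, Omega x -> nabla A 0 f0 x + nabla A 1 f1 x = 0].

Definition L0 f x : R[i] :=
  (x 0 2 +i* x 0 3) * (f x).1 + (x 0 0 +i* x 0 1) * (f x).2.

Definition L1 f x : R[i] :=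
  ((- x 0 0) +i* x 0 1) * (f x).1 + (x 0 2 -i* x 0 3) * (f x).2.

End Regular.

(* Main.v *)
(** It suffices to treat a real harmonic function h and to find a vector field p on Omega with
    x . p = h, div p = 0 and vanishing self-dual part of the exterior derivative of p: the fields
    of Re h and Im h combine into f and g.  With N = 1/|x|^2 the field W = h grad N - N grad h is
    divergence free, so H^3 = 0 makes the dual 3-form of W exact, *W = dv.  Adding the exterior
    derivative of a 1-form, found by solving Poisson equations, v can be taken anti-self-dual, and
    then p = h N x plus the contraction of x with v has the required properties.

    The Poisson equation Delta u = f is solved on an arbitrary open set by splitting f into pieces
    supported in small balls.  The Newton potential of a piece is expanded around a pole outside
    Omega, or around infinity; subtracting a partial sum, which is harmonic on Omega, makes the
    series of the potentials converge with all its derivatives. *)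

Require Import Defs.
From mathcomp Require Import all_boot all_order all_algebra.
From mathcomp Require Import complex.
From mathcomp Require Import all_classical all_reals all_analysis.
From mathcomp Require Import ring lra zify.
Import Order.TTheory GRing.Theory Num.Theory.
Import numFieldNormedType.Exports.
Set Implicit Arguments.
Unset Strict Implicit.
Unset Printing Implicit Defensive.
Local Open Scope classical_set_scope.
Local Open Scope ring_scope.
Local Notation "''e_' i" := (delta_mx (0 : 'I_1) i) (at level 8, i at level 2).

(** * Directional derivatives and smooth functions *)

Section DerivativeCriterion.
Variables (R : realType) (V : normedModType R).
Implicit Types (f : V -> R) (x v : V) (d : R).

(** The system imposed on p says that the quaternion p_0 - p_1 i - p_2 j - p_3 k is annihilated by
    D, and x . p is the real part of x times this quaternion: h is represented by a regular field.

    The obstacle is the Poisson equation. Its right-hand side comes out of the cohomological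
    primitive and may grow without control near the boundary of Omega, so its Newton potential need
    not converge. The corrections only have to be harmonic on Omega, which leaves room for poles
    just outside it.

    Of the integral, only linearity, positivity, integration by parts and a lower bound on a box are
    ever used, so any functional with these properties serves. The price is that the total mass of
    the Laplacian of the kernel is not computed: it is shown to be a negative number, independent of
    the scale and of the point, and the potentials are divided by it.

    In all potentials the derivatives are moved onto the source. Estimates of the undifferentiated
    kernel, applied to the derivatives of the source, therefore control every order at once. *)

Lemma is_deriveP f x v d :
  is_derive x v f d <->
  forall e : R, 0 < e -> exists2 r : R, 0 < r &
    forall h : R, `|h| < r -> `|f (x + h *: v) - f x - h * d| <= e * `|h|.
Proof.
split=> [[df <-] e e0|H].
- move: df => /cvg_ex[/= l cl].
  have -> : 'D_v f x = l by apply: cvg_lim cl.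
  move/cvgrPdist_le : cl => /(_ _ e0) -[r /= r0 Hr].
  exists r => // h hr.
  have [->|h0] := eqVneq h 0; first by rewrite scale0r addr0 subrr !mul0r subrr normr0 mulr0.
  have := Hr h; rewrite /= sub0r normrN => /(_ hr h0).
  rewrite -(ler_pM2r (_ : 0 < `|h|)) ?normr_gt0// => /(le_trans _); apply.
  rewrite distrC -normrM mulrBl [h *: v + x]addrC.
  suff -> : h^-1 *: (f (x + h *: v) - f x) * h = f (x + h *: v) - f x by rewrite [h * l]mulrC.
  by rewrite [in LHS]/GRing.scale /= mulrAC mulVf// mul1r.
- suff cl : h^-1 *: ((f \o shift x) (h *: v) - f x) @[h --> 0^'] --> d.
    split; [by apply/cvg_ex; exists d|exact: cvg_lim cl].
  apply/cvgrPdist_le => e /H[r r0 Hr].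
  exists r => //= h /=; rewrite sub0r normrN => hr h0.
  have Hh := Hr h hr; rewrite [_ + x]addrC.
  rewrite -(ler_pM2r (_ : 0 < `|h|)) ?normr_gt0// distrC -normrM mulrBl.
  suff -> : h^-1 *: (f (x + h *: v) - f x) * h = f (x + h *: v) - f x by rewrite [d * h]mulrC.
  by rewrite [in LHS]/GRing.scale /= mulrAC mulVf// mul1r.
Qed.

End DerivativeCriterion.

Section DerivativeRules.
Variables (R : realType) (V : normedModType R).
Implicit Types (f : V -> R) (x v : V) (d : R).

(** A bound C h^2 on the error, unlike a bound o(h), survives pointwise limits and means.
    Derivatives of limits and of potentials are obtained in this way. *)
Lemma is_derive_quad f x v d (r C : R) : 0 < r ->
  (forall h : R, `|h| < r -> `|f (x + h *: v) - f x - h * d| <= C * h ^+ 2) ->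
  is_derive x v f d.
Proof.
move=> r0 H; apply/is_deriveP => e e0.
pose K := Num.max C 1; have K0 : 0 < K by rewrite lt_max ltr01 orbT.
exists (Num.min r (e / K)); first by rewrite lt_min r0 divr_gt0.
move=> h; rewrite lt_min => /andP[hr he]; apply: (le_trans (H h hr)).
rewrite -normr_id -[h ^+ 2]real_normK ?num_real// expr2 normr_id mulrA ler_wpM2r//.
apply: (@le_trans _ _ (K * `|h|)); first by rewrite ler_wpM2r// le_max lexx.
by rewrite mulrC -ler_pdivlMr// ltW.
Qed.

Lemma is_derive_shift0 f x v d (t : R) :
  is_derive (x + t *: v) v f d -> is_derive t 1 (fun s => f (x + s *: v)) d.
Proof.
move=> /is_deriveP H; apply/is_deriveP => e /H[r r0 Hr]; exists r => // h /Hr.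
by rewrite scalerDl addrA [h *: 1]mulr1.
Qed.

Lemma is_derive_near f g x v d (r : R) : 0 < r ->
  (forall h : R, `|h| < r -> f (x + h *: v) = g (x + h *: v)) ->
  is_derive x v f d -> is_derive x v g d.
Proof.
move=> r0 fg /is_deriveP H; apply/is_deriveP => e /H[s s0 Hs].
exists (Num.min r s); first by rewrite lt_min r0.
move=> h; rewrite lt_min => /andP[hr hs].
by rewrite -fg// -[g x]/(g x) -(addr0 x) -(scale0r v) -fg ?normr0// scale0r !addr0 Hs.
Qed.

Lemma is_derive_comp1 (g : R -> R) f x v (a b : R) :
  is_derive (f x) 1 g a -> is_derive x v f b -> is_derive x v (fun y => g (f y)) (a * b).
Proof.
move=> /is_deriveP Hg /is_deriveP Hf; apply/is_deriveP => e e0.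
have [r1 r10 H1] := Hf 1 ltr01.
pose B := `|b| + 1; have B0 : 0 < B by rewrite ltr_wpDl.
have [r2 r20 H2] := Hg (e / 2 / B) (divr_gt0 (divr_gt0 e0 (ltr0Sn _ _)) B0).
pose A := `|a| + 1; have A0 : 0 < A by rewrite ltr_wpDl.
have [r3 r30 H3] := Hf (e / 2 / A) (divr_gt0 (divr_gt0 e0 (ltr0Sn _ _)) A0).
exists (Num.min r1 (Num.min r3 (r2 / B))); first by rewrite !lt_min r10 r30 divr_gt0.
move=> h; rewrite !lt_min => /and3P[h1 h3 h2] /=.
set k := f (x + h *: v) - f x.
have kB : `|k| <= B * `|h|.
  have := H1 h h1; rewrite -/k mul1r => Hk.
  rewrite -[k](subrK (h * b)) (le_trans (ler_normD _ _))// normrM /B mulrDl mul1r addrC.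
  by rewrite [`|h| * _]mulrC lerD2l.
have k2 : `|k| < r2.
  by apply: (le_lt_trans kB); rewrite mulrC -ltr_pdivlMr.
have := H2 k k2; rewrite {1}/k [k%:A]mulr1.
have -> : f x + k = f (x + h *: v) by rewrite /k addrC subrK.
move=> G.
have -> : g (f (x + h *: v)) - g (f x) - h * (a * b) =
  (g (f (x + h *: v)) - g (f x) - k * a) + a * (k - h * b) by ring.
apply: (le_trans (ler_normD _ _)); have -> : e * `|h| = e / 2 * `|h| + e / 2 * `|h| by rewrite -mulrDl -splitr.
apply: lerD.
- apply: (le_trans G); rewrite -[leLHS]mulrA ler_wpM2l ?divr_ge0 ?(ltW e0)//.
  by rewrite mulrC ler_pdivrMr// mulrC.
- rewrite normrM; apply: (@le_trans _ _ (A * (e / 2 / A * `|h|))).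
    by apply: ler_pM => //; [rewrite /A lerDl|exact: H3].
  by rewrite mulrA [A * _]mulrC divfK// gt_eqF.
Qed.

End DerivativeRules.

(** * Mean value and Taylor estimates along lines *)

Section MeanValue.
Variables (R : realType) (V : normedModType R).
Implicit Types (f : V -> R) (x v : V).

Lemma mvt_line f f' x v (h : R) :
  (forall t : R, 0 <= t <= 1 ->
     is_derive (x + (t * h) *: v) v f (f' (x + (t * h) *: v))) ->
  exists2 t : R, 0 <= t <= 1 &
    f (x + h *: v) - f x = h * f' (x + (t * h) *: v).
Proof.
move=> df.
pose phi (s : R) := f (x + (s * h) *: v).
pose phi' (s : R) := h * f' (x + (s * h) *: v).
have dphi (s : R) : 0 <= s <= 1 -> is_derive s 1 phi (phi' s).
  move=> /df /is_derive_shift0 D; rewrite /phi' [h * _]mulrC.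
  have L : is_derive s 1 (fun s : R => s * h) h.
    apply: (@is_derive_quad _ _ _ _ _ _ 1 0) => // k _.
    rewrite [k%:A]mulr1 mul0r; have -> : (s + k) * h - s * h - k * h = 0 by ring.
    by rewrite normr0.
  exact: (is_derive_comp1 (f := fun s : R => s * h) D L).
have A1 (s : R) : s \in `]0, 1[%R -> is_derive s 1 phi (phi' s).
  by rewrite in_itv /= => /andP[/ltW s0 /ltW s1]; apply: dphi; rewrite s0.
have A2 : {within `[0, 1], continuous phi}.
  by apply: derivable_within_continuous => s; rewrite in_itv => /dphi[].
have [c c01] := @MVT_segment R phi phi' 0 1 ler01 A1 A2.
rewrite /phi /phi' mul1r mul0r scale0r addr0 subr0 mulr1 => E.
by exists c.
Qed.

(** The mean value theorem is applied to f and then to f'. The constant is twice the optimal one,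
    which is harmless. *)
Lemma taylor2 f f' f'' x v (h C : R) :
  (forall t : R, 0 <= t <= 1 ->
    [/\ is_derive (x + (t * h) *: v) v f (f' (x + (t * h) *: v)),
        is_derive (x + (t * h) *: v) v f' (f'' (x + (t * h) *: v)) &
        `|f'' (x + (t * h) *: v)| <= C]) ->
  `|f (x + h *: v) - f x - h * f' x| <= C * h ^+ 2.
Proof.
move=> H.
have [t /andP[t0 t1] ->] : exists2 t : R, 0 <= t <= 1 &
    f (x + h *: v) - f x = h * f' (x + (t * h) *: v).
  by apply: mvt_line => t /H[].
have H' (s : R) : 0 <= s <= 1 -> 0 <= s * t <= 1.
  by move=> /andP[s0 s1]; rewrite mulr_ge0// mulr_ile1.
have [s s01 E] : exists2 s : R, 0 <= s <= 1 &
    f' (x + (t * h) *: v) - f' x = t * h * f'' (x + (s * (t * h)) *: v).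
  by apply: mvt_line => s; rewrite mulrA => /H' /H[].
have [_ _] := H _ (H' s s01); rewrite -mulrA => Cs.
rewrite -mulrBr E.
have -> (a : R) : h * (t * h * a) = a * (t * h ^+ 2) by ring.
rewrite normrM ler_pM//.
by rewrite normrM [`|h ^+ 2|]ger0_norm ?sqr_ge0// ger0_norm// ler_piMl ?sqr_ge0.
Qed.

End MeanValue.

Section Coordinates.
Variables (R : realType) (n : nat).
Implicit Types (x y : 'rV[R]_n) (f : 'rV[R]_n -> R).

Lemma normrV_le x (r : R) : 0 <= r -> (forall i, `|x 0 i| <= r) -> `|x| <= r.
Proof.
move=> r0 H; rewrite [`|x|]mx_normrE; apply: bigmax_le => // -[i j] _ /=.
by rewrite ord1.
Qed.

Lemma coord_le_norm x i : `|x 0 i| <= `|x|.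
Proof.
rewrite [`|x|]mx_normrE.
by apply: (le_bigmax _ (fun ij : 'I_1 * 'I_n => `|x ij.1 ij.2|) (0, i)).
Qed.

Lemma scale_e_coord (h : R) i j : (h *: 'e_i : 'rV[R]_n) 0 j = if j == i then h else 0.
Proof. by rewrite !mxE eqxx /=; case: eqVneq => _; rewrite ?mulr1 ?mulr0. Qed.

Lemma norm_scale_e (h : R) i : `|(h *: 'e_i : 'rV[R]_n)| <= `|h|.
Proof.
apply: normrV_le => // j; rewrite scale_e_coord.
by case: ifP; rewrite ?normr0.
Qed.

Definition mixv x y (k : nat) : 'rV[R]_n := \row_(i < n) (if (i < k)%N then y 0 i else x 0 i).

(** The path from x to y changes one coordinate at a time, through the points [mixv x y k]. It stays
    in the ball because the norm is the maximum norm: every coordinate on the path is one of x, one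
    of y, or lies between the two. *)
Lemma lip_coord f (f' : 'I_n -> 'rV[R]_n -> R) z (r C : R) : 0 < r ->
  (forall i y, `|y - z| < r -> is_derive y 'e_i f (f' i y) /\ `|f' i y| <= C) ->
  forall x y, `|x - z| < r -> `|y - z| < r -> `|f y - f x| <= C * n%:R * `|y - x|.
Proof.
move=> r0 H x y xr yr.
suff main k : (k <= n)%N -> `|f (mixv x y k) - f x| <= C * k%:R * `|y - x|.
  have := main n (leqnn n); suff -> : mixv x y n = y by [].
  by apply/rowP => i; rewrite mxE ltn_ord.
elim: k => [|k IH] kn.
  suff -> : mixv x y 0 = x by rewrite subrr normr0 mulr0 mul0r.
  by apply/rowP => i; rewrite mxE.
pose K := Ordinal kn; pose h := y 0 K - x 0 K.
have E : mixv x y k.+1 = mixv x y k + h *: 'e_K.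
  apply/rowP => i; rewrite mxE [RHS]mxE scale_e_coord mxE ltnS leq_eqVlt.
  have -> : (i == k :> nat) = (i == K) by [].
  case: eqVneq => [->|_] /=; last by rewrite addr0.
  by rewrite ltnn /h addrC subrK.
have inball (s : R) : 0 <= s <= 1 -> `|mixv x y k + (s * h) *: 'e_K - z| < r.
  move=> /andP[s0 s1].
  suff : `|mixv x y k + (s * h) *: 'e_K - z| <= Num.max `|x - z| `|y - z|.
    by move=> /le_lt_trans; apply; rewrite gt_max xr yr.
  apply: normrV_le => [|i]; first by rewrite le_max normr_ge0.
  have ix := coord_le_norm (x - z) i; have iy := coord_le_norm (y - z) i.
  rewrite mxE [X in X + _]mxE scale_e_coord mxE; move: ix iy; rewrite !mxE.
  case: (ltnP i k) => [ik ix iy|ki].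
    have /negbTE -> : i != K by rewrite neq_ltn ik.
    by rewrite addr0 le_max iy orbT.
  case: eqVneq => [->{i ki}|_ ix iy]; last by rewrite addr0 le_max ix.
  move=> ix iy; set M := Num.max _ _.
  have {}ix : `|x 0 K - z 0 K| <= M by rewrite le_max ix.
  have {}iy : `|y 0 K - z 0 K| <= M by rewrite le_max iy orbT.
  have -> : x 0 K + s * h - z 0 K = (1 - s) * (x 0 K - z 0 K) + s * (y 0 K - z 0 K).
    by rewrite /h; ring.
  apply: (le_trans (ler_normD _ _)); rewrite !normrM.
  have -> : M = (1 - s) * M + s * M by ring.
  by apply: lerD; rewrite ger0_norm ?subr_ge0// ler_wpM2l ?subr_ge0.
have [t /inball /(H K)[_ HC] Et] : exists2 t : R, 0 <= t <= 1 &
    f (mixv x y k.+1) - f (mixv x y k) = h * f' K (mixv x y k + (t * h) *: 'e_K).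
  by rewrite E; apply: mvt_line => t /inball /(H K)[].
have -> : f (mixv x y k.+1) - f x =
    (f (mixv x y k.+1) - f (mixv x y k)) + (f (mixv x y k) - f x) by ring.
apply: (le_trans (ler_normD _ _)); rewrite addrC -natr1 mulrDr mulrDl mulr1.
apply: lerD; first exact/IH/ltnW.
rewrite Et normrM mulrC ler_pM//.
by have := coord_le_norm (y - x) K; rewrite !mxE.
Qed.

End Coordinates.

(** * Families of iterated derivatives and C^k functions *)

Section Jets.
Variables (R : realType) (n : nat).
Implicit Types (x y : 'rV[R]_n) (f g : 'rV[R]_n -> R) (Om : set 'rV[R]_n).
Implicit Types (F : seq 'I_n -> 'rV[R]_n -> R) (s : seq 'I_n).

Definition pd s f : 'rV[R]_n -> R := foldr (fun i g => partial i (g : 'rV[R]_n -> R)) f s.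

Definition locally_bounded Om f :=
  forall x, Om x -> exists r C : R, 0 < r /\ forall y, `|y - x| < r -> `|f y| <= C.

(* [F s] plays the role of the iterated derivative [pd s (F [::])]. *)
Definition jet Om F := forall s,
  (forall i x, Om x -> is_derive x 'e_i (F s) (F (i :: s) x)) /\ locally_bounded Om (F s).

Lemma open_ballP Om x : open Om -> Om x -> exists2 r : R, 0 < r & forall y, `|y - x| < r -> Om y.
Proof.
move=> oOm Ox; have /nbhs_ballP[r /= r0 Hr] : nbhs x Om by exact: open_nbhs_nbhs.
exists r => // y yr.
by apply: Hr; rewrite -ball_normE /ball_/= distrC.
Qed.

Lemma continuous_atP f x : {for x, continuous f} <->
  forall e : R, 0 < e -> exists2 r : R, 0 < r & forall y, `|y - x| < r -> `|f y - f x| < e.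
Proof.
split=> [cf e e0|H A /nbhs_ballP[e /= /H[r r0 Hr] eA]].
  have /nbhs_ballP[r /= r0 Hr] : nbhs x (f @^-1` ball (f x) e).
    by apply: cf; apply/nbhs_ballP; exists e.
  exists r => // y yr; have := Hr y; rewrite -ball_normE /ball_ /= distrC yr => /(_ isT).
  by rewrite -ball_normE /ball_ /= distrC.
apply/nbhs_ballP; exists r => // y; rewrite -ball_normE /ball_ /= distrC => /Hr yr.
by apply: eA; rewrite -ball_normE /ball_ /= distrC.
Qed.

Lemma bounded_family (I : finType) (P : I -> R -> R -> Prop) :
  (forall i r r' C C', 0 < r' -> r' <= r -> C <= C' -> P i r C -> P i r' C') ->
  (forall i, exists r C : R, 0 < r /\ P i r C) ->
  exists r C : R, 0 < r /\ forall i, P i r C.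
Proof.
move=> Pm /choice[r /choice[C H]].
exists (\big[Num.min/1]_i r i), (\big[Num.max/0]_i C i); split.
  by apply: lt_bigmin => // i _; have [] := H i.
move=> i; have [r0 Pi] := H i; apply: Pm Pi.
- by apply: lt_bigmin => // j _; have [] := H j.
- exact: bigmin_le.
- exact: le_bigmax.
Qed.

(** Partial derivatives alone do not give continuity; with local bounds on the next order they give
    a Lipschitz estimate. This is why [jet] asks for local boundedness. *)
Lemma jet_lip Om F s : open Om -> jet Om F -> forall x, Om x ->
  exists r C : R, [/\ 0 < r, 0 <= C & forall y z, `|y - x| < r -> `|z - x| < r ->
    `|F s y - F s z| <= C * `|y - z|].
Proof.
move=> oOm jF x Ox.
have [r0 r00 Hr0] := open_ballP oOm Ox.
have [r1 [C [r10 H]]] : exists r C : R, 0 < r /\ forall i, forall y, `|y - x| < r -> `|F (i :: s) y| <= C.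
  apply: (@bounded_family _ (fun i r C => forall y, `|y - x| < r -> `|F (i :: s) y| <= C)).
    move=> i r r' C C' _ rr CC H y yr; apply: le_trans CC; apply: H; exact: lt_le_trans rr.
  by move=> i; have [_] := jF (i :: s); apply.
exists (Num.min r0 r1), (`|C| * n%:R); split; rewrite ?lt_min ?r00// ?mulr_ge0// => y z yr zr.
apply: (@lip_coord _ _ (F s) (fun i => F (i :: s)) x (Num.min r0 r1)) => //; first by rewrite lt_min r00.
move=> i w; rewrite lt_min => /andP[/Hr0 Ow /H wr]; split; first by have [+ _] := jF s; apply.
exact: (le_trans (wr i) (ler_norm _)).
Qed.

Lemma jet_continuous Om F s x : open Om -> jet Om F -> Om x -> {for x, continuous (F s)}.
Proof.
move=> oOm jF Ox; have [r [C [r0 C0 H]]] := jet_lip s oOm jF Ox.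
apply/continuous_atP => e e0.
have D0 : 0 < C + 1 by rewrite ltr_wpDl.
exists (Num.min r (e / (C + 1))); first by rewrite /= lt_min r0 divr_gt0.
move=> y; rewrite lt_min => /andP[yr ye].
rewrite (le_lt_trans (H y x _ _)) ?subrr ?normr0//.
apply: (@le_lt_trans _ _ ((C + 1) * `|y - x|)); first by rewrite ler_wpM2r// lerDl.
by rewrite mulrC -ltr_pdivlMr.
Qed.

Lemma is_derive_open Om f g x (v : 'rV[R]_n) d : open Om -> Om x -> (forall y, Om y -> f y = g y) ->
  is_derive x v f d -> is_derive x v g d.
Proof.
move=> oOm Ox fg; apply: near_eq_is_derive.
by have /(filterS fg) : nbhs x Om by exact: open_nbhs_nbhs.
Qed.

Lemma continuous_eq_open Om f g x : open Om -> Om x -> (forall y, Om y -> f y = g y) ->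
  {for x, continuous f} -> {for x, continuous g}.
Proof.
move=> oOm Ox fg /continuous_atP cf; have [r0 r00 Hr0] := open_ballP oOm Ox.
apply/continuous_atP => e /cf[r1 r10 Hr1].
exists (Num.min r0 r1) => [|y]; rewrite lt_min ?r00// => /andP[/Hr0 /fg <- /Hr1].
by rewrite -(fg x).
Qed.

Lemma Ck_eq Om k f g : open Om -> (forall x, Om x -> f x = g x) -> Ck k Om f -> Ck k Om g.
Proof.
move=> oOm; elim: k f g => [|k IH] f g fg /= [cf H]; split.
- by move=> x Ox; exact: continuous_eq_open Ox fg (cf x Ox).
- by [].
- by move=> x Ox; exact: continuous_eq_open Ox fg (cf x Ox).
- move=> i; have [df Hk] := H i; split.
    by move=> x Ox; case: (is_derive_open oOm Ox fg (derivableP (df x Ox))).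
  apply: IH Hk => x Ox; rewrite /partial.
  by case: (is_derive_open oOm Ox fg (derivableP (df x Ox))).
Qed.

Lemma jet_Ck Om F : open Om -> jet Om F -> forall k s, Ck k Om (F s).
Proof.
move=> oOm jF k s; elim: k s => [|k IH] s.
  by split=> // x Ox; exact: jet_continuous Ox.
split=> [x Ox|i]; first exact: jet_continuous Ox.
have [dF _] := jF s; split; first by move=> x Ox; case: (dF i x Ox).
by apply: Ck_eq (IH (i :: s)) => // x Ox; case: (dF i x Ox).
Qed.

Lemma jet_pd Om F : open Om -> jet Om F -> forall s x, Om x -> pd s (F [::]) x = F s x.
Proof.
move=> oOm jF; elim=> [//|i s IH] x Ox /=.
have [dF _] := jF s; rewrite /partial.
by case: (is_derive_open oOm Ox (fun y Oy => esym (IH y Oy)) (dF i x Ox)).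
Qed.

Lemma jet_smooth Om F : open Om -> jet Om F -> smooth Om (F [::]).
Proof. by move=> oOm jF k; apply: jet_Ck. Qed.

Lemma smooth_partial Om f i : smooth Om f -> smooth Om (partial i (f : _ -> R)).
Proof. by move=> sf k; have [_ /(_ i)[]] := sf k.+1. Qed.

Lemma smooth_pd Om f s : smooth Om f -> smooth Om (pd s f).
Proof. by move=> sf; elim: s => //= i s; exact: smooth_partial. Qed.

Lemma smooth_is_derive Om f i x : smooth Om f -> Om x -> is_derive x 'e_i f (partial i (f : _ -> R) x).
Proof. by move=> /(_ 1%N)[_ /(_ i)[H _]] Ox; apply/derivableP/H. Qed.

Lemma smooth_continuous Om f x : smooth Om f -> Om x -> {for x, continuous f}.
Proof. by move=> /(_ 0%N)[H _] /H. Qed.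

Lemma smooth_eq Om f g : open Om -> (forall x, Om x -> f x = g x) -> smooth Om f -> smooth Om g.
Proof. by move=> oOm fg sf k; exact: Ck_eq (sf k). Qed.

Lemma pd_eq Om f g s : open Om -> (forall x, Om x -> f x = g x) -> smooth Om f ->
  forall x, Om x -> pd s f x = pd s g x.
Proof.
move=> oOm fg sf; elim: s => [//|i s IH] x Ox /=.
rewrite /partial.
by case: (is_derive_open oOm Ox IH (smooth_is_derive i (smooth_pd s sf) Ox)).
Qed.

End Jets.

Section DerivativeAlgebra.
Variables (R : realType) (V : normedModType R).
Implicit Types (f g : V -> R) (x v : V).

Lemma is_derive_mul f g x v (a b : R) : is_derive x v f a -> is_derive x v g b ->
  is_derive x v (fun y => f y * g y) (a * g x + f x * b).
Proof.
move=> df dg.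
have E : f x *: b + g x *: a = a * g x + f x * b by rewrite addrC [a * _]mulrC.
exact: (is_derive_eq (is_deriveM df dg) E).
Qed.

Lemma is_derive_add f g x v (a b : R) : is_derive x v f a -> is_derive x v g b ->
  is_derive x v (fun y => f y + g y) (a + b).
Proof. exact: is_deriveD. Qed.

Lemma is_derive_opp f x v (a : R) : is_derive x v f a -> is_derive x v (fun y => - f y) (- a).
Proof. exact: is_deriveN. Qed.

Lemma is_derive_sub f g x v (a b : R) : is_derive x v f a -> is_derive x v g b ->
  is_derive x v (fun y => f y - g y) (a - b).
Proof. exact: is_deriveB. Qed.

Lemma is_derive_const (c : R) x v : is_derive x v (fun=> c) 0.
Proof. exact: is_derive_cst. Qed.

End DerivativeAlgebra.

(** * Sums, products and compositions of smooth functions *)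

Section SmoothFunctions.
Variables (R : realType) (n : nat).
Implicit Types (x y : 'rV[R]_n) (f g : 'rV[R]_n -> R) (Om : set 'rV[R]_n).
Implicit Types (F : seq 'I_n -> 'rV[R]_n -> R) (s : seq 'I_n).

Lemma is_derive_coord i j x : is_derive x 'e_i (fun y => y 0 j) ((j == i)%:R : R).
Proof.
apply: (@is_derive_quad _ _ _ _ _ _ 1 0) => // h _.
rewrite mxE scale_e_coord mul0r; case: eqVneq => _.
  have -> : x 0 j + h - x 0 j - h * 1%:R = 0 by ring.
  by rewrite normr0.
have -> : x 0 j + 0 - x 0 j - h * 0%:R = 0 by ring.
  by rewrite normr0.
Qed.

Lemma is_derive_partial f i x (a : R) : is_derive x 'e_i f a -> partial i (f : _ -> R) x = a.
Proof. by case. Qed.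

Lemma continuous_add f g x : {for x, continuous f} -> {for x, continuous g} ->
  {for x, continuous (fun y => f y + g y)}.
Proof. exact: continuousD. Qed.

Lemma continuous_mul f g x : {for x, continuous f} -> {for x, continuous g} ->
  {for x, continuous (fun y => f y * g y)}.
Proof. exact: continuousM. Qed.

Lemma CkS Om k f : Ck k.+1 Om f -> Ck k Om f.
Proof.
elim: k f => [|k IH] f [cf H]; split => // i; have [df] := H i.
by split=> //; exact: IH.
Qed.

Lemma Ck_add Om k f g : open Om -> Ck k Om f -> Ck k Om g -> Ck k Om (fun y => f y + g y).
Proof.
move=> oOm; elim: k f g => [|k IH] f g [cf H] [cg K]; split => //.
- by move=> x Ox; exact: continuous_add (cf x Ox) (cg x Ox).
- by move=> x Ox; exact: continuous_add (cf x Ox) (cg x Ox).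
move=> i; have [df Hf] := H i; have [dg Hg] := K i.
have D x : Om x -> is_derive x 'e_i (fun y => f y + g y) (partial i f x + partial i g x).
  by move=> Ox; apply: is_derive_add; apply/derivableP; [exact: df|exact: dg].
split; first by move=> x /D[].
by apply: Ck_eq (IH _ _ Hf Hg) => // x /D[].
Qed.

Lemma Ck_mul Om k f g : open Om -> Ck k Om f -> Ck k Om g -> Ck k Om (fun y => f y * g y).
Proof.
move=> oOm; elim: k f g => [|k IH] f g Cf Cg; have [cf H] := Cf; have [cg K] := Cg; split => //.
- by move=> x Ox; exact: continuous_mul (cf x Ox) (cg x Ox).
- by move=> x Ox; exact: continuous_mul (cf x Ox) (cg x Ox).
move=> i; have [df Hf] := H i; have [dg Hg] := K i.
have D x : Om x -> is_derive x 'e_i (fun y => f y * g y) (partial i f x * g x + f x * partial i g x).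
  by move=> Ox; apply: is_derive_mul; apply/derivableP; [exact: df|exact: dg].
split; first by move=> x /D[].
apply: Ck_eq (Ck_add oOm (IH _ _ Hf (CkS Cg)) (IH _ _ (CkS Cf) Hg)) => // x /D[_].
exact.
Qed.

Lemma Ck_cst Om k (c : R) : Ck k Om (fun _ : 'rV[R]_n => c).
Proof.
elim: k c => [|k IH] c; split => //; do ?[by move=> x _; exact: cst_continuous].
move=> i; split; first by move=> x _; case: (is_derive_const c x (delta_mx 0 i)).
suff -> : partial i (fun _ : 'rV[R]_n => c) = fun=> 0 by [].
by apply/funext => x; case: (is_derive_const c x 'e_i).
Qed.

Lemma continuous_coord j x : {for x, continuous (fun y : 'rV[R]_n => y 0 j)}.
Proof. exact: coord_continuous. Qed.

Lemma Ck_coord Om k j : Ck k Om (fun y : 'rV[R]_n => y 0 j).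
Proof.
case: k => [|k]; split => //; do ?[by move=> x _; exact: continuous_coord].
move=> i; split; first by move=> x _; case: (is_derive_coord i j x).
suff -> : partial i (fun y : 'rV[R]_n => y 0 j) = fun=> (j == i)%:R by exact: Ck_cst.
by apply/funext => x; case: (is_derive_coord i j x).
Qed.

Lemma smooth_add Om f g : open Om -> smooth Om f -> smooth Om g -> smooth Om (fun y => f y + g y).
Proof. by move=> oOm sf sg k; exact: Ck_add. Qed.

Lemma smooth_mul Om f g : open Om -> smooth Om f -> smooth Om g -> smooth Om (fun y => f y * g y).
Proof. by move=> oOm sf sg k; exact: Ck_mul. Qed.

Lemma smooth_cst Om (c : R) : smooth Om (fun _ : 'rV[R]_n => c).
Proof. by move=> k; exact: Ck_cst. Qed.

Lemma smooth_coord Om j : smooth Om (fun y : 'rV[R]_n => y 0 j).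
Proof. by move=> k; exact: Ck_coord. Qed.

Lemma smooth_opp Om f : open Om -> smooth Om f -> smooth Om (fun y => - f y).
Proof.
move=> oOm sf; apply: smooth_eq (smooth_mul oOm (smooth_cst _ (-1)) sf) => // x _.
by rewrite mulN1r.
Qed.

Lemma smooth_sub Om f g : open Om -> smooth Om f -> smooth Om g -> smooth Om (fun y => f y - g y).
Proof. by move=> oOm sf sg; apply: smooth_add => //; exact: smooth_opp. Qed.

Lemma smooth_sum Om (I : Type) (r : seq I) (P : pred I) (f : I -> 'rV[R]_n -> R) : open Om ->
  (forall i, P i -> smooth Om (f i)) -> smooth Om (fun y => \sum_(i <- r | P i) f i y).
Proof.
move=> oOm H; elim: r => [|a r IH].
  by apply: smooth_eq (smooth_cst _ 0) => // x _; rewrite big_nil.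
case/boolP: (P a) => Pa.
  by apply: smooth_eq (smooth_add oOm (H a Pa) IH) => // x _; rewrite big_cons Pa.
by apply: smooth_eq IH => // x _; rewrite big_cons (negbTE Pa).
Qed.

Lemma smooth_prod Om (I : Type) (r : seq I) (P : pred I) (f : I -> 'rV[R]_n -> R) : open Om ->
  (forall i, P i -> smooth Om (f i)) -> smooth Om (fun y => \prod_(i <- r | P i) f i y).
Proof.
move=> oOm H; elim: r => [|a r IH].
  by apply: smooth_eq (smooth_cst _ 1) => // x _; rewrite big_nil.
case/boolP: (P a) => Pa.
  by apply: smooth_eq (smooth_mul oOm (H a Pa) IH) => // x _; rewrite big_cons Pa.
by apply: smooth_eq IH => // x _; rewrite big_cons (negbTE Pa).
Qed.

Lemma smooth_subset Om Om' f : Om' `<=` Om -> smooth Om f -> smooth Om' f.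
Proof.
move=> sub sf k; have := sf k; elim: k f {sf} => [|k IH] f [cf H]; split => //.
- by move=> x /sub; exact: cf.
- by move=> x /sub; exact: cf.
by move=> i; have [df Hf] := H i; split=> [x /sub|]; [exact: df|exact: IH].
Qed.

(* [g k] is the [k]-th derivative of [g 0]. *)
Definition smooth1 (D : set R) (g : nat -> R -> R) :=
  forall k t, D t -> is_derive t 1 (g k) (g k.+1 t).

(** The induction on k treats all m together, since differentiating [g m] composed with f brings in
    [g m.+1]. *)
Lemma Ck_comp Om D (g : nat -> R -> R) f k m : open Om -> smooth1 D g -> (forall x, Om x -> D (f x)) ->
  Ck k Om f -> Ck k Om (fun y => g m (f y)).
Proof.
move=> oOm sg OD.
have C x l : Om x -> {for x, continuous f} -> {for x, continuous (fun y => g l (f y))}.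
  move=> Ox cf; apply: continuous_comp; first exact: cf.
  by apply/differentiable_continuous/derivable1_diffP; case: (sg l _ (OD x Ox)).
elim: k m => [|k IH] m Cf; have [cf H] := Cf; split => //.
- by move=> x Ox; apply: C => //; exact: cf.
- by move=> x Ox; apply: C => //; exact: cf.
move=> i; have [df Hf] := H i.
have Dd x : Om x -> is_derive x 'e_i (fun y => g m (f y)) (g m.+1 (f x) * partial i f x).
  move=> Ox; apply: is_derive_comp1; first exact: sg (OD x Ox).
  by apply/derivableP; exact: df.
split; first by move=> x /Dd[].
apply: Ck_eq (Ck_mul oOm (IH m.+1 (CkS Cf)) Hf) => // x /Dd[_].
exact.
Qed.

Lemma smooth_comp Om D (g : nat -> R -> R) f : open Om -> smooth1 D g -> (forall x, Om x -> D (f x)) ->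
  smooth Om f -> smooth Om (fun y => g 0%N (f y)).
Proof. by move=> oOm sg OD sf k; exact: Ck_comp sg OD (sf k). Qed.

End SmoothFunctions.

(** * Symmetry of second derivatives and limits of jets *)

Section JetLimits.
Variables (R : realType) (n : nat).
Implicit Types (x y : 'rV[R]_n) (f g : 'rV[R]_n -> R) (Om : set 'rV[R]_n).
Implicit Types (F : seq 'I_n -> 'rV[R]_n -> R) (s : seq 'I_n).

Lemma second_difference Om f i j x (r : R) : smooth Om f -> (forall y, `|y - x| < r -> Om y) ->
  forall h : R, 2 * `|h| < r -> exists2 w, `|w - x| <= 2 * `|h| &
    f (x + h *: 'e_i + h *: 'e_j) - f (x + h *: 'e_i) - (f (x + h *: 'e_j) - f x) =
    h ^+ 2 * partial j (partial i (f : _ -> R)) w.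
Proof.
move=> sf Hr h hr.
have inb (s t : R) : 0 <= s <= 1 -> 0 <= t <= 1 ->
    `|x + (s * h) *: 'e_i + (t * h) *: 'e_j - x| <= 2 * `|h|.
  move=> /andP[s0 s1] /andP[t0 t1]; rewrite -(addrA x) [x + _]addrC addrK.
  apply: (le_trans (ler_normD _ _)); rewrite mulr_natl mulr2n.
  apply: lerD; apply: (le_trans (norm_scale_e _ _)); by rewrite normrM ger0_norm// ler_piMl.
have inO (s t : R) (s01 : 0 <= s <= 1) (t01 : 0 <= t <= 1) := Hr _ (le_lt_trans (inb s t s01 t01) hr).
have [s s01] : exists2 s : R, 0 <= s <= 1 &
    (fun y => f (y + h *: 'e_j) - f y) (x + h *: 'e_i) - (fun y => f (y + h *: 'e_j) - f y) x =
    h * (fun y => partial i f (y + h *: 'e_j) - partial i f y) (x + (s * h) *: 'e_i).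
  apply: (@mvt_line _ _ (fun y => f (y + h *: 'e_j) - f y)
    (fun y => partial i f (y + h *: 'e_j) - partial i f y)) => t t01.
  apply: is_derive_sub; last first.
    apply: smooth_is_derive sf _.
    have := inO t 0 t01; rewrite mul0r scale0r addr0; apply.
    by rewrite lexx ler01.
  have : is_derive (x + (t * h) *: 'e_i + h *: 'e_j) 'e_i f (partial i f (x + (t * h) *: 'e_i + h *: 'e_j)).
    apply: smooth_is_derive sf _.
    have := inO t 1 t01; rewrite mul1r; apply.
    by rewrite lexx ler01.
  move=> /is_deriveP H; apply/is_deriveP => e /H[d d0 Hd]; exists d => // k /Hd.
  by rewrite [_ + k *: _]addrAC.
have [t t01] : exists2 t : R, 0 <= t <= 1 &
    partial i f (x + (s * h) *: 'e_i + h *: 'e_j) - partial i f (x + (s * h) *: 'e_i) =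
    h * partial j (partial i f) (x + (s * h) *: 'e_i + (t * h) *: 'e_j).
  apply: mvt_line => t t01; apply: smooth_is_derive (smooth_partial i sf) _.
  exact: inO.
move=> E2 E1; exists (x + (s * h) *: 'e_i + (t * h) *: 'e_j); first exact: inb.
by rewrite expr2 -mulrA -E2 -E1.
Qed.

(** The mixed second difference is symmetric in i and j and equals h^2 times either mixed
    derivative, each taken at some point within 2h of x. Continuity of both derivatives at x
    concludes. *)
Lemma schwarz Om f i j x : open Om -> smooth Om f -> Om x ->
  partial i (partial j (f : _ -> R)) x = partial j (partial i (f : _ -> R)) x.
Proof.
move=> oOm sf Ox; have [r r0 Hr] := open_ballP oOm Ox.
have c1 : {for x, continuous (partial i (partial j (f : _ -> R)))}.
  by apply: smooth_continuous Ox; do 2!apply: smooth_partial.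
have c2 : {for x, continuous (partial j (partial i (f : _ -> R)))}.
  by apply: smooth_continuous Ox; do 2!apply: smooth_partial.
apply/eqP; rewrite -subr_eq0 -normr_le0; apply/ler_addgt0Pr => e e0; rewrite add0r.
have e2 : 0 < e / 2 by rewrite divr_gt0.
move/continuous_atP : c1 => /(_ _ e2)[r1 r10 H1].
move/continuous_atP : c2 => /(_ _ e2)[r2 r20 H2].
pose h : R := Num.min r (Num.min r1 r2) / 3.
have m0 : 0 < Num.min r (Num.min r1 r2) by rewrite !lt_min r0 r10.
have h0 : 0 < h by rewrite divr_gt0.
have : 2 * `|h| < Num.min r (Num.min r1 r2).
  rewrite gtr0_norm// /h; set m := Num.min r _ in m0 *; lra.
rewrite !lt_min => /and3P[hr hr1 hr2].
have [w wx E] := second_difference i j sf Hr hr.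
have [v vx E'] := second_difference j i sf Hr hr.
have : h ^+ 2 * partial j (partial i f) w = h ^+ 2 * partial i (partial j f) v.
  have K (a b c d : R) : a - b - (c - d) = a - c - (b - d) by ring.
  apply: (eq_trans (esym E)); apply: (eq_trans _ E').
  by rewrite (addrAC x (h *: 'e_j)) K.
have h2 : h ^+ 2 != 0 by rewrite expf_neq0// gt_eqF.
move=> /(mulfI h2) Ewv.
have := H1 v (le_lt_trans vx hr1); have := H2 w (le_lt_trans wx hr2).
rewrite Ewv => A B.
have K (a b c : R) : a - b = (c - b) - (c - a) by ring.
rewrite (K _ _ (partial i (partial j f) v)) [e]splitr.
exact: (le_trans (ler_normB _ _) (lerD (ltW A) (ltW B))).
Qed.

Lemma lim_norm_le (u : nat -> R) (l c : R) (N : nat) : u @ \oo --> l ->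
  (forall j, (N <= j)%N -> `|u j| <= c) -> `|l| <= c.
Proof.
by move=> ul H; apply: (cvgr_to_le (cvg_norm ul)); exists N => // j /= /H.
Qed.

(** Pointwise convergence is enough: the bounds on the derivatives two orders higher are locally
    uniform in j, so the Taylor estimate with quadratic error passes to the limit. *)
Lemma jet_lim Om (F : nat -> seq 'I_n -> 'rV[R]_n -> R) (G : seq 'I_n -> 'rV[R]_n -> R) :
  open Om ->
  (forall s x, Om x -> exists (r C : R) (N : nat), 0 < r /\ forall j, (N <= j)%N ->
     forall y, `|y - x| < r -> `|F j s y| <= C /\
       forall i, is_derive y 'e_i (F j s) (F j (i :: s) y)) ->
  (forall s x, Om x -> F j s x @[j --> \oo] --> G s x) ->
  jet Om G.
Proof.
move=> oOm H cF s; split=> [i x Ox|x Ox]; last first.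
  have [r0 r00 Hr0] := open_ballP oOm Ox.
  have [r [C [N [r_gt0 HC]]]] := H s x Ox.
  exists (Num.min r0 r), C; rewrite lt_min r00; split=> // y.
  rewrite lt_min => /andP[/Hr0 Oy yr].
  by apply: lim_norm_le (cF s y Oy) (_ : forall j, (N <= j)%N -> _) => j /HC /(_ y yr)[].
have [r0 r00 Hr0] := open_ballP oOm Ox.
have [r1 [C1 [N1 [r10 H1]]]] := H s x Ox.
have [r2 [C2 [N2 [r20 H2]]]] := H (i :: s) x Ox.
have [r3 [C3 [N3 [r30 H3]]]] := H (i :: i :: s) x Ox.
apply: (@is_derive_quad _ _ _ _ _ _ (Num.min (Num.min r0 r1) (Num.min r2 r3)) C3).
  by rewrite !lt_min r00 r10 r20.
move=> h; rewrite !lt_min => /andP[/andP[h0 h1] /andP[h2 h3]].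
have nb (t r : R) : 0 <= t <= 1 -> `|h| < r -> `|x + (t * h) *: 'e_i - x| < r.
  move=> /andP[t0 t1]; apply: le_lt_trans; rewrite [x + _]addrC addrK.
  by apply: (le_trans (norm_scale_e _ _)); rewrite normrM ger0_norm// ler_piMl.
have Oh : Om (x + h *: 'e_i).
  by apply: Hr0; have := nb 1 r0; rewrite mul1r; apply => //; rewrite lexx ler01.
apply: (@lim_norm_le (fun j => F j s (x + h *: 'e_i) - F j s x - h * F j (i :: s) x) _ _ (maxn N1 (maxn N2 N3))).
  apply: cvgB; last exact: cvgM (cvg_cst _) (cF _ _ Ox).
  by apply: cvgB; exact: cF.
move=> j; rewrite !geq_max => /and3P[j1 j2 j3].
apply: (@taylor2 _ _ _ _ (F j (i :: i :: s))) => t t01; split.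
- exact: (H1 j j1 _ (nb t _ t01 h1)).2.
- exact: (H2 j j2 _ (nb t _ t01 h2)).2.
- exact: (H3 j j3 _ (nb t _ t01 h3)).1.
Qed.

End JetLimits.

Lemma ultra_fmap (T S : Type) (U : set_system T) (u : T -> S) : UltraFilter U -> UltraFilter (u @ U).
Proof.
move=> UU; split=> [|G GF sG]; first exact: fmap_proper_filter.
rewrite eqEsubset; split=> // A GA.
have [//|nA] := in_ultra_setVsetC (u @^-1` A) UU.
have GnA : G (~` A) by exact: sG.
have /filter_ex[x [Ax nAx]] : G (A `&` ~` A) by exact: filterI.
by case: nAx.
Qed.

(** * A mean on the functions on a cube *)

(** There are 16 (k+1) points on each edge. Divisibility by 16 makes the count of the points in the
    central box exact, and at least 16 points put the last one within 1/2 of the face of the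
    cube. *)
Definition grid_size (k : nat) := (16 * k + 15)%N.

Section Mean.
Variable R : realType.
Local Notation pointset := ('rV[R]_4).
Implicit Types (f g : pointset -> R) (c z : pointset).

Definition bounded_on (Q : set pointset) f := exists C : R, forall z, Q z -> `|f z| <= C.

Definition cube c (r : R) : set pointset := [set z | `|z - c| <= r].

(* A finitely additive substitute for the integral over the cube, defined on all functions, so that
   no measurability or integrability has to be checked; [mean_derive] stands for integration by
   parts and [mean_box] for non-degeneracy. *)
Record is_mean c (L : (pointset -> R) -> R) : Prop := IsMean {
  mean_add : forall f g, bounded_on (cube c 3) f -> bounded_on (cube c 3) g ->
    L (fun z => f z + g z) = L f + L g;
  mean_scale : forall (a : R) f, bounded_on (cube c 3) f -> L (fun z => a * f z) = a * L f;
  mean_ge0 : forall f, bounded_on (cube c 3) f -> (forall z, cube c 3 z -> 0 <= f z) -> 0 <= L f;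
  mean_le : forall f (C : R), (forall z, cube c 3 z -> `|f z| <= C) -> `|L f| <= C;
  mean_derive : forall i g g', bounded_on (cube c 3) g' ->
    (exists C : R, forall z (h : R), cube c 3 z -> cube c 3 (z + h *: 'e_i) ->
      `|g (z + h *: 'e_i) - g z - h * g' z| <= C * h ^+ 2) ->
    (forall z, 5 / 2 <= `|z - c| -> g z = 0 /\ g' z = 0) -> L g' = 0;
  mean_box : forall f, bounded_on (cube c 3) f -> (forall z, cube c 3 z -> 0 <= f z) ->
    (forall z, cube c (3 / 8) z -> 1 <= f z) -> 1 / 4096 <= L f }.

Section Construction.
Variable c : pointset.

Local Notation N := grid_size.
(** The upper faces of the cube are left out and the indices form a product of cyclic groups, so a
    shift of the index permutes the grid. *)
Definition grid_pt (k : nat) (m : {ffun 'I_4 -> 'I_(N k).+1}) : pointset :=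
  c + \row_(i < 4) (- 3 + 6 * (m i)%:R / (N k).+1%:R).

Definition grid_avg (k : nat) f : R := (\sum_(m : {ffun 'I_4 -> 'I_(N k).+1}) f (grid_pt m)) / (N k).+1%:R ^+ 4.

Lemma grid_pt_cube k m : cube c 3 (@grid_pt k m).
Proof.
rewrite /cube /= /grid_pt addrC addKr; apply: normrV_le => // i; rewrite mxE.
have m0 : 0 <= (m i)%:R / (N k).+1%:R :> R by rewrite divr_ge0.
have m1 : (m i)%:R / (N k).+1%:R <= 1 :> R.
  by rewrite ler_pdivrMr// mul1r ler_nat ltnW.
rewrite -mulrA; set t : R := _ / _ in m0 m1 *.
by rewrite ler_norml; lra.
Qed.

Lemma card_grid k : (\sum_(m : {ffun 'I_4 -> 'I_(N k).+1}) 1 : R) = (N k).+1%:R ^+ 4.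
Proof. by rewrite sumr_const card_ffun !card_ord natrX. Qed.

Lemma grid_avg_le k f (C : R) : (forall z, cube c 3 z -> `|f z| <= C) -> `|grid_avg k f| <= C.
Proof.
move=> H; rewrite /grid_avg normrM normfV [`|_ ^+ 4|]gtr0_norm ?exprn_gt0// ler_pdivrMr ?exprn_gt0//.
rewrite -card_grid mulr_sumr; apply: (le_trans (ler_norm_sum _ _ _)).
by apply: ler_sum => m _; rewrite mulr1; apply: H; exact: grid_pt_cube.
Qed.

Lemma grid_avg_add k f g : grid_avg k (fun z => f z + g z) = grid_avg k f + grid_avg k g.
Proof. by rewrite /grid_avg big_split mulrDl. Qed.

Lemma grid_avg_scale k (a : R) f : grid_avg k (fun z => a * f z) = a * grid_avg k f.
Proof. by rewrite /grid_avg -mulr_sumr mulrA. Qed.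

Lemma grid_avg_ge0 k f : (forall z, cube c 3 z -> 0 <= f z) -> 0 <= grid_avg k f.
Proof.
move=> H; rewrite /grid_avg divr_ge0 ?exprn_ge0//.
by apply: sumr_ge0 => m _; apply: H; exact: grid_pt_cube.
Qed.

(** With step h, the value h g' differs from the increment of g to the next grid point by at most C
    h^2. The increments sum to zero under the cyclic shift, so the average of g' is at most C h = 6
    C / (N+1). *)
Lemma grid_avg_derive k i g g' (C : R) :
  (forall z (h : R), cube c 3 z -> cube c 3 (z + h *: 'e_i) ->
      `|g (z + h *: 'e_i) - g z - h * g' z| <= C * h ^+ 2) ->
  (forall z, 5 / 2 <= `|z - c| -> g z = 0 /\ g' z = 0) ->
  `|grid_avg k g'| <= 6 * C / (N k).+1%:R.
Proof.
move=> Hq H0.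
(* The generator of the index group in direction i; adding it leads from the last point of a line
   back to the first. *)
pose d : {ffun 'I_4 -> 'I_(N k).+1} := [ffun j => if j == i then inZp 1 else 0].
pose h : R := 6 / (N k).+1%:R.
have h0 : 0 < h by rewrite divr_gt0.
have C0 : 0 <= C.
  have := Hq c 1; rewrite expr1n mulr1 => Hc; apply: le_trans (Hc _ _) => //.
    by rewrite /cube /= subrr normr0.
  rewrite /cube /= addrC addKr; apply: (le_trans (norm_scale_e _ _)).
  by rewrite normr1 ler1n.
have step m : `|g (grid_pt (m + d)) - g (grid_pt m) - h * g' (grid_pt m)| <= C * h ^+ 2.
  have [lt_m|ge_m] := ltnP (m i).+1 (N k).+1.
    have E : grid_pt (m + d) = grid_pt m + h *: 'e_i.
      apply/rowP => j; rewrite [RHS]mxE scale_e_coord !mxE -addrA; congr (_ + _).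
      rewrite ffunE /d ffunE; case: eqVneq => [->|_]; last by rewrite !addr0.
      rewrite /= modnDmr addn1 modn_small// -[(m i).+1%:R]natr1 /h.
      by set a : R := (m i)%:R; rewrite mulrDr mulrDl mulr1 addrA.
    by rewrite E; apply: Hq; rewrite -?E; exact: grid_pt_cube.
  (* At the wrap-around both points are within 1/2 of a face of the cube, where g and g' vanish. *)
  have mi : (m i).+1 = (N k).+1 by apply/eqP; rewrite eqn_leq ltn_ord.
  have [g1 g2] : g (grid_pt m) = 0 /\ g' (grid_pt m) = 0.
    apply: H0; apply: (le_trans _ (coord_le_norm _ i)); rewrite !mxE addrC addKr.
    have -> : (m i)%:R = (N k).+1%:R - 1 :> R by have /eqP := congr1 (fun a => a%:R : R) mi; rewrite -[(m i).+1%:R]natr1 => /eqP <-; rewrite addrK.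
    have n16 : 16 <= (N k).+1%:R :> R by rewrite ler_nat /N -addnS leq_addl.
    have -> : - 3 + 6 * ((N k).+1%:R - 1) / (N k).+1%:R = 3 - 6 / (N k).+1%:R :> R.
      by field; rewrite gt_eqF.
    have : 6 / (N k).+1%:R <= 1 / 2 :> R by rewrite ler_pdivrMr//; lra.
    set t : R := 6 / _; move=> t1; rewrite ger0_norm; lra.
  have [g3 _] : g (grid_pt (m + d)) = 0 /\ g' (grid_pt (m + d)) = 0.
    apply: H0; apply: (le_trans _ (coord_le_norm _ i)); rewrite !mxE addrC addKr.
    rewrite ffunE /d ffunE eqxx /= modnDmr addn1 mi modnn mulr0 mul0r addr0.
    by rewrite normrN ger0_norm; lra.
  by rewrite g1 g2 g3 !subr0 mulr0 subrr normr0 mulr_ge0// sqr_ge0.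
have tele : \sum_(m : {ffun 'I_4 -> 'I_(N k).+1}) (g (grid_pt (m + d)) - g (grid_pt m)) = 0.
  by rewrite sumrB [X in _ - X](reindex_inj (addIr d)) /= subrr.
have H : `|h * \sum_(m : {ffun 'I_4 -> 'I_(N k).+1}) g' (grid_pt m)| <= (N k).+1%:R ^+ 4 * (C * h ^+ 2).
  rewrite -[h * _]opprK normrN -[X in `|X|]add0r -[X in `|X - _|]tele mulr_sumr -sumrB.
  apply: (le_trans (ler_norm_sum _ _ _)); rewrite -card_grid mulr_suml.
  by apply: ler_sum => m _; rewrite mul1r; exact: step.
rewrite /grid_avg normrM normfV [`|_ ^+ 4|]gtr0_norm ?exprn_gt0// ler_pdivrMr ?exprn_gt0//.
rewrite -(ler_pM2l h0) -[h in h * `|_|]gtr0_norm// -normrM (le_trans H)//.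
rewrite /h; set a := _ ^+ 4; set b := (N k).+1%:R.
by rewrite le_eqVlt; apply/orP; left; apply/eqP; field; rewrite gt_eqF.
Qed.

Lemma grid_avg_box k f : (forall z, cube c 3 z -> 0 <= f z) ->
  (forall z, cube c (3 / 8) z -> 1 <= f z) -> 1 / 4096 <= grid_avg k f.
Proof.
move=> f0 f1; rewrite /grid_avg ler_pdivlMr ?exprn_gt0//.
(* These indices are the coordinates from -3/8 to 3/8 relative to the centre, one eighth of each
   edge; the fraction of the grid is 1/8^4 = 1/4096. *)
pose b (a : 'I_(N k).+1) : R := ((7 * k.+1 <= a) && (a < 9 * k.+1))%N%:R.
have sb : \sum_a b a = 2 * k.+1%:R.
  have nE : (N k).+1 = (16 * k.+1)%N by rewrite /grid_size; lia.
  rewrite -natr_sum -(big_mkord xpredT (fun a => ((7 * k.+1 <= a) && (a < 9 * k.+1) : nat)%N)) nE.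
  rewrite (big_cat_nat (n := (7 * k.+1)%N))//=; last by rewrite leq_mul2r orbT.
  rewrite (big_cat_nat (m := (7 * k.+1)%N) (n := (9 * k.+1)%N))//=; try by rewrite leq_mul2r orbT.
  rewrite big_nat big1 ?add0n; last by move=> a /andP[_ /ltn_geF ->].
  rewrite [X in (_ + X)%N]big_nat [X in (_ + X)%N]big1 ?addn0; last first.
    by move=> a /andP[a9 _]; rewrite ltnNge a9 andbF.
  rewrite big_nat (eq_bigr (fun=> 1%N)) => [|a /andP[-> ->]//].
  rewrite -big_nat sum_nat_const_nat muln1 -mulnBl natrM.
  by [].
have E : \sum_(m : {ffun 'I_4 -> 'I_(N k).+1}) \prod_i b (m i) = (2 * k.+1%:R) ^+ 4.
  by rewrite -(bigA_distr_bigA (fun=> b)) prodr_const card_ord sb.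
have -> : 1 / 4096 * (N k).+1%:R ^+ 4 = (2 * k.+1%:R) ^+ 4 :> R.
  have -> : (N k).+1%:R = 16 * k.+1%:R :> R by rewrite -natrM; congr (_%:R); rewrite /grid_size; lia.
  by field.
rewrite -E; apply: ler_sum => m _.
have [/forallP Hm|/forallPn[i Hi]] := boolP [forall i, (7 * k.+1 <= m i) && (m i < 9 * k.+1)]%N; last first.
  rewrite (bigD1 i)//= /b (negbTE Hi) mul0r; apply: f0; exact: grid_pt_cube.
rewrite big1 => [|i _]; last by rewrite /b Hm.
apply: f1; rewrite /cube /= /grid_pt addrC addKr; apply: normrV_le => [|i]; first by rewrite divr_ge0.
rewrite mxE; have /andP[l u] := Hm i.
have -> : (N k).+1%:R = 16 * k.+1%:R :> R by rewrite -natrM; congr (_%:R); rewrite /grid_size; lia.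
have k0 : 0 < k.+1%:R :> R by [].
have l' : 7 * k.+1%:R <= (m i)%:R :> R by rewrite -natrM ler_nat.
have u' : (m i)%:R <= 9 * k.+1%:R :> R by rewrite -natrM ler_nat ltnW.
have -> : 6 * (m i)%:R / (16 * k.+1%:R) = 3 / 8 * ((m i)%:R / k.+1%:R) :> R by field; rewrite gt_eqF.
have : 7 <= (m i)%:R / k.+1%:R :> R by rewrite ler_pdivlMr.
have : (m i)%:R / k.+1%:R <= 9 :> R by rewrite ler_pdivrMr.
set t : R := _ / _ => t1 t2; rewrite ler_norml.
by apply/andP; split; lra.
Qed.

(* An ultrafilter limit of averages over finer and finer grids. *)
Lemma exists_mean : exists L, is_mean c L.
Proof.
have [U [UU sU]] := ultraFilterLemma (eventually_filter : ProperFilter \oo).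
pose L f : R := lim (grid_avg ^~ f @ U).
have cvL f : bounded_on (cube c 3) f -> grid_avg ^~ f @ U --> L f.
  move=> [C HC].
  have := @segment_compact R (- C) C; rewrite compact_ultra => /(_ (grid_avg ^~ f @ U)).
  case; first exact: ultra_fmap.
    by apply: (@filterE _ U) => k /=; rewrite in_itv /= -ler_norml; exact: grid_avg_le.
  by move=> l [_ Hl]; rewrite /L (cvg_lim _ Hl).
have near_le f (C : R) (l : R) : grid_avg ^~ f @ U --> l -> (\forall k \near U, `|grid_avg k f| <= C) -> `|l| <= C.
  by move=> fl H; apply: (cvgr_to_le (cvg_norm fl)).
exists L; split.
- move=> f g bf bg; rewrite {1}/L; apply: cvg_lim => //.
  under [X in X @ U --> _]funext do rewrite grid_avg_add.
  by apply: cvgD; exact: cvL.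
- move=> a f bf; rewrite {1}/L; apply: cvg_lim => //.
  under [X in X @ U --> _]funext do rewrite grid_avg_scale.
  by apply: cvgM; [exact: cvg_cst|exact: cvL].
- move=> f /cvL H f0; apply: (cvgr_to_ge H); apply: nearW => k; exact: grid_avg_ge0.
- move=> f C H; have /cvL HL : bounded_on (cube c 3) f by exists C.
  by apply: (near_le f) => //; apply: nearW => k; exact: grid_avg_le.
- move=> i g g' /cvL HL [C Hq] H0; apply/eqP; rewrite -normr_le0; apply/ler_addgt0Pr => e e0.
  rewrite add0r; apply: (near_le g') => //; apply: sU.
  have C1 : 0 < `|C| + 1 by rewrite ltr_wpDl.
  exists (Num.truncn (6 * (`|C| + 1) / e)).+1 => // k /= Nk.
  apply: (le_trans (grid_avg_derive k Hq H0)); rewrite ler_pdivrMr//.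
  apply: (@le_trans _ _ (6 * (`|C| + 1))).
    by rewrite ler_wpM2l// (le_trans (ler_norm C))// lerDl.
  rewrite -ler_pdivrMl// [e^-1 * _]mulrC; apply: ltW.
  apply: (lt_le_trans (truncnS_gt _)).
  by rewrite ler_nat; apply: (leq_trans Nk); rewrite /grid_size; lia.
- move=> f /cvL H f0 f1; apply: (cvgr_to_ge H); apply: nearW => k; exact: grid_avg_box.
Qed.

End Construction.

End Mean.

(** * Test functions and differentiation under the mean *)

Section MeanTheory.
Variable R : realType.
Implicit Types (f g : 'rV[R]_4 -> R) (c x y z w : 'rV[R]_4) (Q : set 'rV[R]_4).

Lemma bounded_add Q f g : bounded_on Q f -> bounded_on Q g -> bounded_on Q (fun z => f z + g z).
Proof.
move=> [C HC] [D HD]; exists (C + D) => z Qz.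
by apply: (le_trans (ler_normD _ _)); apply: lerD; [exact: HC|exact: HD].
Qed.

Lemma bounded_mul Q f g : bounded_on Q f -> bounded_on Q g -> bounded_on Q (fun z => f z * g z).
Proof.
move=> [C HC] [D HD]; exists (C * D) => z Qz.
by rewrite normrM; apply: ler_pM => //; [exact: HC|exact: HD].
Qed.

Lemma bounded_cst Q (a : R) : bounded_on Q (fun=> a).
Proof. by exists `|a|. Qed.

Lemma bounded_opp Q f : bounded_on Q f -> bounded_on Q (fun z => - f z).
Proof. by move=> [C HC]; exists C => z Qz; rewrite normrN HC. Qed.

Lemma bounded_sub Q f g : bounded_on Q f -> bounded_on Q g -> bounded_on Q (fun z => f z - g z).
Proof. by move=> bf bg; apply: bounded_add => //; exact: bounded_opp. Qed.

Section Fixed.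
Variables (c : 'rV[R]_4) (L : ('rV[R]_4 -> R) -> R).
Hypothesis HL : is_mean c L.
Local Notation Q := (cube c 3).

Lemma mean_opp f : bounded_on Q f -> L (fun z => - f z) = - L f.
Proof.
move=> bf; rewrite -mulN1r -(mean_scale HL)//; congr L.
by apply/funext => z; rewrite mulN1r.
Qed.

Lemma mean_sub f g : bounded_on Q f -> bounded_on Q g -> L (fun z => f z - g z) = L f - L g.
Proof.
move=> bf bg; rewrite (mean_add HL)//; last exact: bounded_opp.
by rewrite mean_opp.
Qed.

Lemma mean_dist f g (C : R) : bounded_on Q f -> bounded_on Q g ->
  (forall z, Q z -> `|f z - g z| <= C) -> `|L f - L g| <= C.
Proof. by move=> bf bg H; rewrite -mean_sub//; exact: (mean_le HL). Qed.

Lemma mean_ext f g : bounded_on Q f -> (forall z, Q z -> f z = g z) -> L f = L g.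
Proof.
move=> [C HC] fg; apply/eqP; rewrite -subr_eq0 -normr_le0; apply: mean_dist.
- by exists C.
- by exists C => z Qz; rewrite -fg// HC.
- by move=> z Qz; rewrite fg// subrr normr0.
Qed.

Lemma mean_mono f g : bounded_on Q f -> bounded_on Q g ->
  (forall z, Q z -> f z <= g z) -> L f <= L g.
Proof.
move=> bf bg fg; rewrite -subr_ge0 -mean_sub//; apply: (mean_ge0 HL).
  exact: bounded_sub.
by move=> z Qz; rewrite subr_ge0 fg.
Qed.

Lemma mean_sum (I : Type) (r : seq I) (f : I -> 'rV[R]_4 -> R) : (forall i, bounded_on Q (f i)) ->
  L (fun z => \sum_(i <- r) f i z) = \sum_(i <- r) L (f i).
Proof.
move=> bf; elim: r => [|a r IH].
  rewrite big_nil; under [X in L X]funext do rewrite big_nil.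
  by apply/eqP; rewrite -normr_le0; apply: (mean_le HL) => z _; rewrite normr0.
rewrite big_cons -IH -(mean_add HL)//; last first.
  elim: r {IH} => [|b r IH]; first by exists 0 => z _; rewrite big_nil normr0.
  have [C HC] := bounded_add (bf b) IH.
  by exists C => z Qz; rewrite big_cons HC.
by congr L; apply/funext => z; rewrite big_cons.
Qed.

Lemma cube_segment z i (h t : R) : Q z -> Q (z + h *: 'e_i) -> 0 <= t <= 1 -> Q (z + (t * h) *: 'e_i).
Proof.
rewrite /cube /= => z1 z2 /andP[t0 t1].
have -> : z + (t * h) *: 'e_i - c = (1 - t) *: (z - c) + t *: (z + h *: 'e_i - c).
  by apply/rowP => j; rewrite !mxE; ring.
apply: (le_trans (ler_normD _ _)); rewrite !normrZ.
have -> : 3 = (1 - t) * 3 + t * 3 :> R by ring.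
by apply: lerD; rewrite ger0_norm ?subr_ge0// ler_wpM2l ?subr_ge0.
Qed.

Lemma mean_derive_C2 i g g' g'' :
  (forall z, Q z -> is_derive z 'e_i g (g' z)) ->
  (forall z, Q z -> is_derive z 'e_i g' (g'' z)) ->
  bounded_on Q g' -> bounded_on Q g'' ->
  (forall z, 5 / 2 <= `|z - c| -> g z = 0 /\ g' z = 0) -> L g' = 0.
Proof.
move=> d1 d2 b1 [C HC] H0; apply: (mean_derive HL b1 _ H0); exists C => z h Qz Qh.
apply: (@taylor2 _ _ g g' g'' z 'e_i h C) => t t01; have Qt := cube_segment Qz Qh t01.
by split; [exact: d1|exact: d2|exact: HC].
Qed.

End Fixed.

(** The radius 1/2 leaves a margin in the cube of radius 3: a point y with |y - c| >= 1 keeps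
    distance 1/2 from the support, and one with |y - c| < 1 keeps distance 1 from the zone |z - c|
    >= 5/2. *)
Definition testfun c f := smooth setT f /\ forall z, 1 / 2 < `|z - c| -> f z = 0.

Lemma open_dist_gt c (r : R) : open [set z : 'rV[R]_4 | r < `|z - c|].
Proof.
rewrite openE => z /= rz; apply/nbhs_ballP; exists (`|z - c| - r); first by rewrite /= subr_gt0.
move=> y; rewrite -ball_normE /ball_ /= ltrBrDl -ltrBrDr => H.
apply: (lt_le_trans H); rewrite lerBlDr.
have -> : z - c = (y - c) + (z - y) by rewrite [RHS]addrC addrA subrK.
exact: ler_normD.
Qed.

Lemma testfun_partial c f i : testfun c f -> testfun c (partial i (f : _ -> R)).
Proof.
move=> [sf f0]; split; first exact: smooth_partial.
move=> z zc; apply: is_derive_partial.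
have E y : [set y : 'rV[R]_4 | 1 / 2 < `|y - c|] y -> (fun=> 0) y = f y by move=> /f0 ->.
exact: (is_derive_open (@open_dist_gt c (1 / 2)) zc E (is_derive_const 0 z 'e_i)).
Qed.

Lemma testfun_pd c f s : testfun c f -> testfun c (pd s f).
Proof. by move=> tf; elim: s => //= i s; exact: testfun_partial. Qed.

Lemma testfun_derive c f i z : testfun c f -> is_derive z 'e_i f (partial i (f : _ -> R) z).
Proof. by move=> [sf _]; exact: smooth_is_derive sf _. Qed.

Lemma testfun_bounded c f : testfun c f -> exists2 C : R, 0 <= C & forall z, `|f z| <= C.
Proof.
move=> [sf f0].
have cK : compact (cube c 1 : set 'rV[R]_4).
  apply: bounded_closed_compact.
    exists (`|c| + 1); split; first exact: num_real.
    move=> M cM z /= zc; apply: le_trans (ltW cM).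
    by rewrite -[z](subrK c) addrC (le_trans (ler_normD _ _))// lerD2l.
  rewrite -[X in closed X]setCK closedC.
  rewrite (_ : ~` _ = [set z | 1 < `|z - c|]); first exact: open_dist_gt.
  by apply/seteqP; split => z /=; rewrite ltNge => /negP.
have [M [_ HM]] : bounded_set (f @` cube c 1).
  apply: compact_bounded; apply: continuous_compact cK.
  apply: continuous_subspaceT => z; exact: (smooth_continuous sf).
exists (`|M| + 1); first by rewrite addr_ge0.
move=> z; have [zc|/f0 ->] := leP `|z - c| (1 / 2); last by rewrite normr0 addr_ge0.
apply: (HM (`|M| + 1)) => /=; first by rewrite (le_lt_trans (ler_norm M))// ltrDl.
by exists z => //; rewrite /cube /=; apply: (le_trans zc); lra.
Qed.

Lemma testfun_bounded_on c f Q : testfun c f -> bounded_on Q f.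
Proof. by move=> /testfun_bounded[C _ HC]; exists C => z _; exact: HC. Qed.

(** A bound on the second derivative of the kernel, uniform in z, gives a Taylor error C h^2 uniform
    in z, which the mean preserves. The result is stated through f' so that the derivative can be
    given after an integration by parts. *)
Lemma kernel_derive c L f i y (k k1 k2 : 'rV[R]_4 -> 'rV[R]_4 -> R) f' (r C : R) :
  is_mean c L -> 0 < r -> bounded_on (cube c 3) f ->
  (forall w z, cube c 3 z -> `|w - y| < r -> f z != 0 ->
    [/\ is_derive w 'e_i (k^~ z) (k1 w z), is_derive w 'e_i (k1^~ z) (k2 w z) &
     [/\ `|k w z| <= C, `|k1 w z| <= C & `|k2 w z| <= C]]) ->
  L (fun z => k1 y z * f z) = L f' ->
  is_derive y 'e_i (fun y => L (fun z => k y z * f z)) (L f').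
Proof.
move=> HL r0 [B HB] H <-.
have bd (h : 'rV[R]_4 -> R) : (forall z, cube c 3 z -> f z != 0 -> `|h z| <= C) ->
    bounded_on (cube c 3) (fun z => h z * f z).
  move=> Hh; exists (`|C| * B) => z Qz; have [->|fz] := eqVneq (f z) 0.
    by rewrite mulr0 normr0 mulr_ge0// (le_trans _ (HB z Qz)).
  by rewrite normrM ler_pM ?HB// (le_trans (Hh z Qz fz))// ler_norm.
apply: (@is_derive_quad _ _ _ _ _ _ r (`|C| * B)) => // h hr.
have nb (t : R) : 0 <= t <= 1 -> `|y + (t * h) *: 'e_i - y| < r.
  move=> /andP[t0 t1]; rewrite [y + _]addrC addrK (le_lt_trans (norm_scale_e _ _))//.
  by rewrite (le_lt_trans _ hr)// normrM ger0_norm// ler_piMl.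
have nh : `|y + h *: 'e_i - y| < r by have := nb 1; rewrite mul1r; apply; rewrite lexx ler01.
have ny : `|y - y| < r by rewrite subrr normr0.
have b1 : bounded_on (cube c 3) (fun z => k (y + h *: 'e_i) z * f z).
  by apply: bd => z Qz fz; have [_ _ []] := H _ z Qz nh fz.
have b2 : bounded_on (cube c 3) (fun z => k y z * f z).
  by apply: bd => z Qz fz; have [_ _ []] := H _ z Qz ny fz.
have b3 : bounded_on (cube c 3) (fun z => k1 y z * f z).
  by apply: bd => z Qz fz; have [_ _ []] := H _ z Qz ny fz.
have b4 : bounded_on (cube c 3) (fun z => h * (k1 y z * f z)).
  by apply: bounded_mul => //; exact: bounded_cst.
rewrite -(mean_sub HL b1 b2) -(mean_scale HL _ b3) -(mean_sub HL (bounded_sub b1 b2) b4).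
apply: (mean_le HL) => z Qz; have [->|fz] := eqVneq (f z) 0.
  by rewrite !mulr0 !subrr normr0 mulr_ge0 ?sqr_ge0// mulr_ge0// (le_trans _ (HB z Qz)).
have -> (a b d e : R) : a * d - b * d - h * (e * d) = (a - b - h * e) * d by ring.
rewrite normrM mulrAC ler_pM ?HB//.
apply: (@taylor2 _ _ (k^~ z) (k1^~ z) (k2^~ z) y 'e_i h `|C|) => t t01.
have [d1 d2 [_ _ d3]] := H _ z Qz (nb t t01) fz; split => //.
exact: (le_trans d3 (ler_norm _)).
Qed.

End MeanTheory.

(** * The Newton potential *)

Section Profile.
Variable R : realType.
Implicit Types (s t x d : R).

Definition piecewise x (f1 f2 : R -> R) s : R := if s < x then f1 s else f2 s.

Lemma is_derive_glue (f1 f2 : R -> R) x d : is_derive x 1 f1 d -> is_derive x 1 f2 d ->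
  f1 x = f2 x -> is_derive x 1 (piecewise x f1 f2) d.
Proof.
move=> /is_deriveP H1 /is_deriveP H2 E; apply/is_deriveP => e e0.
have [r1 r10 K1] := H1 e e0; have [r2 r20 K2] := H2 e e0.
exists (Num.min r1 r2) => [|h]; rewrite lt_min ?r10// => /andP[/K1 k1 /K2 k2].
by rewrite /piecewise ltxx; case: ifP; rewrite -?E // E.
Qed.

Lemma is_derive_piecewise (f1 f2 f1' f2' : R -> R) x :
  (forall s, s <= x -> is_derive s 1 f1 (f1' s)) ->
  (forall s, x <= s -> is_derive s 1 f2 (f2' s)) -> f1 x = f2 x -> f1' x = f2' x ->
  forall s, is_derive s 1 (piecewise x f1 f2) (piecewise x f1' f2' s).
Proof.
move=> D1 D2 E E' s; rewrite [piecewise _ f1' _ s]/piecewise; have [sx|xs|->] := ltgtP s x.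
- apply: (@is_derive_near _ _ f1 _ _ _ _ (x - s)) (D1 s (ltW sx)); rewrite ?subr_gt0// => h hr.
  rewrite /piecewise [h%:A]mulr1 ifT//; have := ler_norm h; move: hr; set k := `|h|; lra.
- apply: (@is_derive_near _ _ f2 _ _ _ _ (s - x)) (D2 s (ltW xs)); rewrite ?subr_gt0// => h hr.
  rewrite /piecewise [h%:A]mulr1 ifF//; apply/negbTE; rewrite -leNgt.
  have := ler_norm (- h); rewrite normrN; move: hr; set k := `|h|; lra.
- apply: is_derive_glue => //; last exact: D2.
  by rewrite -E'; exact: D1.
Qed.

Lemma is_derive_idR s : is_derive s 1 (fun s : R => s) 1.
Proof. exact: is_derive_id. Qed.

Lemma is_derive_invR s : s != 0 -> is_derive s 1 (fun s : R => s^-1) (- (s^-1 * s^-1)).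
Proof.
move=> s0.
have E : - s ^- 2 *: (1 : R) = - (s^-1 * s^-1) by rewrite [LHS]mulr1 -exprVn expr2.
exact: (is_derive_eq (is_deriveV s0 (is_derive_idR s)) E).
Qed.

(* 1/s for s >= 1, continued by its Taylor polynomial of degree 4 at 1: [a * prof (a * |v|^2)] is a
   regularised Newton kernel. *)
Definition prof : R -> R := piecewise 1 (fun s => 5 - 10 * s + 10 * (s * s) - 5 * (s * s * s) + s * s * s * s) (fun s => s^-1).
Definition prof1 : R -> R := piecewise 1 (fun s => - 10 + 20 * s - 15 * (s * s) + 4 * (s * s * s)) (fun s => - (s^-1 * s^-1)).
Definition prof2 : R -> R := piecewise 1 (fun s => 20 - 30 * s + 12 * (s * s)) (fun s => 2 * (s^-1 * s^-1 * s^-1)).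
Definition prof3 : R -> R := piecewise 1 (fun s => - 30 + 24 * s) (fun s => - 6 * (s^-1 * s^-1 * s^-1 * s^-1)).
Definition bump3 : R -> R := piecewise 1 (fun s => (1 - s) * (1 - s) * (1 - s)) (fun s => 0).
Definition bump3' : R -> R := piecewise 1 (fun s => - 3 * ((1 - s) * (1 - s))) (fun s => 0).
Definition bump3'' : R -> R := piecewise 1 (fun s => 6 * (1 - s)) (fun s => 0).

Ltac dtac := repeat (first [exact: is_derive_idR | exact: is_derive_const
  | apply: is_derive_invR | apply: is_derive_add | apply: is_derive_sub | apply: is_derive_opp | apply: is_derive_mul]).

Lemma is_derive_prof s : is_derive s 1 prof (prof1 s).
Proof.
apply: is_derive_piecewise => [t _|t t1||]; rewrite ?invr1; try ring.
- eapply is_derive_eq; [dtac|rewrite /GRing.scale /=; ring].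
- by apply: is_derive_invR; rewrite gt_eqF// (lt_le_trans _ t1).
Qed.

Lemma is_derive_prof1 s : is_derive s 1 prof1 (prof2 s).
Proof.
apply: is_derive_piecewise => [t _|t t1||]; rewrite ?invr1; try ring.
- by eapply is_derive_eq; [dtac|rewrite /GRing.scale /=; ring].
- have t0 : t != 0 by rewrite gt_eqF// (lt_le_trans _ t1).
  by eapply is_derive_eq; [dtac|rewrite /GRing.scale /=; ring].
Qed.

Lemma is_derive_prof2 s : is_derive s 1 prof2 (prof3 s).
Proof.
apply: is_derive_piecewise => [t _|t t1||]; rewrite ?invr1; try ring.
- by eapply is_derive_eq; [dtac|rewrite /GRing.scale /=; ring].
- have t0 : t != 0 by rewrite gt_eqF// (lt_le_trans _ t1).
  by eapply is_derive_eq; [dtac|rewrite /GRing.scale /=; ring].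
Qed.

Lemma is_derive_bump3 s : is_derive s 1 bump3 (bump3' s).
Proof.
have D1 t : t <= 1 -> is_derive t 1 (fun s : R => (1 - s) * (1 - s) * (1 - s)) (- 3 * ((1 - t) * (1 - t))).
  by move=> _; eapply is_derive_eq; [dtac|rewrite /GRing.scale /=; ring].
have D2 t : 1 <= t -> is_derive t 1 (fun=> 0 : R) 0 by move=> _; exact: is_derive_const.
apply: (is_derive_piecewise (f1' := fun t => - 3 * ((1 - t) * (1 - t))) (f2' := fun=> 0) D1 D2).
  by rewrite subrr mulr0.
by rewrite subrr !mulr0.
Qed.

Lemma is_derive_bump3' s : is_derive s 1 bump3' (bump3'' s).
Proof.
have D1 t : t <= 1 -> is_derive t 1 (fun s : R => - 3 * ((1 - s) * (1 - s))) (6 * (1 - t)).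
  by move=> _; eapply is_derive_eq; [dtac|rewrite /GRing.scale /=; ring].
have D2 t : 1 <= t -> is_derive t 1 (fun=> 0 : R) 0 by move=> _; exact: is_derive_const.
apply: (is_derive_piecewise (f1' := fun t => 6 * (1 - t)) (f2' := fun=> 0) D1 D2).
  by rewrite subrr !mulr0.
by rewrite subrr mulr0.
Qed.

Lemma profile_bounds s : 0 <= s ->
  [/\ `|prof s| <= 100, `|prof1 s| <= 100, `|prof2 s| <= 100, `|prof3 s| <= 100 &
   [/\ 0 <= bump3 s, bump3 s <= 1, `|bump3 s| <= 100, `|bump3' s| <= 100 & `|bump3'' s| <= 100]].
Proof.
move=> s0; rewrite /prof /prof1 /prof2 /prof3 /bump3 /bump3' /bump3'' /piecewise.
case: ltP => s1.
- have a2 : 0 <= s * s <= 1 by rewrite mulr_ge0// mulr_ile1// ltW.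
  have a3 : 0 <= s * s * s <= 1.
    by case/andP: a2 => ? ?; rewrite mulr_ge0//= mulr_ile1// ltW.
  have a4 : 0 <= s * s * s * s <= 1.
    by case/andP: a3 => ? ?; rewrite mulr_ge0//= mulr_ile1// ltW.
  have w0 : 0 <= 1 - s by rewrite subr_ge0 ltW.
  have w1 : 1 - s <= 1 by rewrite gerBl.
  have b2 : 0 <= (1 - s) * (1 - s) <= 1 by rewrite mulr_ge0//= mulr_ile1.
  have b3 : 0 <= (1 - s) * (1 - s) * (1 - s) <= 1.
    by case/andP: b2 => ? ?; rewrite mulr_ge0//= mulr_ile1.
  move: a2 a3 a4 b2 b3.
  set p2 := s * s; set p3 := p2 * s; set p4 := p3 * s; set q2 := (1 - s) * (1 - s); set q3 := q2 * (1 - s).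
  move=> /andP[? ?] /andP[? ?] /andP[? ?] /andP[? ?] /andP[? ?].
  by rewrite !ler_norml; split; [lra|lra|lra|lra|split; lra].
- have t0 : 0 <= s^-1 by rewrite invr_ge0.
  have t1 : s^-1 <= 1 by rewrite invf_le1// (lt_le_trans _ s1).
  have a2 : 0 <= s^-1 * s^-1 <= 1 by rewrite mulr_ge0//= mulr_ile1.
  have a3 : 0 <= s^-1 * s^-1 * s^-1 <= 1.
    by case/andP: a2 => ? ?; rewrite mulr_ge0//= mulr_ile1.
  have a4 : 0 <= s^-1 * s^-1 * s^-1 * s^-1 <= 1.
    by case/andP: a3 => ? ?; rewrite mulr_ge0//= mulr_ile1.
  move: t0 t1 a2 a3 a4; set p1 := s^-1.
  set p2 := p1 * p1; set p3 := p2 * p1; set p4 := p3 * p1.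
  move=> ? ? /andP[? ?] /andP[? ?] /andP[? ?].
  by rewrite !ler_norml; split; [lra|lra|lra|lra|split; lra].
Qed.

(** The left-hand side is the Laplacian on R^4 of prof(|v|^2) at |v|^2 = s. Since 1/|v|^2 is
    harmonic, only the polynomial part contributes. *)
Lemma prof_laplace s : 0 <= s -> 8 * prof1 s + 4 * s * prof2 s = - 80 * bump3 s.
Proof.
move=> s0; rewrite /prof1 /prof2 /bump3 /piecewise; case: ltP => s1; first by ring.
by field; rewrite gt_eqF// (lt_le_trans _ s1).
Qed.

(** It makes the regularised kernels increase when the scale is multiplied by 4. Below 1 the profile
    is (1 - (1 - s)^5) / s, hence at most 1/s, which settles the case where only 4s has passed 1. *)
Lemma prof_monotone s : 0 <= s -> prof s <= 4 * prof (4 * s).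
Proof.
move=> s0; rewrite /prof /piecewise; case: ltP => s1; case: ltP => s4.
(* In terms of the distance u to the end of the interval, the difference is a polynomial with
   positive coefficients. *)
- pose u := 1 / 4 - s; have u0 : 0 <= u by rewrite /u; lra.
  rewrite -subr_ge0; set D := (X in 0 <= X).
  have -> : D = 243 / 256 + 81 / 8 * u + 459 / 8 * u ^+ 2 + 252 * u ^+ 3 + 1023 * u ^+ 4.
    by rewrite /D /u; field.
  have := exprn_ge0 2 u0; have := exprn_ge0 3 u0; have := exprn_ge0 4 u0.
  move: (u ^+ 2) (u ^+ 3) (u ^+ 4) => a b d; lra.
- have sp : 0 < s by lra.
  have -> : 4 * (4 * s)^-1 = s^-1 by field; rewrite gt_eqF.
  rewrite -[s^-1]mul1r ler_pdivlMr// -subr_ge0.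
  set D := (X in 0 <= X); have -> : D = (1 - s) ^+ 4 * (1 - s) by rewrite /D; ring.
  have w0 : 0 <= 1 - s by rewrite subr_ge0 ltW.
  by rewrite mulr_ge0// exprn_ge0.
- by lra.
- have sp : 0 < s by lra.
  suff -> : 4 * (4 * s)^-1 = s^-1 by [].
  by field; rewrite gt_eqF.
Qed.

End Profile.

(** * Regularised Newton kernels and their densities *)

Section NewtonKernel.
Variable R : realType.
Implicit Types (f g : 'rV[R]_4 -> R) (c x y z w v : 'rV[R]_4) (a : R).

Lemma is_derive_translate (G : 'rV[R]_4 -> R) w z v (d : R) :
  is_derive (w - z) v G d -> is_derive w v (fun w => G (w - z)) d.
Proof.
move=> /is_deriveP H; apply/is_deriveP => e /H[r r0 Hr]; exists r => // h /Hr.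
by rewrite [_ - z + _]addrAC.
Qed.

Lemma is_derive_reflect (G : 'rV[R]_4 -> R) y z v (d : R) :
  is_derive (y - z) v G d -> is_derive z v (fun z => G (y - z)) (- d).
Proof.
move=> /is_deriveP H; apply/is_deriveP => e /H[r r0 Hr]; exists r => // h hr.
have := Hr (- h); rewrite normrN => /(_ hr).
by rewrite scaleNr opprD addrA mulNr mulrN.
Qed.

Definition sq v : R := \sum_i v 0 i * v 0 i.

Lemma sq_ge0 v : 0 <= sq v.
Proof. by apply: sumr_ge0 => i _; rewrite -expr2 sqr_ge0. Qed.

(** The norm is the maximum norm while the kernels depend on the Euclidean length; this and
    [sq_le_norm] compare the two, at the cost of a factor 4. *)
Lemma norm_sq_le v : `|v| ^+ 2 <= sq v.
Proof.
have [->|v0] := eqVneq v 0; first by rewrite normr0 expr0n sq_ge0.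
have v0' : mx_norm v != 0 by rewrite -[mx_norm v]/(`|v|) normr_eq0.
have [[i j] E] := mx_norm_neq0 v0'.
rewrite -[`|v|]/(mx_norm v) E ord1 /= real_normK ?num_real// expr2 /sq (bigD1 j)//= lerDl.
by apply: sumr_ge0 => k _; rewrite -expr2 sqr_ge0.
Qed.

Lemma sq_le_norm v : sq v <= 4 * `|v| ^+ 2.
Proof.
rewrite /sq (_ : 4 * _ = \sum_(i < 4) `|v| ^+ 2); last by rewrite sumr_const card_ord mulr_natl.
apply: ler_sum => i _; rewrite -expr2 -real_normK ?num_real//.
by rewrite ler_pXn2r ?nnegrE//; exact: coord_le_norm.
Qed.

Lemma is_derive_sq v i : is_derive v 'e_i sq (2 * v 0 i).
Proof.
apply: (@is_derive_quad _ _ _ _ _ _ 1 1) => // h _.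
have -> : sq (v + h *: 'e_i) = sq v + (2 * h * v 0 i + h ^+ 2).
  rewrite /sq (bigD1 i)//= [in RHS](bigD1 i)//= mxE scale_e_coord eqxx.
  rewrite (eq_bigr (fun j => v 0 j * v 0 j)) => [|j /negbTE ji]; first by ring.
  by rewrite mxE scale_e_coord ji addr0.
have -> : sq v + (2 * h * v 0 i + h ^+ 2) - sq v - h * (2 * v 0 i) = h ^+ 2 by ring.
by rewrite mul1r ger0_norm// sqr_ge0.
Qed.

Lemma is_derive_radial (p p1 : R -> R) (a : R) v i : (forall s : R, is_derive s 1 p (p1 s)) ->
  is_derive v 'e_i (fun v => p (a * sq v)) (p1 (a * sq v) * (2 * a * v 0 i)).
Proof.
move=> dp; apply: (is_derive_comp1 (f := fun v => a * sq v) (dp _)).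
have E : 0 * sq v + a * (2 * v 0 i) = 2 * a * v 0 i by ring.
exact: (is_derive_eq (is_derive_mul (is_derive_const a v 'e_i) (is_derive_sq v i)) E).
Qed.

(** The kernel equals 1/|v|^2 as soon as a |v|^2 >= 1. [nk1], [nk2] and [nk3] are its successive
    derivatives along the i-th axis; the third one bounds the Taylor error when [nk2] is integrated
    by parts. *)
Definition nk a v : R := a * prof (a * sq v).
Definition nk1 a i v : R := 2 * a ^+ 2 * v 0 i * prof1 (a * sq v).
Definition nk2 a i v : R := 2 * a ^+ 2 * prof1 (a * sq v) + 4 * a ^+ 3 * v 0 i ^+ 2 * prof2 (a * sq v).
Definition nk3 a i v : R := 12 * a ^+ 3 * v 0 i * prof2 (a * sq v) + 8 * a ^+ 4 * v 0 i ^+ 3 * prof3 (a * sq v).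

Lemma is_derive_coord1 v i : is_derive v 'e_i (fun v => v 0 i) (1 : R).
Proof. by have := is_derive_coord i i v; rewrite eqxx. Qed.

Lemma is_derive_nk a i v : is_derive v 'e_i (nk a) (nk1 a i v).
Proof.
have E : 0 * prof (a * sq v) + a * (prof1 (a * sq v) * (2 * a * v 0 i)) = nk1 a i v.
  by rewrite /nk1; move: (prof _) (prof1 _) (v 0 i) => p q t; ring.
exact: (is_derive_eq (is_derive_mul (is_derive_const a v 'e_i)
  (is_derive_radial a v i (@is_derive_prof R))) E).
Qed.

Lemma is_derive_nk1 a i v : is_derive v 'e_i (nk1 a i) (nk2 a i v).
Proof.
have D := is_derive_mul (is_derive_mul (is_derive_const (2 * a ^+ 2) v 'e_i) (is_derive_coord1 v i))
  (is_derive_radial a v i (@is_derive_prof1 R)).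
apply: (is_derive_eq D); rewrite /nk2; move: (prof1 _) (prof2 _) (v 0 i) => p q t; ring.
Qed.

Lemma is_derive_nk2 a i v : is_derive v 'e_i (nk2 a i) (nk3 a i v).
Proof.
have D2 := is_derive_mul (is_derive_const (4 * a ^+ 3) v 'e_i) (is_derive_mul (is_derive_coord1 v i) (is_derive_coord1 v i)).
have D := is_derive_add (is_derive_mul (is_derive_const (2 * a ^+ 2) v 'e_i) (is_derive_radial a v i (@is_derive_prof1 R)))
  (is_derive_mul D2 (is_derive_radial a v i (@is_derive_prof2 R))).
apply: (is_derive_eq D); rewrite /nk3; move: (prof1 _) (prof2 _) (prof3 _) (v 0 i) => p q r t; ring.
Qed.

(** The Laplacian of [nk a]: nonpositive and concentrated where a |v|^2 < 1, it plays the part of a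
    multiple of the Dirac mass as a grows. *)
Definition dens a v : R := - 80 * a ^+ 2 * bump3 (a * sq v).
Definition dens1 a i v : R := - 160 * a ^+ 3 * v 0 i * bump3' (a * sq v).
Definition dens2 a i v : R := - 160 * a ^+ 3 * bump3' (a * sq v) - 320 * a ^+ 4 * v 0 i ^+ 2 * bump3'' (a * sq v).

Lemma is_derive_dens a i v : is_derive v 'e_i (dens a) (dens1 a i v).
Proof.
have D := is_derive_mul (is_derive_const (- 80 * a ^+ 2) v 'e_i)
  (is_derive_radial a v i (@is_derive_bump3 R)).
by apply: (is_derive_eq D); rewrite /dens1; move: (bump3 _) (bump3' _) (v 0 i) => p q t; ring.
Qed.

Lemma is_derive_dens1 a i v : is_derive v 'e_i (dens1 a i) (dens2 a i v).
Proof.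
have D := is_derive_mul (is_derive_mul (is_derive_const (- 160 * a ^+ 3) v 'e_i) (is_derive_coord1 v i))
  (is_derive_radial a v i (@is_derive_bump3' R)).
by apply: (is_derive_eq D); rewrite /dens2; move: (bump3' _) (bump3'' _) (v 0 i) => p q t; ring.
Qed.

Lemma laplace_nk a v : 0 <= a -> \sum_i nk2 a i v = dens a v.
Proof.
move=> a0; rewrite /nk2 big_split /= sumr_const card_ord.
have -> : \sum_(i < 4) 4 * a ^+ 3 * v 0 i ^+ 2 * prof2 (a * sq v) = 4 * a ^+ 3 * sq v * prof2 (a * sq v).
  by move: (prof2 _) => q; rewrite /sq mulr_sumr mulr_suml; apply: eq_bigr => i _; rewrite expr2.
have := prof_laplace (mulr_ge0 a0 (sq_ge0 v)); rewrite /dens.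
set s := sq v; set p := prof1 (a * s); set q := prof2 (a * s); set b := bump3 (a * s) => E.
have -> : - 80 * a ^+ 2 * b = a ^+ 2 * (- 80 * b) by ring.
by rewrite -E -mulr_natl; ring.
Qed.

Definition ball_bounded (G : 'rV[R]_4 -> R) := forall B : R, exists C : R, forall v, `|v| <= B -> `|G v| <= C.

Lemma ball_bounded_mul G H : ball_bounded G -> ball_bounded H -> ball_bounded (fun v => G v * H v).
Proof.
move=> bG bH B; have [C HC] := bG B; have [D HD] := bH B; exists (C * D) => v vB.
by rewrite normrM ler_pM// ?HC ?HD.
Qed.

Lemma ball_bounded_add G H : ball_bounded G -> ball_bounded H -> ball_bounded (fun v => G v + H v).
Proof.
move=> bG bH B; have [C HC] := bG B; have [D HD] := bH B; exists (C + D) => v vB.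
by apply: (le_trans (ler_normD _ _)); rewrite lerD// ?HC ?HD.
Qed.

Lemma ball_bounded_sub G H : ball_bounded G -> ball_bounded H -> ball_bounded (fun v => G v - H v).
Proof.
move=> bG bH; apply: ball_bounded_add => // B; have [C HC] := bH B.
by exists C => v vB; rewrite normrN HC.
Qed.

Lemma ball_bounded_cst (a : R) : ball_bounded (fun=> a).
Proof. by move=> B; exists `|a|. Qed.

Lemma ball_bounded_coord i : ball_bounded (fun v => v 0 i).
Proof. by move=> B; exists B => v vB; exact: le_trans (coord_le_norm v i) vB. Qed.

Lemma ball_bounded_exp G n : ball_bounded G -> ball_bounded (fun v => G v ^+ n).
Proof.
move=> bG; elim: n => [|n IH]; first exact: ball_bounded_cst.
by under eq_fun do rewrite exprS; exact: ball_bounded_mul.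
Qed.

Lemma ball_bounded_radial (p : R -> R) a : 0 <= a -> (forall s : R, 0 <= s -> `|p s| <= 100) ->
  ball_bounded (fun v => p (a * sq v)).
Proof. by move=> a0 H B; exists 100 => v _; apply: H; rewrite mulr_ge0// sq_ge0. Qed.

Lemma ball_bounded_sq : ball_bounded sq.
Proof.
move=> B; exists (4 * B ^+ 2) => v vB; rewrite ger0_norm ?sq_ge0// (le_trans (sq_le_norm v))//.
by rewrite ler_wpM2l// ler_pXn2r ?nnegrE// (le_trans _ vB).
Qed.

Ltac bbtac := repeat (first [exact: ball_bounded_coord | exact: ball_bounded_cst | exact: ball_bounded_sq
  | apply: ball_bounded_sub | apply: ball_bounded_add | apply: ball_bounded_exp | apply: ball_bounded_mul
  | apply: ball_bounded_radial => // ? /profile_bounds[? ? ? ? [? ? ? ? ?]] // ]).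

Lemma ball_bounded_kernels a i : 0 <= a -> [/\ ball_bounded (nk a), ball_bounded (nk1 a i),
  ball_bounded (nk2 a i), ball_bounded (nk3 a i) &
  [/\ ball_bounded (dens a), ball_bounded (dens1 a i) & ball_bounded (dens2 a i)]].
Proof.
move=> a0; split; [| | | |split].
- by rewrite /nk; bbtac.
- by rewrite /nk1; bbtac.
- by rewrite /nk2; bbtac.
- by rewrite /nk3; bbtac.
- by rewrite /dens; bbtac.
- by rewrite /dens1; bbtac.
- by rewrite /dens2; bbtac.
Qed.

Lemma nk_far a v : 0 < a -> 1 <= a * sq v -> nk a v = (sq v)^-1.
Proof.
move=> a0 H; rewrite /nk /prof /piecewise ltNge H /=.
have s0 : 0 < sq v by rewrite -(pmulr_rgt0 _ a0) (lt_le_trans _ H).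
by field; rewrite !gt_eqF.
Qed.

Lemma nk1_far a i v : 0 < a -> 1 <= a * sq v -> nk1 a i v = - 2 * v 0 i / sq v ^+ 2.
Proof.
move=> a0 H; rewrite /nk1 /prof1 /piecewise ltNge H /=.
have s0 : 0 < sq v by rewrite -(pmulr_rgt0 _ a0) (lt_le_trans _ H).
by field; rewrite !gt_eqF.
Qed.

Lemma nk2_far a i v : 0 < a -> 1 <= a * sq v ->
  nk2 a i v = - 2 / sq v ^+ 2 + 8 * v 0 i ^+ 2 / sq v ^+ 3.
Proof.
move=> a0 H; rewrite /nk2 /prof1 /prof2 /piecewise ltNge H /=.
have s0 : 0 < sq v by rewrite -(pmulr_rgt0 _ a0) (lt_le_trans _ H).
by field; rewrite !gt_eqF.
Qed.

Lemma dens_far a v : 1 <= a * sq v -> dens a v = 0.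
Proof. by move=> H; rewrite /dens /bump3 /piecewise ltNge H /= mulr0. Qed.

Lemma dens1_far a i v : 1 <= a * sq v -> dens1 a i v = 0.
Proof. by move=> H; rewrite /dens1 /bump3' /piecewise ltNge H /= mulr0. Qed.

Lemma nk_monotone a v : 0 <= a -> nk a v <= nk (4 * a) v.
Proof.
move=> a0; rewrite /nk [4 * a]mulrC -mulrA ler_wpM2l// [a * 4]mulrC -mulrA.
by apply: prof_monotone; rewrite mulr_ge0// sq_ge0.
Qed.

End NewtonKernel.

(** * Regularised potentials and comparison of two scales *)

Section Newton.
Variable R : realType.
Implicit Types (f g : 'rV[R]_4 -> R) (x y z w v : 'rV[R]_4) (a : R).
Variables (c : 'rV[R]_4) (L : ('rV[R]_4 -> R) -> R).
Hypothesis HL : is_mean c L.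
Local Notation Q := (cube c 3).

Lemma ball_bounded_reflect (G : 'rV[R]_4 -> R) y : ball_bounded G -> bounded_on Q (fun z => G (y - z)).
Proof.
move=> /(_ (`|y - c| + 3))[C HC]; exists C => z Qz; apply: HC.
have -> : y - z = (y - c) - (z - c) by rewrite opprB addrA subrK.
by rewrite (le_trans (ler_normB _ _))// lerD2l.
Qed.

Lemma testfun_far f z : testfun c f -> 5 / 2 <= `|z - c| -> f z = 0.
Proof. by move=> [_ f0] H; apply: f0; lra. Qed.

Lemma mean_ibp (G G1 G2 : 'rV[R]_4 -> R) f i y : testfun c f ->
  (forall v, is_derive v 'e_i G (G1 v)) -> (forall v, is_derive v 'e_i G1 (G2 v)) ->
  ball_bounded G -> ball_bounded G1 -> ball_bounded G2 ->
  L (fun z => G1 (y - z) * f z) = L (fun z => G (y - z) * partial i (f : _ -> R) z).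
Proof.
move=> tf d1 d2 b0 b1 b2.
have tf1 := testfun_partial i tf; have tf2 := testfun_partial i tf1.
have B0 := ball_bounded_reflect y b0; have B1 := ball_bounded_reflect y b1.
have B2 := ball_bounded_reflect y b2.
have F0 := testfun_bounded_on Q tf; have F1 := testfun_bounded_on Q tf1.
have F2 := testfun_bounded_on Q tf2.
apply/eqP; rewrite -subr_eq0 -(mean_sub HL (bounded_mul B1 F0) (bounded_mul B0 F1)).
rewrite -oppr_eq0 -(mean_opp HL (bounded_sub (bounded_mul B1 F0) (bounded_mul B0 F1))).
apply/eqP; apply: (mean_derive_C2 HL (i := i)
  (g := fun z => G (y - z) * f z)
  (g'' := fun z => (G2 (y - z) * f z - G1 (y - z) * partial i f z) +
     (- G1 (y - z) * partial i f z + G (y - z) * partial i (partial i f) z))).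
- move=> z _.
  have D := is_derive_mul (is_derive_reflect (d1 (y - z))) (testfun_derive i z tf).
  by apply: (is_derive_eq D); rewrite opprB mulNr addrC.
- move=> z _.
  have D := is_derive_opp (is_derive_sub (is_derive_mul (is_derive_reflect (d2 (y - z))) (testfun_derive i z tf))
     (is_derive_mul (is_derive_reflect (d1 (y - z))) (testfun_derive i z tf1))).
  apply: (is_derive_eq D); move: (G (y - z)) (G1 (y - z)) (G2 (y - z)) (f z) (partial i f z) (partial i (partial i f) z).
  by move=> p q r s t u; ring.
- by apply: bounded_opp; apply: bounded_sub; exact: bounded_mul.
- apply: bounded_add; [apply: bounded_sub|apply: bounded_add]; apply: bounded_mul => //.
  exact: bounded_opp.
- move=> z zc; rewrite (testfun_far tf zc) (testfun_far tf1 zc).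
  by rewrite !mulr0 subrr oppr0.
Qed.

Definition npot a f y := L (fun z => nk a (y - z) * f z).

(** Since the derivative falls on f, all derivatives of the potential are potentials of test
    functions, and a bound uniform in a for the potentials themselves suffices at every order. *)
Lemma npot_derive a f y i : 0 <= a -> testfun c f ->
  is_derive y 'e_i (npot a f) (npot a (partial i (f : _ -> R)) y).
Proof.
move=> a0 tf; have [b0 b1 b2 _ _] := ball_bounded_kernels i a0.
have [C0 H0] := b0 (`|y - c| + 2); have [C1 H1] := b1 (`|y - c| + 2).
have [C2 H2] := b2 (`|y - c| + 2).
apply: (@kernel_derive R c L f i y (fun w z => nk a (w - z)) (fun w z => nk1 a i (w - z))
  (fun w z => nk2 a i (w - z)) (fun z => nk a (y - z) * partial i f z) 1 (Num.max C0 (Num.max C1 C2)) HL) => //.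
- exact: testfun_bounded_on tf.
- move=> w z _ wy fz; have zc : `|z - c| <= 1 / 2.
    by rewrite leNgt; apply/negP => /(proj2 tf) /eqP; apply/negP.
  have nwz : `|w - z| <= `|y - c| + 2.
    have E : w - z = (w - y) + ((y - c) - (z - c)) by apply/rowP => j; rewrite !mxE; ring.
    have n1 : `|w - z| <= `|w - y| + `|y - c - (z - c)| by rewrite [in leLHS]E ler_normD.
    have n2 := ler_normB (y - c) (z - c).
    apply: (le_trans n1); apply: (@le_trans _ _ (1 + (`|y - c| + 1 / 2))); last by lra.
    by apply: lerD; [exact: ltW|apply: (le_trans n2); rewrite lerD2l].
  split; [exact: is_derive_translate (is_derive_nk _ _ _)|exact: is_derive_translate (is_derive_nk1 _ _ _)|].
  by rewrite !le_max (H0 _ nwz) (H1 _ nwz) (H2 _ nwz) !orbT.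
- exact: mean_ibp (is_derive_nk a i) (is_derive_nk1 a i) b0 b1 b2.
Qed.

Lemma npot_laplace a f y : 0 <= a -> testfun c f ->
  \sum_i npot a (partial i (partial i (f : _ -> R))) y = L (fun z => dens a (y - z) * f z).
Proof.
move=> a0 tf.
rewrite (eq_bigr (fun i => L (fun z => nk2 a i (y - z) * f z))) => [|i _]; last first.
  have [b0 b1 b2 b3 _] := ball_bounded_kernels i a0.
  rewrite (mean_ibp y tf (is_derive_nk1 a i) (is_derive_nk2 a i) b1 b2 b3).
  by rewrite (mean_ibp y (testfun_partial i tf) (is_derive_nk a i) (is_derive_nk1 a i) b0 b1 b2).
rewrite -(mean_sum HL) => [|i].
  congr L; apply/funext => z; rewrite -mulr_suml; congr (_ * _); exact: laplace_nk.
apply: bounded_mul; last exact: testfun_bounded_on tf.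
by apply: ball_bounded_reflect; have [] := ball_bounded_kernels i a0.
Qed.

(* Hence the kernels of scales [a] and [4 a] at [y - z] agree for [z] near the boundary of the cube. *)
Lemma far_from_center a y z : 1 <= a -> `|y - c| < 1 -> 5 / 2 <= `|z - c| -> 1 <= a * sq (y - z).
Proof.
move=> a1 yc zc.
have H : 1 <= `|y - z|.
  have n1 : `|z - c| <= `|y - z| + `|y - c| by rewrite (distrC y z) ler_distD.
  have : 5 / 2 <= `|y - z| + 1 by apply: (le_trans zc); apply: (le_trans n1); rewrite lerD2l ltW.
  by lra.
have H2 : 1 <= sq (y - z) by apply: le_trans (norm_sq_le _); rewrite expr_ge1.
by apply: (le_trans H2); rewrite ler_peMl// (le_trans _ H2).
Qed.

Section Scale.
Variables (a : R) (y : 'rV[R]_4).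
Hypotheses (a1 : 1 <= a) (yc : `|y - c| < 1).
Let a0 : 0 <= a. Proof. exact: le_trans a1. Qed.
Let b1 : 1 <= 4 * a. Proof. by rewrite (le_trans a1)// ler_peMl// ler1n. Qed.
Let b0 : 0 <= 4 * a. Proof. exact: le_trans b1. Qed.

Let E0 v := nk (4 * a) v - nk a v.
Let E1 i v := nk1 (4 * a) i v - nk1 a i v.
Let E2 i v := nk2 (4 * a) i v - nk2 a i v.
Let E3 i v := nk3 (4 * a) i v - nk3 a i v.

Let E_far z : 5 / 2 <= `|z - c| -> E0 (y - z) = 0 /\ forall i, E1 i (y - z) = 0 /\ E2 i (y - z) = 0.
Proof.
move=> zc; have h := far_from_center a1 yc zc; have h4 := far_from_center b1 yc zc.
have p : 0 < a by exact: lt_le_trans a1.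
have p4 : 0 < 4 * a by exact: lt_le_trans b1.
split=> [|i]; first by rewrite /E0 !nk_far// subrr.
by rewrite /E1 !nk1_far// /E2 !nk2_far// !subrr.
Qed.

Let E_derive i z : [/\ is_derive z 'e_i (fun z => E0 (y - z)) (- E1 i (y - z)),
  is_derive z 'e_i (fun z => E1 i (y - z)) (- E2 i (y - z)) &
  is_derive z 'e_i (fun z => E2 i (y - z)) (- E3 i (y - z))].
Proof.
split; apply: is_derive_reflect; apply: is_derive_sub.
all: do ?[exact: is_derive_nk|exact: is_derive_nk1|exact: is_derive_nk2].
Qed.

Let E_bounded i : [/\ bounded_on Q (fun z => E0 (y - z)), bounded_on Q (fun z => E1 i (y - z)),
  bounded_on Q (fun z => E2 i (y - z)) & bounded_on Q (fun z => E3 i (y - z))].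
Proof.
have [? ? ? ? _] := ball_bounded_kernels i a0; have [? ? ? ? _] := ball_bounded_kernels i b0.
by split; apply: ball_bounded_reflect; exact: ball_bounded_sub.
Qed.

Let E_laplace v : \sum_i E2 i v = dens (4 * a) v - dens a v.
Proof. by rewrite sumrB !laplace_nk. Qed.

(** The two kernels agree near the boundary of the cube, so their difference can be integrated by
    parts without boundary terms and the mean of its Laplacian vanishes. *)
Lemma mass_scale : L (fun z => dens (4 * a) (y - z)) = L (fun z => dens a (y - z)).
Proof.
have [_ _ _ _ [B1 _ _]] := ball_bounded_kernels 0 a0.
have [_ _ _ _ [B2 _ _]] := ball_bounded_kernels 0 b0.
apply/eqP; rewrite -subr_eq0 -(mean_sub HL (ball_bounded_reflect y B2) (ball_bounded_reflect y B1)).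
under [X in L X]eq_fun do rewrite -E_laplace.
rewrite (mean_sum HL) => [|i]; last by have [] := E_bounded i.
rewrite big1// => i _; have [_ _ c2 c3] := E_bounded i.
rewrite -[L _]opprK -(mean_opp HL c2).
suff -> : L (fun z => - E2 i (y - z)) = 0 by rewrite oppr0.
apply: (mean_derive_C2 HL (i := i) (g := fun z => E1 i (y - z))
  (g' := fun z => - E2 i (y - z)) (g'' := fun z => - - E3 i (y - z))).
- by move=> z _; have [] := E_derive i z.
- by move=> z _; apply: is_derive_opp; have [] := E_derive i z.
- exact: bounded_opp.
- by do 2!apply: bounded_opp.
- by move=> z zc; have [_ /(_ i)[-> ->]] := E_far zc; rewrite oppr0.
Qed.

(** Green's identity for [E0] against |y - z|^2, whose Laplacian is the constant 8. It measures the
    change of the kernel from one scale to the next by the densities. *)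
Lemma mean_kernel_diff : 0 <= L (fun z => E0 (y - z)) /\
  8 * L (fun z => E0 (y - z)) = L (fun z => (dens (4 * a) (y - z) - dens a (y - z)) * sq (y - z)).
Proof.
have [B0 _ _ _] := E_bounded 0; split.
  by apply: (mean_ge0 HL B0) => z _; rewrite subr_ge0; exact: nk_monotone.
have S0 : bounded_on Q (fun z => sq (y - z)) := ball_bounded_reflect y (@ball_bounded_sq R).
have S1 i : bounded_on Q (fun z => 2 * (y - z) 0 i).
  apply: bounded_mul; first exact: bounded_cst.
  exact: ball_bounded_reflect (@ball_bounded_coord R i).
have dS i z : is_derive z 'e_i (fun z => sq (y - z)) (- (2 * (y - z) 0 i)).
  by apply: is_derive_reflect; exact: is_derive_sq.
have dS1 i z : is_derive z 'e_i (fun z => 2 * (y - z) 0 i) (- 2).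
  apply: (is_derive_reflect (G := fun v => 2 * v 0 i)).
  apply: (is_derive_eq (is_derive_mul (is_derive_const 2 _ 'e_i) (is_derive_coord1 _ i))).
  by rewrite mul0r add0r mulr1.
have key i : 2 * L (fun z => E0 (y - z)) = L (fun z => E2 i (y - z) * sq (y - z)).
  have [_ c1 c2 c3] := E_bounded i.
  have B2 : bounded_on Q (fun z => 2 * E0 (y - z)) by apply: bounded_mul => //; exact: bounded_cst.
  have T2 : bounded_on Q (fun z => E2 i (y - z) * sq (y - z)) by exact: bounded_mul.
  apply/eqP; rewrite -(mean_scale HL)// -subr_eq0 -(mean_sub HL B2 T2) -oppr_eq0 -(mean_opp HL (bounded_sub B2 T2)).
  apply/eqP; apply: (mean_derive_C2 HL (i := i)
    (g := fun z => E0 (y - z) * (2 * (y - z) 0 i) - E1 i (y - z) * sq (y - z))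
    (g' := fun z => - (2 * E0 (y - z) - E2 i (y - z) * sq (y - z)))
    (g'' := fun z => 2 * E1 i (y - z) - (E3 i (y - z) * sq (y - z) + E2 i (y - z) * (2 * (y - z) 0 i)))).
  - move=> z _; have [d0 d1 d2] := E_derive i z.
    have D := is_derive_sub (is_derive_mul d0 (dS1 i z)) (is_derive_mul d1 (dS i z)).
    apply: (is_derive_eq D); move: (E0 _) (E1 _ _) (E2 _ _) (sq _) ((y - z) 0 i) => p q r s t; ring.
  - move=> z _; have [d0 d1 d2] := E_derive i z.
    have D := is_derive_opp (is_derive_sub (is_derive_mul (is_derive_const 2 z 'e_i) d0) (is_derive_mul d2 (dS i z))).
    apply: (is_derive_eq D); move: (E0 _) (E1 _ _) (E2 _ _) (E3 _ _) (sq _) ((y - z) 0 i) => p q r s t u; ring.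
  - by apply: bounded_opp; exact: bounded_sub.
  - apply: bounded_sub; first by apply: bounded_mul => //; exact: bounded_cst.
    by apply: bounded_add; apply: bounded_mul.
  - move=> z zc; have [-> /(_ i)[-> ->]] := E_far zc.
    by rewrite !(mul0r, mulr0) subrr oppr0.
have : \sum_(i < 4) 2 * L (fun z => E0 (y - z)) = \sum_(i < 4) L (fun z => E2 i (y - z) * sq (y - z)).
  by apply: eq_bigr => i _; exact: key.
rewrite -(mean_sum HL) => [|i]; last by apply: bounded_mul => //; have [] := E_bounded i.
have E8 (X : R) : \sum_(i < 4) 2 * X = 8 * X by rewrite sumr_const card_ord; ring.
rewrite E8 => ->.
by congr L; apply/funext => z; rewrite -mulr_suml E_laplace.
Qed.

End Scale.
End Newton.

Section Geometric.
Variable R : realType.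

Lemma geometric_cauchy (x : nat -> R) (C : R) : (forall j, `|x j.+1 - x j| <= C * 2^-1 ^+ j) ->
  exists2 l : R, x @ \oo --> l & forall j, `|x j - x 0| <= 2 * C.
Proof.
move=> H; have C0 : 0 <= C by have := H 0%N; rewrite expr0 mulr1; exact: le_trans.
have tele n : x n - x 0%N = \sum_(0 <= j < n) (x j.+1 - x j) by rewrite telescope_sumr.
have geo n : \sum_(0 <= j < n) C * 2^-1 ^+ j = 2 * C - 2 * C * 2^-1 ^+ n.
  elim: n => [|n IH]; first by rewrite big_nil expr0 mulr1 subrr.
  by rewrite big_nat_recr//= IH exprS; field.
have p n : 0 <= 2^-1 ^+ n :> R by rewrite exprn_ge0// invr_ge0.
have cv : cvgn (series (fun j => x j.+1 - x j)).
  apply: normed_cvg; apply: (@series_le_cvg _ _ (fun j => C * 2^-1 ^+ j)) => //.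
  - by move=> n /=.
  - by move=> n /=; apply: mulr_ge0.
  - apply: is_cvg_geometric_series.
    by rewrite ger0_norm ?invr_ge0// invf_lt1// ltr1n.
exists (x 0%N + limn (series (fun j => x j.+1 - x j))).
  have E : (fun n => x 0%N + series (fun j => x j.+1 - x j) n) = x.
    by apply/funext => n; rewrite /series /= -tele addrC subrK.
  rewrite -[X in X @ \oo --> _]E; exact: (cvgD (@cvg_cst _ (x 0%N) _ \oo _) cv).
move=> j; rewrite tele; apply: (le_trans (ler_norm_sum _ _ _)).
apply: (@le_trans _ _ (\sum_(0 <= i < j) C * 2^-1 ^+ i)); first by apply: ler_sum => i _; exact: H.
by rewrite geo gerBl mulr_ge0// mulr_ge0.
Qed.

End Geometric.

(** * The mass of the density *)

Section Newton.
Variable R : realType.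
Implicit Types (f g : 'rV[R]_4 -> R) (x y z w v : 'rV[R]_4) (a : R).
Variables (c : 'rV[R]_4) (L : ('rV[R]_4 -> R) -> R).
Hypothesis HL : is_mean c L.
Local Notation Q := (cube c 3).
Local Notation mass a y := (L (fun z => dens a (y - z))).

Lemma dens_bounded a y : 0 <= a -> bounded_on Q (fun z => dens a (y - z)).
Proof.
move=> a0; apply: ball_bounded_reflect.
by have [_ _ _ _ []] := ball_bounded_kernels (0 : 'I_4) a0.
Qed.

Lemma dens_le0 a v : 0 <= a -> dens a v <= 0.
Proof.
move=> a0; rewrite /dens mulNr mulNr oppr_le0 !mulr_ge0 ?exprn_ge0//.
by have [_ _ _ _ []] := profile_bounds (mulr_ge0 a0 (sq_ge0 v)).
Qed.

Lemma four_exp_ge1 j : 1 <= 4 ^+ j :> R.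
Proof. by apply: exprn_ege1; rewrite ler1n. Qed.

Lemma mass_exp j y : `|y - c| < 1 -> mass (4 ^+ j) y = mass 1 y.
Proof.
move=> yc; elim: j => [|j IH]; first by rewrite expr0.
by rewrite exprS (mass_scale HL (four_exp_ge1 j) yc).
Qed.

(** No translation invariance of the mean is available. Instead, the derivative in y is the mean of
    a derivative in z of a function vanishing near the boundary of the cube, hence zero. *)
Lemma mass_const y : `|y - c| < 1 -> mass 1 y = mass 1 c.
Proof.
move=> yc; apply/eqP; rewrite -subr_eq0 -normr_le0.
have D i x : `|x - c| < 1 -> is_derive x 'e_i (fun y => mass 1 y) 0.
  move=> xc; have [_ _ _ _ [b0 b1 b2]] := ball_bounded_kernels i (@ler01 R).
  pose r := 1 - `|x - c|; have r0 : 0 < r by rewrite subr_gt0.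
  have [C0 H0] := b0 (1 + 3 : R); have [C1 H1] := b1 (1 + 3 : R); have [C2 H2] := b2 (1 + 3 : R).
  have K := @kernel_derive R c L (fun=> 1) i x (fun w z => dens 1 (w - z)) (fun w z => dens1 1 i (w - z))
    (fun w z => dens2 1 i (w - z)) (fun=> 0) r (Num.max C0 (Num.max C1 C2)) HL r0 (bounded_cst Q 1).
  have E0 : L (fun=> 0) = 0.
    by apply/eqP; rewrite -normr_le0; apply: (mean_le HL) => z _; rewrite normr0.
  rewrite E0 in K.
  have -> : (fun y => mass 1 y) = (fun y => L (fun z => dens 1 (y - z) * 1)).
    by apply/funext => w; congr L; apply/funext => z; rewrite mulr1.
  apply: K.
    move=> w z Qz wx _; have nwz : `|w - z| <= 1 + 3.
      have E : w - z = (w - x) + (x - c) - (z - c) by apply/rowP => j; rewrite !mxE; ring.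
      rewrite E (le_trans (ler_normB _ _))// lerD// (le_trans (ler_normD _ _))//.
      by rewrite -[leRHS](subrK `|x - c|) lerD2r ltW.
    split; [exact: is_derive_translate (is_derive_dens _ _ _)|exact: is_derive_translate (is_derive_dens1 _ _ _)|].
    by rewrite !le_max (H0 _ nwz) (H1 _ nwz) (H2 _ nwz) !orbT.
  have B1 := ball_bounded_reflect c x b1.
  have -> : (fun z => dens1 1 i (x - z) * 1) = (fun z => - - dens1 1 i (x - z)).
    by apply/funext => z; rewrite mulr1 opprK.
  rewrite (mean_opp HL (bounded_opp B1)).
  suff -> : L (fun z => - dens1 1 i (x - z)) = 0 by rewrite oppr0.
  apply: (mean_derive_C2 HL (i := i) (g := fun z => dens 1 (x - z)) (g' := fun z => - dens1 1 i (x - z))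
    (g'' := fun z => - - dens2 1 i (x - z))).
  - by move=> z _; apply: is_derive_reflect; exact: is_derive_dens.
  - by move=> z _; apply: is_derive_opp; apply: is_derive_reflect; exact: is_derive_dens1.
  - exact: bounded_opp.
  - by do 2!apply: bounded_opp; exact: ball_bounded_reflect.
  - move=> z zc; have h := far_from_center (lexx 1) xc zc.
    by rewrite dens_far// dens1_far// oppr0.
have := @lip_coord R 4 (fun y => mass 1 y) (fun _ _ => 0) c 1 0 ltr01 _ c y.
rewrite !mul0r; apply => //; last by rewrite subrr normr0.
by move=> i x xc; split; [exact: D|rewrite normr0].
Qed.

(** The place where the mean must be known not to be degenerate: the Poisson equation is solved by
    dividing by this mass. *)
Lemma mass_lt0 : mass 1 c < 0.
Proof.
have B := dens_bounded c (@ler01 R).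
(* On the box of radius 3/8 the squared length is at most 9/16, so the cubic bump is at least
   (7/16)^3, and 80/5 times this exceeds 1. *)
have : 1 / 4096 <= L (fun z => - (1 / 5) * dens 1 (c - z)).
  apply: (mean_box HL).
  - by apply: bounded_mul => //; exact: bounded_cst.
  - by move=> z _; rewrite mulNr oppr_ge0 pmulr_rle0; [exact: dens_le0|lra].
  - move=> z zc; rewrite /dens /bump3 /piecewise expr1n mulr1 [1 * sq _]mul1r.
    have s1 : sq (c - z) <= 9 / 16.
      apply: (le_trans (sq_le_norm _)); rewrite distrC.
      apply: (@le_trans _ _ (4 * (3 / 8) ^+ 2)); last by lra.
      by rewrite ler_wpM2l// ler_pXn2r ?nnegrE//; lra.
    rewrite ifT; last by apply: (le_lt_trans s1); lra.
    have w1 : 7 / 16 <= 1 - sq (c - z) by lra.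
    suff X (w : R) : 7 / 16 <= w -> 1 <= - (1 / 5) * (- 80 * (w * w * w)) by exact: X.
    move=> ww; have w2 : 7 / 16 * (7 / 16) <= w * w by apply: ler_pM => //; lra.
    have w3 : 7 / 16 * (7 / 16) * (7 / 16) <= w * w * w by apply: ler_pM => //; rewrite mulr_ge0.
    by move: w3; set W : R := w * w * w; lra.
rewrite (mean_scale HL)// => H.
by rewrite ltNge; apply/negP => h; move: H; nra.
Qed.

Lemma mass_ge : - 80 <= mass 1 c.
Proof.
suff : `|mass 1 c| <= 80 by rewrite ler_norml => /andP[].
apply: (mean_le HL) => z _; rewrite /dens expr1n mulr1 normrM normrN [X in X * _]ger0_norm// ger0_norm.
  by rewrite ler_piMr//; have [_ _ _ _ []] := profile_bounds (mulr_ge0 ler01 (sq_ge0 (c - z))).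
by have [_ _ _ _ []] := profile_bounds (mulr_ge0 ler01 (sq_ge0 (c - z))).
Qed.

(** In Green's identity the density of the larger scale contributes a nonpositive term. That of
    scale a lives where |y - z|^2 < 1/a, so 8 times the mean is at most -mass/a, and -mass is at
    most 80. *)
Lemma mean_kernel_diff_le j y : `|y - c| < 1 ->
  L (fun z => nk (4 ^+ j.+1) (y - z) - nk (4 ^+ j) (y - z)) <= 10 / 4 ^+ j.
Proof.
move=> yc; set a : R := 4 ^+ j; have a1 : 1 <= a by exact: four_exp_ge1.
have a0 : 0 < a by exact: lt_le_trans a1.
have b0 : 0 <= 4 * a by rewrite mulr_ge0// ltW.
rewrite exprS -/a; have [_ E] := mean_kernel_diff HL a1 yc.
suff : 8 * L (fun z => nk (4 * a) (y - z) - nk a (y - z)) <= 80 / a by rewrite !ler_pdivlMr//; lra.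
rewrite E; apply: (@le_trans _ _ (L (fun z => - a^-1 * dens a (y - z)))).
  apply: (mean_mono HL).
  - apply: bounded_mul; last exact: ball_bounded_reflect (@ball_bounded_sq R).
    by apply: bounded_sub; apply: dens_bounded => //; exact: ltW.
  - by apply: bounded_mul; [exact: bounded_cst|exact/dens_bounded/ltW].
  move=> z _; have d4 := dens_le0 (y - z) b0; have d1 := dens_le0 (y - z) (ltW a0).
  have s0 := sq_ge0 (y - z).
  apply: (@le_trans _ _ (- dens a (y - z) * sq (y - z))).
    by rewrite ler_wpM2r// gerDr.
  have [h|/ltW h] := leP 1 (a * sq (y - z)); first by rewrite dens_far// oppr0 mul0r mulr0.
  rewrite !mulNr lerN2 [a^-1 * _]mulrC; apply: ler_wnM2l => //.
  by rewrite -[a^-1]mul1r ler_pdivlMr// mulrC.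
rewrite (mean_scale HL); last exact/dens_bounded/ltW.
rewrite (mass_exp j yc) (mass_const yc) mulNr -mulrN mulrC ler_pM2r ?invr_gt0//.
by rewrite lerNl; exact: mass_ge.
Qed.

End Newton.

Lemma cvg_sumR (R : realType) (I : Type) (r : seq I) (u : I -> nat -> R) (l : I -> R) :
  (forall i, u i @ \oo --> l i) -> (fun j => \sum_(i <- r) u i j) @ \oo --> \sum_(i <- r) l i.
Proof.
move=> H; elim: r => [|i r IH].
  by rewrite big_nil; under eq_fun do rewrite big_nil; exact: cvg_cst.
by rewrite big_cons; under eq_fun do rewrite big_cons; exact: cvgD (H i) IH.
Qed.

(** * The Newton potential as a limit of scales *)

Section Pot.
Variable R : realType.
Implicit Types (f g : 'rV[R]_4 -> R) (x y z w v : 'rV[R]_4) (a : R).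
Variables (c : 'rV[R]_4) (L : ('rV[R]_4 -> R) -> R).
Hypothesis HL : is_mean c L.
Local Notation Q := (cube c 3).
Local Notation mass a y := (L (fun z => dens a (y - z))).

Lemma four_exp_gt0 j : 0 < 4 ^+ j :> R. Proof. by rewrite exprn_gt0. Qed.

Lemma nk_bounded a y : 0 <= a -> bounded_on Q (fun z => nk a (y - z)).
Proof.
move=> a0; apply: ball_bounded_reflect.
by have [] := ball_bounded_kernels (0 : 'I_4) a0.
Qed.

Lemma far_from_support f y z : testfun c f -> 1 <= `|y - c| -> f z != 0 -> 1 / 2 <= `|y - z|.
Proof.
move=> tf yc fz; have zc : `|z - c| <= 1 / 2.
  by rewrite leNgt; apply/negP => /(proj2 tf) /eqP; apply/negP.
have n1 : `|y - c| <= `|y - z| + `|z - c| by exact: ler_distD.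
have : 1 <= `|y - z| + 1 / 2 by apply: (le_trans yc); apply: (le_trans n1); rewrite lerD2l.
by lra.
Qed.

Lemma four_sq_far j y z : 1 / 2 <= `|y - z| -> 1 <= 4 ^+ j.+1 * sq (y - z).
Proof.
move=> H; have s : 1 / 4 <= sq (y - z).
  apply: le_trans (norm_sq_le _); apply: (@le_trans _ _ ((1 / 2) ^+ 2)); first by lra.
  by rewrite ler_pXn2r ?nnegrE.
rewrite exprS; have p := four_exp_ge1 R j.
apply: (@le_trans _ _ (4 * 1 * (1 / 4))); first by lra.
by apply: ler_pM => //; rewrite ?ler_pM2l//; lra.
Qed.

(** The kernels increase with the scale, so the mean of the absolute difference is the mean of the
    difference, which is summable in j. For |y - c| >= 1 both kernels already equal 1/|y - z|^2 on
    the support of f. *)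
Lemma npot_step f y j (B : R) : testfun c f -> (forall z, `|f z| <= B) ->
  `|npot L (4 ^+ j.+2) f y - npot L (4 ^+ j.+1) f y| <= 10 * B / 4 ^+ j.+1.
Proof.
move=> tf HB; have B0 : 0 <= B := le_trans (normr_ge0 _) (HB 0).
have F := testfun_bounded_on Q tf.
have b1 := nk_bounded y (ltW (four_exp_gt0 j.+1)); have b2 := nk_bounded y (ltW (four_exp_gt0 j.+2)).
rewrite /npot -(mean_sub HL (bounded_mul b2 F) (bounded_mul b1 F)).
have [yc|yc] := ltP `|y - c| 1; last first.
  apply: (@le_trans _ _ 0); last by rewrite divr_ge0 ?mulr_ge0 ?exprn_ge0.
  apply: (mean_le HL) => z _; have [->|fz] := eqVneq (f z) 0; first by rewrite !mulr0 subrr normr0.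
  have yz := far_from_support tf yc fz.
  by rewrite !nk_far ?four_sq_far ?exprn_gt0// subrr normr0.
have bE : bounded_on Q (fun z => nk (4 ^+ j.+2) (y - z) - nk (4 ^+ j.+1) (y - z)) by exact: bounded_sub.
have bB : bounded_on Q (fun z => B * (nk (4 ^+ j.+2) (y - z) - nk (4 ^+ j.+1) (y - z))).
  by apply: bounded_mul => //; exact: bounded_cst.
have bF : bounded_on Q (fun z => nk (4 ^+ j.+2) (y - z) * f z - nk (4 ^+ j.+1) (y - z) * f z).
  by apply: bounded_sub; exact: bounded_mul.
have H : B * L (fun z => nk (4 ^+ j.+2) (y - z) - nk (4 ^+ j.+1) (y - z)) <= 10 * B / 4 ^+ j.+1.
  rewrite [10 * B]mulrC -mulrA.
  exact: (ler_wpM2l B0 (mean_kernel_diff_le HL j.+1 yc)).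
have K z : `|nk (4 ^+ j.+2) (y - z) * f z - nk (4 ^+ j.+1) (y - z) * f z| <=
    B * (nk (4 ^+ j.+2) (y - z) - nk (4 ^+ j.+1) (y - z)).
  rewrite -mulrBl normrM mulrC ler_pM// ger0_norm// subr_ge0 [4 ^+ j.+2]exprS.
  by apply: nk_monotone; exact/ltW/four_exp_gt0.
rewrite ler_norml; apply/andP; split.
- rewrite lerNl -(mean_opp HL bF) (le_trans _ H)// -(mean_scale HL _ bE).
  apply: (mean_mono HL) => //; first exact: bounded_opp.
  by move=> z _; apply: le_trans (K z); rewrite -normrN ler_norm.
- rewrite (le_trans _ H)// -(mean_scale HL _ bE).
  apply: (mean_mono HL) => // z _; apply: le_trans (K z); exact: ler_norm.
Qed.

(** The scales start at 4 because [four_sq_far] needs it: points at distance 1/2 only satisfy |y -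
    z|^2 >= 1/4. *)
Definition pot f y : R := limn (fun j => npot L (4 ^+ j.+1) f y).

Lemma pot_cvg_bound f : testfun c f -> exists C : R, forall y,
  (npot L (4 ^+ j.+1) f y @[j --> \oo] --> pot f y) /\ forall j, `|npot L (4 ^+ j.+1) f y| <= C.
Proof.
move=> tf; have [B B0 HB] := testfun_bounded tf; exists (2 * (10 * B) + 400 * B) => y.
have [l cl Hl] : exists2 l : R, npot L (4 ^+ j.+1) f y @[j --> \oo] --> l &
    forall j, `|npot L (4 ^+ j.+1) f y - npot L (4 ^+ 1) f y| <= 2 * (10 * B).
  apply: (@geometric_cauchy R (fun j => npot L (4 ^+ j.+1) f y)) => j.
  apply: (le_trans (npot_step y j tf HB)); rewrite ler_wpM2l// ?mulr_ge0//.
  rewrite -exprVn (@le_trans _ _ (4^-1 ^+ j))//.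
    by rewrite exprS ler_piMl ?exprn_ge0 ?invr_ge0// invf_le1// ler1n.
  by apply: lerXn2r; rewrite ?nnegrE ?invr_ge0// lef_pV2 ?posrE// ler_nat.
have -> : pot f y = l by apply: cvg_lim cl.
split=> // j; rewrite -[npot L (4 ^+ j.+1) f y](subrK (npot L (4 ^+ 1) f y)).
rewrite (le_trans (ler_normD _ _))// lerD// /npot; apply: (mean_le HL) => z _.
have [H _ _ _ _] := profile_bounds (mulr_ge0 (ler0n R 4) (sq_ge0 (y - z))).
rewrite normrM; apply: ler_pM => //; rewrite /nk expr1 normrM ger0_norm//.
apply: (@le_trans _ _ (4 * 100)); first by rewrite ler_pM2l.
by rewrite -natrM.
Qed.

Lemma pot_cvg f y : testfun c f -> npot L (4 ^+ j.+1) f y @[j --> \oo] --> pot f y.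
Proof. by move=> /pot_cvg_bound[C /(_ y)[]]. Qed.

Lemma pot_jet f : testfun c f -> jet setT (fun s => pot (pd s f)).
Proof.
move=> tf; apply: (@jet_lim R 4 setT (fun j s => npot L (4 ^+ j.+1) (pd s f))).
- exact: openT.
- move=> s x _; have [C HC] := pot_cvg_bound (testfun_pd s tf).
  exists 1, C, 0%N; split=> // j _ y _; split; first by have [_] := HC y; apply.
  by move=> i; apply: (npot_derive HL); [exact/ltW/four_exp_gt0|exact: testfun_pd].
- by move=> s x _; apply: pot_cvg; exact: testfun_pd.
Qed.

(** The sequence of regularised potentials is constant once 4^(j+1) d^2 >= 1. No other information
    on the unregularised kernel is needed for the expansions. *)
Lemma pot_far f y (d : R) : testfun c f -> 0 < d -> (forall z, f z != 0 -> d <= `|y - z|) ->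
  pot f y = L (fun z => (sq (y - z))^-1 * f z).
Proof.
move=> tf d0 H; apply: cvg_lim => //.
apply: cvg_near_cst; exists (Num.truncn (d ^- 2)).+1 => // j /= jN.
have F := testfun_bounded_on Q tf.
have b1 := nk_bounded y (ltW (four_exp_gt0 j.+1)).
apply: (mean_ext HL (bounded_mul b1 F)) => z _; have [->|fz] := eqVneq (f z) 0; first by rewrite !mulr0.
rewrite nk_far ?four_exp_gt0//.
have s : d ^+ 2 <= sq (y - z).
  by apply: le_trans (norm_sq_le _); apply: lerXn2r; rewrite ?nnegrE ?(ltW d0)// H.
have J : d ^- 2 <= 4 ^+ j.+1.
  apply: ltW; apply: (lt_le_trans (truncnS_gt _)); apply: (@le_trans _ _ j.+1%:R).
    by rewrite ler_nat ltnW.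
  by rewrite -natrX ler_nat ltnW// ltn_expl.
apply: (@le_trans _ _ (d ^- 2 * d ^+ 2)); first by rewrite mulVf// expf_neq0// gt_eqF.
by apply: ler_pM => //; rewrite ?invr_ge0 ?exprn_ge0// ltW.
Qed.

(** The densities concentrate at y while their mass stays fixed, so they form an approximate
    identity up to this mass. Continuity of f at y is used up to e/80, as 80 bounds the absolute
    mass. *)
Lemma pot_laplace f y : testfun c f ->
  \sum_i pot (partial i (partial i (f : _ -> R))) y = mass 1 c * f y.
Proof.
move=> tf.
have cvS : (fun j => L (fun z => dens (4 ^+ j.+1) (y - z) * f z)) @ \oo -->
    \sum_i pot (partial i (partial i (f : _ -> R))) y.
  have -> : (fun j => L (fun z => dens (4 ^+ j.+1) (y - z) * f z)) =
      (fun j => \sum_i npot L (4 ^+ j.+1) (partial i (partial i (f : _ -> R))) y).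
    by apply/funext => j; rewrite (npot_laplace HL)//; exact/ltW/four_exp_gt0.
  by apply: (cvg_sumR (u := fun i j => npot L (4 ^+ j.+1) (partial i (partial i f)) y)) => i; apply: pot_cvg; do 2!apply: testfun_partial.
suff : (fun j => L (fun z => dens (4 ^+ j.+1) (y - z) * f z)) @ \oo --> mass 1 c * f y.
  by move=> H; apply: (cvg_unique _ cvS H).
have F := testfun_bounded_on Q tf.
have [yc|yc] := ltP `|y - c| 1; last first.
  have -> : f y = 0 by apply: (proj2 tf); apply: lt_le_trans yc; lra.
  rewrite mulr0; apply: cvg_near_cst; exists 0%N => // j _.
  apply/eqP; rewrite -normr_le0; apply: (mean_le HL) => z _.
  have [->|fz] := eqVneq (f z) 0; first by rewrite mulr0 normr0.
  have yz := far_from_support tf yc fz.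
  by rewrite dens_far ?four_sq_far// mul0r normr0.
have cf : {for y, continuous f} by exact: (smooth_continuous (proj1 tf)).
apply/cvgrPdist_le => e e0.
have e80 : 0 < e / 80 by rewrite divr_gt0.
have [r r0 Hr] := (continuous_atP f y).1 cf _ e80.
exists (Num.truncn (r ^- 2)).+1 => // j /= jN.
have a0 := four_exp_gt0 j.+1.
have bd := dens_bounded c y (ltW a0).
have bdy : bounded_on Q (fun z => f y * dens (4 ^+ j.+1) (y - z)).
  by apply: bounded_mul => //; exact: bounded_cst.
rewrite -(mass_const HL yc) -(mass_exp HL j.+1 yc) mulrC -(mean_scale HL _ bd).
rewrite -(mean_sub HL bdy (bounded_mul bd F)).
have J : r ^- 2 <= 4 ^+ j.+1.
  apply: ltW; apply: (lt_le_trans (truncnS_gt _)); apply: (@le_trans _ _ j.+1%:R).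
    by rewrite ler_nat ltnW.
  by rewrite -natrX ler_nat ltnW// ltn_expl.
have K z : `|f y * dens (4 ^+ j.+1) (y - z) - dens (4 ^+ j.+1) (y - z) * f z| <=
    - (e / 80) * dens (4 ^+ j.+1) (y - z).
  have dn := dens_le0 (y - z) (ltW a0).
  rewrite [f y * _]mulrC -mulrBr normrM ler0_norm// mulrC mulNr mulrN lerN2.
  have [yr|yr] := ltP `|z - y| r.
    by apply: ler_wnM2r => //; rewrite distrC; exact/ltW/Hr.
  rewrite dens_far ?mulr0 ?mul0r// (@le_trans _ _ (r ^- 2 * r ^+ 2))//.
    by rewrite mulVf// expf_neq0// gt_eqF.
  apply: ler_pM => //; rewrite ?invr_ge0 ?exprn_ge0 ?(ltW r0)//.
  by apply: le_trans (norm_sq_le _); apply: lerXn2r; rewrite ?nnegrE ?(ltW r0)// distrC.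
have bK : bounded_on Q (fun z => - (e / 80) * dens (4 ^+ j.+1) (y - z)).
  by apply: bounded_mul => //; exact: bounded_cst.
have H : L (fun z => - (e / 80) * dens (4 ^+ j.+1) (y - z)) <= e.
  rewrite (mean_scale HL _ bd) (mass_exp HL _ yc) (mass_const HL yc).
  have := mass_ge HL; set m := L _ => mge.
  apply: (@le_trans _ _ (- (e / 80) * - 80)); last by rewrite mulrNN divfK.
  by rewrite ler_wnM2l// oppr_le0 ltW.
have bF : bounded_on Q (fun z => f y * dens (4 ^+ j.+1) (y - z) - dens (4 ^+ j.+1) (y - z) * f z).
  by apply: bounded_sub => //; exact: bounded_mul.
rewrite ler_norml; apply/andP; split.
- rewrite lerNl -(mean_opp HL bF) (le_trans _ H)//.
  apply: (mean_mono HL) => //; first exact: bounded_opp.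
  by move=> z _; apply: le_trans (K z); rewrite -normrN ler_norm.
- rewrite (le_trans _ H)//.
  apply: (mean_mono HL) => // z _; apply: le_trans (K z); exact: ler_norm.
Qed.

End Pot.

(** * Expansion of the Newton kernel *)

Section Expansion.
Variable R : realType.
Implicit Types (A B C : R) (m K : nat).

(* [xp A B C m K] is the sum of the coefficients of t^0, ..., t^(K-1) in the power series of
   (A - 2 B t + C t^2)^(-m). *)
Fixpoint xp A B C m : nat -> R :=
  if m is m'.+1 then
    (fix F K := if K is K'.+1 then
       A^-1 * (xp A B C m' K + 2 * B * F K' - C * (if K' is K''.+1 then F K'' else 0)) else 0)
  else fun K => (0 < K)%N%:R.

Lemma xp0 A B C m : xp A B C m 0 = 0. Proof. by case: m. Qed.

Lemma xpSS A B C m K : xp A B C m.+1 K.+1 =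
  A^-1 * (xp A B C m K.+1 + 2 * B * xp A B C m.+1 K - C * xp A B C m.+1 K.-1).
Proof. by case: K => [|K] //=; rewrite xp0. Qed.

Lemma xp_0S A B C K : xp A B C 0 K.+1 = 1. Proof. by []. Qed.

Local Arguments xp : simpl never.

Lemma xp_rec A B C m K : A != 0 -> A * xp A B C m.+1 K =
  xp A B C m K + 2 * B * xp A B C m.+1 K.-1 - C * xp A B C m.+1 K.-2.
Proof.
move=> A0; case: K => [|K]; first by rewrite !xp0 !(mulr0, subrr, addr0, subr0).
by rewrite xpSS mulVKf.
Qed.

Lemma xp_bounded (a0 M : R) m K : 0 < a0 -> exists2 N : R, 0 <= N & forall A B C,
  a0 <= A -> `|B| <= M -> `|C| <= M -> `|xp A B C m K| <= N.
Proof.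
move=> a00; elim: m K => [|m IHm] K; first by exists 1 => // A B C _ _ _; rewrite /xp; case: (0 < K)%N; rewrite ?normr1 ?normr0.
suff: forall K, (exists2 N : R, 0 <= N & forall A B C, a0 <= A -> `|B| <= M -> `|C| <= M -> `|xp A B C m.+1 K| <= N) /\
   (exists2 N : R, 0 <= N & forall A B C, a0 <= A -> `|B| <= M -> `|C| <= M -> `|xp A B C m.+1 K.-1| <= N).
  by move=> /(_ K)[].
elim=> [|{}K [[N1 N10 H1] [N2 N20 H2]]].
  by split; exists 0 => // A B C _ _ _; rewrite normr0.
split; last by exists N1.
have [N3 N30 H3] := IHm K.+1; exists (a0^-1 * (N3 + 2 * `|M| * N1 + `|M| * N2)).
  by rewrite mulr_ge0 ?invr_ge0 ?(ltW a00)// !addr_ge0// !mulr_ge0.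
move=> A B C HA HB HC; have A0 : 0 < A := lt_le_trans a00 HA.
have HB' := le_trans HB (ler_norm M); have HC' := le_trans HC (ler_norm M).
rewrite xpSS normrM; apply: ler_pM => //.
  by rewrite normfV gtr0_norm// lef_pV2 ?posrE.
apply: (le_trans (ler_normB _ _)); apply: lerD; last by rewrite normrM ler_pM ?H2.
apply: (le_trans (ler_normD _ _)); apply: lerD; first exact: H3.
rewrite normrM; apply: ler_pM => //; last exact: H1.
by rewrite normrM (ger0_norm (ler0n R 2)) ler_pM2l.
Qed.

(** The truncated form of the derivative -m (A' - 2 B' t + C' t^2) (A - 2 B t + C t^2)^(-m-1): a
    factor t lowers the truncation by one. Predecessors stop at 0, where the partial sum is empty,
    so they need no special treatment. *)
Lemma is_derive_xp (V : normedModType R) (A B C : V -> R) (x v : V) (A' B' C' : R) m K :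
  is_derive x v A A' -> is_derive x v B B' -> is_derive x v C C' -> A x != 0 ->
  is_derive x v (fun y => xp (A y) (B y) (C y) m K)
    (- m%:R * (A' * xp (A x) (B x) (C x) m.+1 K - 2 * B' * xp (A x) (B x) (C x) m.+1 K.-1
      + C' * xp (A x) (B x) (C x) m.+1 K.-2)).
Proof.
move=> dA dB dC A0; elim: m K => [|m IHm] K.
  by rewrite oppr0 mul0r; exact: is_derive_const.
pose P K := is_derive x v (fun y => xp (A y) (B y) (C y) m.+1 K)
    (- m.+1%:R * (A' * xp (A x) (B x) (C x) m.+2 K - 2 * B' * xp (A x) (B x) (C x) m.+2 K.-1
      + C' * xp (A x) (B x) (C x) m.+2 K.-2)).
suff: forall K, P K /\ P K.-1 by move=> /(_ K)[].
have P0 : P 0%N.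
  rewrite /P !xp0 !mulr0 subrr addr0 mulr0.
  have -> : (fun y => xp (A y) (B y) (C y) m.+1 0) = (fun=> 0) by apply/funext => y; rewrite xp0.
  exact: is_derive_const.
elim=> [//|{}K [P1 P2]]; split=> //; rewrite /P.
have dinv : is_derive x v (fun y => (A y)^-1) (- ((A x)^-1 * (A x)^-1) * A').
  exact: (is_derive_comp1 (is_derive_invR A0) dA).
have -> : (fun y => xp (A y) (B y) (C y) m.+1 K.+1) = (fun y => (A y)^-1 *
   (xp (A y) (B y) (C y) m K.+1 + 2 * B y * xp (A y) (B y) (C y) m.+1 K
     - C y * xp (A y) (B y) (C y) m.+1 K.-1)) by apply/funext => y; rewrite xpSS.
have D := is_derive_mul dinv (is_derive_sub (is_derive_add (IHm K.+1)
  (is_derive_mul (is_derive_mul (is_derive_const 2 x v) dB) P1)) (is_derive_mul dC P2)).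
apply: (is_derive_eq D).
rewrite /=; move: D IHm P1 P2 => _ _ _ _.
(* After multiplication by [A x] these recursions eliminate the leading partial sums and leave a
   rational identity. *)
have R2 k := xp_rec (B x) (C x) m.+1 k A0; have R1 k := xp_rec (B x) (C x) m k A0.
have E1 := R1 K.+1; have F1 := R2 K.+1; have F2 := R2 K; have F3 := R2 K.-1.
rewrite /= in E1 F1 F2 F3.
apply: (mulfI A0); move: E1 F1 F2 F3.
set s0 := xp _ _ _ m K.+1; set s1 := xp _ _ _ m.+1 K.+1; set s2 := xp _ _ _ m.+1 K.
set s3 := xp _ _ _ m.+1 K.-1; set t1 := xp _ _ _ m.+2 K.+1; set t2 := xp _ _ _ m.+2 K.
set t3 := xp _ _ _ m.+2 K.-1; set t4 := xp _ _ _ m.+2 K.-2; set t5 := xp _ _ _ m.+2 K.-2.-1.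
move: (A x) A0 (B x) (C x) s0 s1 s2 s3 t1 t2 t3 t4 t5 => a a0 b c s0 s1 s2 s3 t1 t2 t3 t4 t5 E1 F1 F2 F3.
rewrite -E1 -[m.+1%:R]natr1; set M : R := m%:R.
have -> : a * (- (M + 1) * (A' * t1 - 2 * B' * t2 + C' * t3)) =
  - (M + 1) * (A' * (a * t1) - 2 * B' * (a * t2) + C' * (a * t3)) by ring.
rewrite F1 F2 F3; field; exact: a0.
Qed.

(** At t = 1 the remainders satisfy the homogeneous two-term recursion. Under the bounds on B and C
    each step contracts by at most 1/4 + 2/64, which is below 1/2. *)
Lemma xp_remainder A B C K : 0 < A -> 0 <= C -> C <= A / 64 -> `|2 * B| <= A / 4 ->
  `|(A - 2 * B + C)^-1 - xp A B C 1 K| <= 2^-1 ^+ K * (A - 2 * B + C)^-1.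
Proof.
move=> A0 C0 CA BA; set q := A - 2 * B + C.
have q0 : 0 < q by move: BA; rewrite ler_norml /q => /andP[_ ?]; lra.
pose r K := q^-1 - xp A B C 1 K.
have r0 : r 0%N = q^-1 by rewrite /r xp0 subr0.
(* For k = 0 the predecessor is 0 again, which is the right value: with no terms subtracted the
   remainder is all of 1/q. *)
have rS k : A * r k.+1 = 2 * B * r k - C * r k.-1.
  rewrite /r xpSS mulrBr mulVKf ?gt_eqF//= /q.
  move: (xp _ _ _ _ k) (xp _ _ _ _ k.-1) => u v; rewrite -/q.
  have -> : A * q^-1 = 1 + (2 * B - C) * q^-1 by rewrite /q; field; rewrite gt_eqF.
  by rewrite xp_0S; ring.
suff: forall k, `|r k| <= 2^-1 ^+ k * q^-1 /\ `|r k.-1| <= 2 * 2^-1 ^+ k * q^-1 by move=> /(_ K)[].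
have qi : 0 < q^-1 by rewrite invr_gt0.
elim=> [|k [H1 H2]].
  rewrite /= r0 expr0 !mul1r mulr1 gtr0_norm//; split=> //.
  by apply: ler_peMl; [exact: ltW|rewrite ler1n].
have p : 0 < 2^-1 ^+ k :> R by rewrite exprn_gt0// invr_gt0.
split; last first.
  by rewrite /= exprS mulrA divff// mul1r.
rewrite -(ler_pM2l A0) -[A in A * `|_|]gtr0_norm// -normrM rS.
apply: (le_trans (ler_normB _ _)); rewrite (normrM (2 * B)) (normrM C).
have n1 : `|2 * B| * `|r k| <= A / 4 * (2^-1 ^+ k * q^-1) by rewrite ler_pM.
have n2 : `|C| * `|r k.-1| <= A / 64 * (2 * 2^-1 ^+ k * q^-1) by rewrite ler_pM// ger0_norm.
apply: (le_trans (lerD n1 n2)); rewrite exprS.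
have X : 0 < A * (2^-1 ^+ k * q^-1) by rewrite !mulr_gt0.
move: X; set X := _ ^+ k; set Y := q^-1 => X0.
rewrite -subr_ge0 (_ : _ - _ = (7 / 32) * (A * (X * Y))); last by field.
by rewrite mulr_ge0// ltW.
Qed.

End Expansion.

Local Arguments xp : simpl never.

(** * Truncations of the expansion of 1/|a - b|^2 *)

Section TwoPoint.
Variable R : realType.
Implicit Types (a b x y z w v : 'rV[R]_4) (m K : nat) (i : 'I_4).

Definition dot a b : R := \sum_i a 0 i * b 0 i.

Lemma is_derive_dotl a b i : is_derive a 'e_i (dot^~ b) (b 0 i).
Proof.
apply: (@is_derive_quad _ _ _ _ _ _ 1 0) => // h _.
have -> : dot (a + h *: 'e_i) b = dot a b + h * b 0 i.
  rewrite /dot (bigD1 i)//= [in RHS](bigD1 i)//= mxE scale_e_coord eqxx.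
  rewrite (eq_bigr (fun j => a 0 j * b 0 j)) => [|j /negbTE ji]; first by ring.
  by rewrite mxE scale_e_coord ji addr0.
have -> : dot a b + h * b 0 i - dot a b - h * b 0 i = 0 by ring.
by rewrite normr0 mul0r.
Qed.

Lemma dotC a b : dot a b = dot b a.
Proof. by apply: eq_bigr => i _; rewrite mulrC. Qed.

Lemma is_derive_dotr a b i : is_derive b 'e_i (dot a) (a 0 i).
Proof.
have -> : dot a = dot^~ a by apply/funext => b'; exact: dotC.
exact: is_derive_dotl.
Qed.

Lemma dot_bound a b : `|dot a b| <= 4 * (`|a| * `|b|).
Proof.
have -> : 4 * (`|a| * `|b|) = \sum_(i < 4) (`|a| * `|b|) by rewrite sumr_const card_ord mulr_natl.
apply: (le_trans (ler_norm_sum _ _ _)); apply: ler_sum => i _.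
by rewrite normrM ler_pM// coord_le_norm.
Qed.

(** The sum of the terms of degree below K in b in the expansion of |a - b|^(-2m) for small b, as
    the trinomial becomes |a - t b|^2. *)
Definition xk a b m K : R := xp (sq a) (dot a b) (sq b) m K.

Lemma is_derive_xk_l a b i m K : sq a != 0 -> is_derive a 'e_i (fun a => xk a b m K)
  (- m%:R * (2 * a 0 i * xk a b m.+1 K - 2 * b 0 i * xk a b m.+1 K.-1)).
Proof.
move=> a0.
have D := is_derive_xp m K (is_derive_sq a i) (is_derive_dotl a b i) (is_derive_const (sq b) a 'e_i) a0.
by apply: (is_derive_eq D); rewrite mul0r addr0.
Qed.

Lemma is_derive_xk_r a b i m K : sq a != 0 -> is_derive b 'e_i (fun b => xk a b m K)
  (- m%:R * (- 2 * a 0 i * xk a b m.+1 K.-1 + 2 * b 0 i * xk a b m.+1 K.-2)).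
Proof.
move=> a0.
have D := is_derive_xp m K (is_derive_const (sq a) b 'e_i) (is_derive_dotr a b i) (is_derive_sq b i) a0.
by apply: (is_derive_eq D); rewrite mul0r sub0r !mulNr.
Qed.

Definition xk1 i K a b : R := - 2 * a 0 i * xk a b 2 K + 2 * b 0 i * xk a b 2 K.-1.
Definition xk2 i K a b : R := - 2 * xk a b 2 K + 8 * a 0 i ^+ 2 * xk a b 3 K
  - 16 * a 0 i * b 0 i * xk a b 3 K.-1 + 8 * b 0 i ^+ 2 * xk a b 3 K.-2.

Definition xk3 i K a b : R := 24 * a 0 i * xk a b 3 K - 24 * b 0 i * xk a b 3 K.-1
  - 48 * a 0 i ^+ 3 * xk a b 4 K + 144 * a 0 i ^+ 2 * b 0 i * xk a b 4 K.-1
  - 144 * a 0 i * b 0 i ^+ 2 * xk a b 4 K.-2 + 48 * b 0 i ^+ 3 * xk a b 4 K.-2.-1.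

Lemma is_derive_xk_l1 a b i K : sq a != 0 -> is_derive a 'e_i (fun a => xk a b 1 K) (xk1 i K a b).
Proof.
move=> a0; apply: (is_derive_eq (is_derive_xk_l b i 1 K a0)); rewrite /xk1.
by move: (xk _ _ _ _) (xk _ _ _ _) => s t; ring.
Qed.

(** The full kernel depends on a - b only, so a derivative in b is minus the one in a; on the
    truncations the degree in b drops by one. *)
Lemma is_derive_xk_r1 a b i K : sq a != 0 -> is_derive b 'e_i (fun b => xk a b 1 K) (- xk1 i K.-1 a b).
Proof.
move=> a0; apply: (is_derive_eq (is_derive_xk_r b i 1 K a0)); rewrite /xk1.
by move: (xk _ _ _ _) (xk _ _ _ _) => s t; ring.
Qed.

Lemma is_derive_xk1_l a b i K : sq a != 0 -> is_derive a 'e_i (fun a => xk1 i K a b) (xk2 i K a b).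
Proof.
move=> a0.
have D := is_derive_add (is_derive_mul (is_derive_mul (is_derive_const (- 2) a 'e_i) (is_derive_coord1 a i))
    (is_derive_xk_l b i 2 K a0))
  (is_derive_mul (is_derive_const (2 * b 0 i) a 'e_i) (is_derive_xk_l b i 2 K.-1 a0)).
apply: (is_derive_eq D); rewrite /xk2.
set s := xk a b 2 K; set s' := xk a b 2 K.-1; set t := xk a b 3 K; set t1 := xk a b 3 K.-1; set t2 := xk a b 3 K.-2.
by move: s s' t t1 t2 (a 0 i) (b 0 i) => s s' t t1 t2 u w; ring.
Qed.

Lemma is_derive_xk1_r a b i K : sq a != 0 -> is_derive b 'e_i (fun b => xk1 i K a b) (- xk2 i K.-1 a b).
Proof.
move=> a0.
have D := is_derive_add (is_derive_mul (is_derive_const (- 2 * a 0 i) b 'e_i) (is_derive_xk_r b i 2 K a0))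
  (is_derive_mul (is_derive_mul (is_derive_const 2 b 'e_i) (is_derive_coord1 b i)) (is_derive_xk_r b i 2 K.-1 a0)).
apply: (is_derive_eq D); rewrite /xk2.
set s := xk a b 2 K; set s' := xk a b 2 K.-1; set t := xk a b 3 K.-1; set t1 := xk a b 3 K.-2; set t2 := xk a b 3 K.-2.-1.
move: s s' t t1 t2 (a 0 i) (b 0 i) => s s' t t1 t2 u w; ring.
Qed.

Lemma is_derive_xk2_l a b i K : sq a != 0 -> is_derive a 'e_i (fun a => xk2 i K a b) (xk3 i K a b).
Proof.
move=> a0; have C1 := is_derive_coord1 a i.
have K2 := is_derive_const _ a 'e_i.
have D := is_derive_add (is_derive_sub (is_derive_add
   (is_derive_mul (K2 (- 2)) (is_derive_xk_l b i 2 K a0))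
   (is_derive_mul (is_derive_mul (K2 8) (is_derive_mul C1 C1)) (is_derive_xk_l b i 3 K a0)))
   (is_derive_mul (is_derive_mul (is_derive_mul (K2 16) C1) (K2 (b 0 i))) (is_derive_xk_l b i 3 K.-1 a0)))
   (is_derive_mul (K2 (8 * b 0 i ^+ 2)) (is_derive_xk_l b i 3 K.-2 a0)).
apply: (is_derive_eq D); rewrite /xk3.
set s := xk a b 3 K; set s1 := xk a b 3 K.-1; set s2 := xk a b 3 K.-2; set t := xk a b 4 K.
set t1 := xk a b 4 K.-1; set t2 := xk a b 4 K.-2; set t3 := xk a b 4 K.-2.-1.
move: s s1 s2 t t1 t2 t3 (xk a b 2 K) (a 0 i) (b 0 i) => s s1 s2 t t1 t2 t3 r u w; ring.
Qed.

Lemma is_derive_xk2_r a b i K : sq a != 0 -> is_derive b 'e_i (fun b => xk2 i K a b) (- xk3 i K.-1 a b).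
Proof.
move=> a0; have C1 := is_derive_coord1 b i.
have K2 := is_derive_const _ b 'e_i.
have D := is_derive_add (is_derive_sub (is_derive_add
   (is_derive_mul (K2 (- 2)) (is_derive_xk_r b i 2 K a0))
   (is_derive_mul (K2 (8 * a 0 i ^+ 2)) (is_derive_xk_r b i 3 K a0)))
   (is_derive_mul (is_derive_mul (K2 (16 * a 0 i)) C1) (is_derive_xk_r b i 3 K.-1 a0)))
   (is_derive_mul (is_derive_mul (K2 8) (is_derive_mul C1 C1)) (is_derive_xk_r b i 3 K.-2 a0)).
apply: (is_derive_eq D); rewrite /xk3.
set s := xk a b 3 K.-1; set s1 := xk a b 3 K.-2; set s2 := xk a b 3 K.-2.-1; set t := xk a b 4 K.-1.
set t1 := xk a b 4 K.-2; set t2 := xk a b 4 K.-2.-1; set t3 := xk a b 4 K.-2.-2.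
move: s s1 s2 t t1 t2 t3 (a 0 i) (b 0 i) => s s1 s2 t t1 t2 t3 u w; ring.
Qed.

(** Each homogeneous term of the expansion is harmonic. Dimension 4 enters here: the four terms -2 s
    cancel the 8 s that the recursion extracts from the second-order terms. *)
Lemma xk_laplace a b K : sq a != 0 -> \sum_i xk2 i K a b = 0.
Proof.
move=> a0; rewrite /xk2 !big_split /= sumr_const card_ord sumrN.
set s := xk a b 2 K; set t := xk a b 3 K; set t1 := xk a b 3 K.-1; set t2 := xk a b 3 K.-2.
have -> : \sum_(i < 4) 8 * a 0 i ^+ 2 * t = 8 * (sq a * t).
  by rewrite mulrA /sq mulr_sumr mulr_suml; apply: eq_bigr => i _; rewrite expr2.
have -> : \sum_(i < 4) 8 * b 0 i ^+ 2 * t2 = 8 * (sq b * t2).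
  by rewrite mulrA /sq mulr_sumr mulr_suml; apply: eq_bigr => i _; rewrite expr2.
have -> : \sum_(i < 4) 16 * a 0 i * b 0 i * t1 = 16 * (dot a b * t1).
  by rewrite mulrA /dot mulr_sumr mulr_suml; apply: eq_bigr => i _; rewrite mulrA.
have E : sq a * t = s + 2 * dot a b * t1 - sq b * t2 := xp_rec _ _ 2 K a0.
by rewrite E; move: (dot a b) (sq b) => u w; ring.
Qed.

Lemma xk_bounded (a0 M : R) i K : 0 < a0 -> exists C : R, forall a b, a0 <= sq a -> `|a| <= M -> `|b| <= M ->
  [/\ `|xk a b 1 K| <= C, `|xk1 i K a b| <= C, `|xk2 i K a b| <= C & `|xk3 i K a b| <= C].
Proof.
move=> a00; pose M' := 4 * (M * M).
have bk m k : exists2 N : R, 0 <= N & forall a b, a0 <= sq a -> `|a| <= M -> `|b| <= M -> `|xk a b m k| <= N.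
  have [N N0 HN] := @xp_bounded R a0 M' m k a00; exists N => // a b ha hA hB; apply: HN => //.
    by rewrite (le_trans (dot_bound _ _))// ler_wpM2l// ler_pM.
  rewrite ger0_norm ?sq_ge0// (le_trans (sq_le_norm _))// ler_wpM2l// expr2 ler_pM//.
have [N1 _ H1] := bk 1%N K; have [N2 N20 H2] := bk 2%N K; have [N3 N30 H3] := bk 2%N K.-1.
have [N4 N40 H4] := bk 3%N K; have [N5 N50 H5] := bk 3%N K.-1; have [N6 N60 H6] := bk 3%N K.-2.
have [N7 N70 H7] := bk 4%N K; have [N8 N80 H8] := bk 4%N K.-1; have [N9 N90 H9] := bk 4%N K.-2.
have [N10 N100 H10] := bk 4%N K.-2.-1.
pose C4 := 24 * M * N4 + 24 * M * N5 + 48 * M ^+ 3 * N7 + 144 * M ^+ 2 * M * N8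
  + 144 * M * M ^+ 2 * N9 + 48 * M ^+ 3 * N10.
pose C2 := 2 * M * N2 + 2 * M * N3.
pose C3 := 2 * N2 + 8 * M ^+ 2 * N4 + 16 * M * M * N5 + 8 * M ^+ 2 * N6.
exists (Num.max N1 (Num.max C2 (Num.max C3 C4))) => a b ha hA hB.
have ai : `|a 0 i| <= M := le_trans (coord_le_norm a i) hA.
have bi : `|b 0 i| <= M := le_trans (coord_le_norm b i) hB.
have M0 : 0 <= M := le_trans (normr_ge0 _) ai.
have a2 : `|a 0 i ^+ 2| <= M ^+ 2 by rewrite normrX lerXn2r.
have b2 : `|b 0 i ^+ 2| <= M ^+ 2 by rewrite normrX lerXn2r.
have a3 : `|a 0 i ^+ 3| <= M ^+ 3 by rewrite normrX lerXn2r.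
have b3 : `|b 0 i ^+ 3| <= M ^+ 3 by rewrite normrX lerXn2r.
have n (k : nat) : `|k%:R : R| <= k%:R by rewrite ger0_norm.
have mm (u v U W : R) : `|u| <= U -> `|v| <= W -> `|u * v| <= U * W by move=> *; rewrite normrM ler_pM.
have dd (u v U W : R) : `|u| <= U -> `|v| <= W -> `|u + v| <= U + W.
  by move=> *; rewrite (le_trans (ler_normD _ _))// lerD.
have nn (u U : R) : `|u| <= U -> `|- u| <= U by rewrite normrN.
split; rewrite !le_max; apply/orP.
- by left; exact: H1.
- right; apply/orP; left; rewrite /xk1 /C2.
  apply: (dd _ _ _ _); apply: (mm _ _ _ _); [apply: (mm _ _ _ _) => //; apply: (nn _ _); exact: (n _)|exact: H2|apply: (mm _ _ _ _) => //; exact: (n _)|exact: H3].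
- right; apply/orP; right; apply/orP; left; rewrite /xk2 /C3; apply: (dd _ _ _ _); [apply: (dd _ _ _ _); [apply: (dd _ _ _ _)|apply: (nn _ _)]|]; apply: (mm _ _ _ _).
  + by apply: (nn _ _); exact: (n _).
  + exact: H2.
  + by apply: (mm _ _ _ _) => //; exact: (n _).
  + exact: H4.
  + by apply: (mm _ _ _ _) => //; apply: (mm _ _ _ _) => //; exact: (n _).
  + exact: H5.
  + by apply: (mm _ _ _ _) => //; exact: (n _).
  + exact: H6.
- right; apply/orP; right; apply/orP; right; rewrite /xk3 /C4.
  have := H4 a b ha hA hB; have := H5 a b ha hA hB; have := H7 a b ha hA hB.
  have := H8 a b ha hA hB; have := H9 a b ha hA hB; have := H10 a b ha hA hB.
  move: (xk a b 3 K) (xk a b 3 K.-1) (xk a b 4 K) (xk a b 4 K.-1) (xk a b 4 K.-2) (xk a b 4 K.-2.-1).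
  move=> s4 s5 s7 s8 s9 s10 h10 h9 h8 h7 h5 h4.
  have t1 (u U w W : R) (j : nat) : `|u| <= U -> `|w| <= W -> `|j%:R * u * w| <= j%:R * U * W.
    by move=> hu hw; apply: (mm _ _ _ _) => //; apply: (mm _ _ _ _) => //; exact: (n _).
  have t2 (u U v V w W : R) (j : nat) : `|u| <= U -> `|v| <= V -> `|w| <= W -> `|j%:R * u * v * w| <= j%:R * U * V * W.
    by move=> hu hv hw; apply: (mm _ _ _ _) => //; exact: t1.
  apply: (dd _ _ _ _ _ (t1 _ _ _ _ 48%N b3 h10)).
  apply: (dd _ _ _ _ _ (nn _ _ (t2 _ _ _ _ _ _ 144%N ai b2 h9))).
  apply: (dd _ _ _ _ _ (t2 _ _ _ _ _ _ 144%N a2 bi h8)).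
  apply: (dd _ _ _ _ _ (nn _ _ (t1 _ _ _ _ 48%N a3 h7))).
  exact: (dd _ _ _ _ (t1 _ _ _ _ 24%N ai h4) (nn _ _ (t1 _ _ _ _ 24%N bi h5))).
Qed.

End TwoPoint.

(** * Potentials with harmonic kernels *)

Section HarmonicKernel.
Variable R : realType.
Implicit Types (f g : 'rV[R]_4 -> R) (x y z w v c : 'rV[R]_4) (K : nat) (i : 'I_4).

(* [sg] is the change of degree under the exchange of [d/dy_i] and [- d/dz_i]. *)
Record harmonic_kernel (D : set 'rV[R]_4) c (k : nat -> 'rV[R]_4 -> 'rV[R]_4 -> R)
  (k1 k2 k3 : 'I_4 -> nat -> 'rV[R]_4 -> 'rV[R]_4 -> R) (sg : nat -> nat) : Prop := HarmonicKernel {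
  hk_dz : forall K i y z, D y -> `|z - c| <= 1 / 2 -> is_derive z 'e_i (k K y) (k1 i K y z);
  hk_dz1 : forall K i y z, D y -> `|z - c| <= 1 / 2 -> is_derive z 'e_i (k1 i K y) (k2 i K y z);
  hk_dz2 : forall K i y z, D y -> `|z - c| <= 1 / 2 -> is_derive z 'e_i (k2 i K y) (k3 i K y z);
  hk_dy : forall K i y z, D y -> `|z - c| <= 1 / 2 ->
    is_derive y 'e_i ((k K)^~ z) (- k1 i (sg K) y z);
  hk_dy1 : forall K i y z, D y -> `|z - c| <= 1 / 2 ->
    is_derive y 'e_i (fun y => - k1 i (sg K) y z) (k2 i (sg (sg K)) y z);
  hk_laplace : forall K y z, D y -> `|z - c| <= 1 / 2 -> \sum_i k2 i K y z = 0;
  hk_bounded : forall i K y, D y -> exists r C : R, 0 < r /\ forall w z, `|w - y| < r ->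
    `|z - c| <= 1 / 2 -> D w /\ [/\ `|k K w z| <= C, `|k1 i K w z| <= C, `|k2 i K w z| <= C & `|k3 i K w z| <= C] }.

Lemma testfun_supp c f z : testfun c f -> f z != 0 -> `|z - c| <= 1 / 2.
Proof. by move=> tf fz; rewrite leNgt; apply/negP => /(proj2 tf) /eqP; apply/negP. Qed.

Lemma bounded_supp c f (G : 'rV[R]_4 -> R) (C : R) : testfun c f ->
  (forall z, `|z - c| <= 1 / 2 -> `|G z| <= C) -> bounded_on (cube c 3) (fun z => G z * f z).
Proof.
move=> tf H; have [B B0 HB] := testfun_bounded tf; exists (`|C| * B) => z _.
have [->|fz] := eqVneq (f z) 0; first by rewrite mulr0 normr0 mulr_ge0.
by rewrite normrM ler_pM// (le_trans (H z (testfun_supp tf fz)))// ler_norm.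
Qed.

(** The kernel is only controlled near the support of f. Elsewhere the product is identically zero
    on an open set, so it is differentiated separately on the two regions. *)
Lemma mean_ibp_local c L (G G1 G2 : 'rV[R]_4 -> R) f i (C : R) : is_mean c L -> testfun c f ->
  (forall z, `|z - c| <= 1 / 2 -> [/\ is_derive z 'e_i G (G1 z), is_derive z 'e_i G1 (G2 z) &
     [/\ `|G z| <= C, `|G1 z| <= C & `|G2 z| <= C]]) ->
  L (fun z => - G1 z * f z) = L (fun z => G z * partial i (f : _ -> R) z).
Proof.
move=> HL tf H; have tf1 := testfun_partial i tf; have tf2 := testfun_partial i tf1.
have b0 := fun (g : 'rV[R]_4 -> R) tg => @bounded_supp c g G C tg (fun z zc => let: And3 _ _ (And3 h _ _) := H z zc in h).
have b1 := fun (g : 'rV[R]_4 -> R) tg => @bounded_supp c g G1 C tg (fun z zc => let: And3 _ _ (And3 _ h _) := H z zc in h).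
have b2 := fun (g : 'rV[R]_4 -> R) tg => @bounded_supp c g G2 C tg (fun z zc => let: And3 _ _ (And3 _ _ h) := H z zc in h).
have Z g z : testfun c g -> 1 / 2 < `|z - c| -> g z = 0 by move=> [_]; apply.
pose D := [set z : 'rV[R]_4 | 1 / 2 < `|z - c|].
have oD : open D by exact: open_dist_gt.
have -> : (fun z => - G1 z * f z) = (fun z => - (G1 z * f z)) by apply/funext => z; rewrite mulNr.
rewrite (mean_opp HL (b1 _ tf)); apply/eqP; rewrite eq_sym -subr_eq0 opprK -(mean_add HL (b0 _ tf1) (b1 _ tf)).
apply/eqP; apply: (mean_derive_C2 HL (i := i) (g := fun z => G z * f z)
  (g' := fun z => G z * partial i f z + G1 z * f z)
  (g'' := fun z => (G1 z * partial i f z + G z * partial i (partial i f) z) +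
    (G2 z * f z + G1 z * partial i f z))).
- move=> z _; have [zc|zc] := leP `|z - c| (1 / 2).
    have [d1 _ _] := H z zc.
    by apply: (is_derive_eq (is_derive_mul d1 (testfun_derive i z tf))); rewrite addrC.
  rewrite (Z _ _ tf1 zc) (Z _ _ tf zc) !mulr0 addr0.
  apply: (is_derive_open oD zc _ (is_derive_const 0 z 'e_i)) => y yc.
  by rewrite (Z _ _ tf yc) mulr0.
- move=> z _; have [zc|zc] := leP `|z - c| (1 / 2).
    have [d1 d2 _] := H z zc.
    exact: (is_derive_add (is_derive_mul d1 (testfun_derive i z tf1)) (is_derive_mul d2 (testfun_derive i z tf))).
  rewrite (Z _ _ tf1 zc) (Z _ _ tf zc) (Z _ _ tf2 zc) !mulr0 !addr0.
  apply: (is_derive_open oD zc _ (is_derive_const 0 z 'e_i)) => y yc.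
  by rewrite (Z _ _ tf yc) (Z _ _ tf1 yc) !mulr0 addr0.
- by apply: bounded_add; [exact: b0|exact: b1].
- by apply: bounded_add; apply: bounded_add; [exact: b1|exact: b0|exact: b2|exact: b1].
- move=> z zc; have zc' : 1 / 2 < `|z - c| by apply: lt_le_trans zc; lra.
  by rewrite (Z _ _ tf zc') (Z _ _ tf1 zc') !mulr0 addr0.
Qed.

Section Fixed.
Variables (c : 'rV[R]_4) (L : ('rV[R]_4 -> R) -> R).
Hypothesis HL : is_mean c L.
Variables (D : set 'rV[R]_4) (k : nat -> 'rV[R]_4 -> 'rV[R]_4 -> R)
  (k1 k2 k3 : 'I_4 -> nat -> 'rV[R]_4 -> 'rV[R]_4 -> R) (sg : nat -> nat).
Hypothesis HK : harmonic_kernel D c k k1 k2 k3 sg.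

Definition kpot K f y := L (fun z => k K y z * f z).

Lemma kernel_ibp K f i y : D y -> testfun c f ->
  L (fun z => - k1 i K y z * f z) = L (fun z => k K y z * partial i (f : _ -> R) z).
Proof.
move=> Dy tf; have [r [C [r0 H]]] := hk_bounded HK i K Dy.
apply: (@mean_ibp_local c L (k K y) (k1 i K y) (k2 i K y) f i C HL tf) => z zc.
have ny : `|y - y| < r by rewrite subrr normr0.
have [_ [B0 B1 B2 _]] := H y z ny zc.
by split; [exact: (hk_dz HK)|exact: (hk_dz1 HK)|].
Qed.

Lemma kernel_ibp2 K f i y : D y -> testfun c f ->
  L (fun z => k2 i K y z * f z) = L (fun z => k K y z * partial i (partial i (f : _ -> R)) z).
Proof.
move=> Dy tf; have [r [C [r0 H]]] := hk_bounded HK i K Dy.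
have ny : `|y - y| < r by rewrite subrr normr0.
rewrite -(kernel_ibp K i Dy (testfun_partial i tf)).
have B (g : 'rV[R]_4 -> R) : testfun c g -> bounded_on (cube c 3) (fun z => k1 i K y z * g z).
  by move=> tg; apply: (bounded_supp tg (C := C)) => z zc; have [_ []] := H y z ny zc.
have B2 : bounded_on (cube c 3) (fun z => k2 i K y z * f z).
  by apply: (bounded_supp tf (C := C)) => z zc; have [_ []] := H y z ny zc.
have -> : (fun z => - k1 i K y z * partial i f z) = (fun z => - (k1 i K y z * partial i f z)).
  by apply/funext => z; rewrite mulNr.
rewrite (mean_opp HL (B _ (testfun_partial i tf))).
rewrite -(@mean_ibp_local c L (k1 i K y) (k2 i K y) (k3 i K y) f i C HL tf) => [|z zc].
  rewrite -(mean_opp HL); last by under eq_fun do rewrite mulNr; exact: bounded_opp.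
  by congr L; apply/funext => z; rewrite mulNr opprK.
have [_ [? ? ? ?]] := H y z ny zc.
by split; [exact: (hk_dz1 HK)|exact: (hk_dz2 HK)|].
Qed.

Lemma kpot_derive K f i y : D y -> testfun c f ->
  is_derive y 'e_i (kpot K f) (kpot (sg K) (partial i (f : _ -> R)) y).
Proof.
move=> Dy tf.
have [r [C [r0 H]]] := hk_bounded HK i K Dy.
have [r' [C' [r0' H']]] := hk_bounded HK i (sg K) Dy.
have [r'' [C'' [r0'' H'']]] := hk_bounded HK i (sg (sg K)) Dy.
apply: (@kernel_derive R c L f i y (k K) (fun w z => - k1 i (sg K) w z) (fun w z => k2 i (sg (sg K)) w z)
  (fun z => k (sg K) y z * partial i f z) (Num.min r (Num.min r' r'')) (Num.max C (Num.max C' C'')) HL).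
- by rewrite !lt_min r0 r0'.
- exact: testfun_bounded_on tf.
- move=> w z _; rewrite !lt_min => /and3P[w1 w2 w3] /(testfun_supp tf) zc.
  have [Dw [B1 _ _ _]] := H w z w1 zc; have [_ [_ B2 _ _]] := H' w z w2 zc; have [_ [_ _ B3 _]] := H'' w z w3 zc.
  split; [exact: (hk_dy HK)|exact: (hk_dy1 HK)|].
  by rewrite normrN !le_max B1 B2 B3 !orbT.
- exact: kernel_ibp.
Qed.

Lemma kpot_locally_bounded K f : testfun c f -> locally_bounded D (kpot K f).
Proof.
move=> tf y Dy; have [r [C [r0 H]]] := hk_bounded HK 0 K Dy.
have [B B0 HB] := testfun_bounded tf.
exists r, (`|C| * B); split=> // w wr; apply: (mean_le HL) => z _.
have [->|fz] := eqVneq (f z) 0; first by rewrite mulr0 normr0 mulr_ge0.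
have [_ [H1 _ _ _]] := H w z wr (testfun_supp tf fz).
by rewrite normrM ler_pM// (le_trans H1)// ler_norm.
Qed.

(** A derivative in y becomes one in z and then falls on f; each such exchange changes the
    truncation from K to [sg K]. *)
Lemma kpot_jet K f : testfun c f -> jet D (fun s => kpot (iter (size s) sg K) (pd s f)).
Proof.
move=> tf s; have ts := testfun_pd s tf; split; last exact: kpot_locally_bounded.
by move=> i y Dy /=; exact: kpot_derive.
Qed.

Lemma kpot_laplace K f y : D y -> testfun c f ->
  \sum_i kpot K (partial i (partial i (f : _ -> R))) y = 0.
Proof.
move=> Dy tf.
have b2 i : bounded_on (cube c 3) (fun z => k2 i K y z * f z).
  have [r [C [r0 H]]] := hk_bounded HK i K Dy.
  apply: (bounded_supp tf (C := C)) => z zc; have ny : `|y - y| < r by rewrite subrr normr0.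
  by have [_ []] := H y z ny zc.
rewrite (eq_bigr (fun i => L (fun z => k2 i K y z * f z))) => [|i _]; last by rewrite kernel_ibp2.
rewrite -(mean_sum HL) => //.
apply/eqP; rewrite -normr_le0; apply: (mean_le HL) => z _.
rewrite -mulr_suml; have [->|fz] := eqVneq (f z) 0; first by rewrite mulr0 normr0.
by rewrite (hk_laplace HK)// ?mul0r ?normr0//; exact: testfun_supp fz.
Qed.

Lemma testfun_pd_bounded f n : testfun c f ->
  exists2 B : R, 0 <= B & forall s, (size s <= n)%N -> forall z, `|pd s f z| <= B.
Proof.
elim: n f => [|n IH] f tf.
  have [B B0 HB] := testfun_bounded tf; exists B => // -[|//] _ z; exact: HB.
have [B0 B00 HB0] := testfun_bounded tf.
have /choice[B HB] : forall i, exists B : R, 0 <= B /\ forall s, (size s <= n)%N ->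
    forall z, `|pd s (partial i (f : _ -> R)) z| <= B.
  by move=> i; have [B ? HB] := IH _ (testfun_partial i tf); exists B.
exists (B0 + \sum_i B i); first by rewrite addr_ge0// sumr_ge0// => i _; have [] := HB i.
move=> s; case/lastP: s => [|s i] sn z.
  by rewrite (le_trans (HB0 z))// lerDl sumr_ge0// => i _; have [] := HB i.
rewrite /pd -cats1 foldr_cat /= -/(pd s (partial i f)).
have [Bi0 Hi] := HB i; rewrite size_rcons ltnS in sn.
apply: (le_trans (Hi s sn z)); rewrite (bigD1 i)//= addrCA lerDl addr_ge0// sumr_ge0// => j _.
by have [] := HB j.
Qed.

Lemma pd_supp f (rho : R) s z : smooth setT f -> (forall z, rho < `|z - c| -> f z = 0) ->
  rho < `|z - c| -> pd s f z = 0.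
Proof.
move=> sf f0; elim: s z => [|i s IH] z zc; first exact: f0.
rewrite /=; apply: is_derive_partial.
have E y : [set y : 'rV[R]_4 | rho < `|y - c|] y -> (fun=> 0) y = pd s f y by move=> /IH ->.
exact: (is_derive_open (@open_dist_gt R c rho) zc E (is_derive_const 0 z 'e_i)).
Qed.

Lemma iter_shift K m : (forall K, (K <= (sg K).+1)%N) -> (K <= iter m sg K + m)%N.
Proof.
move=> H; elim: m => [|m IH] /=; first by rewrite addn0.
by apply: (leq_trans IH); rewrite addnS -addSn leq_add2r.
Qed.

(** Both potentials have their derivatives on f, so the remainder of the undifferentiated kernel
    controls all orders up to n, with a common bound for the derivatives of f. *)
Lemma kpot_approx f n (rho e M d : R) (G : set 'rV[R]_4) : testfun c f -> 0 < e -> 0 < d ->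
  (forall K, (K <= (sg K).+1)%N) -> G `<=` D -> rho <= 1 / 2 -> (forall z, rho < `|z - c| -> f z = 0) ->
  (forall y z, G y -> `|z - c| <= rho -> d <= `|y - z|) ->
  (forall y z K, G y -> `|z - c| <= rho -> `|(sq (y - z))^-1 - k K y z| <= 2^-1 ^+ K * M) ->
  exists K, forall s y, (size s <= n)%N -> G y ->
    `|pot L (pd s f) y - kpot (iter (size s) sg K) (pd s f) y| <= e.
Proof.
move=> tf e0 d0 sgP GD rho2 f0 Hd HM.
have [B B0 HB] := testfun_pd_bounded n tf.
(* N terms make the error at most e; the n additional ones are a reserve, since each derivative may
   lower the truncation by one. *)
pose N := (Num.truncn (`|M| * B / e)).+1; exists (N + n)%N => s y sn Gy.
have ts := testfun_pd s tf; set g := pd s f; set K := iter _ _ _.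
have g0 z : g z != 0 -> `|z - c| <= rho.
  by move=> gz; rewrite leNgt; apply/negP => /(pd_supp s (proj1 tf) f0) /eqP; apply/negP.
rewrite (pot_far HL ts d0) => [|z /g0]; last exact: Hd.
have [r [C [r0 H]]] := hk_bounded HK 0 K (GD y Gy).
have ny : `|y - y| < r by rewrite subrr normr0.
have b1 : bounded_on (cube c 3) (fun z => k K y z * g z).
  by apply: (bounded_supp ts (C := C)) => z zc; have [_ []] := H y z ny zc.
have b2 : bounded_on (cube c 3) (fun z => (sq (y - z))^-1 * g z).
  exists (d ^- 2 * B) => z _; have [->|gz] := eqVneq (g z) 0.
    by rewrite mulr0 normr0 mulr_ge0// invr_ge0 exprn_ge0// ltW.
  rewrite normrM; apply: ler_pM => //; last exact: HB.
  have dz := Hd y z Gy (g0 z gz).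
  have p : d ^+ 2 <= sq (y - z).
    by apply: le_trans (norm_sq_le _); apply: lerXn2r; rewrite ?nnegrE ?(ltW d0).
  have p0 : 0 < d ^+ 2 by rewrite exprn_gt0.
  by rewrite ger0_norm ?invr_ge0 ?sq_ge0// lef_pV2 ?posrE// (lt_le_trans p0).
apply: (mean_dist HL b2 b1) => z _.
rewrite -mulrBl normrM; have [->|gz] := eqVneq (g z) 0; first by rewrite normr0 mulr0 ltW.
have NK : (N <= K)%N.
  rewrite -(leq_add2r (size s)) (leq_trans _ (iter_shift (N + n) (size s) sgP))//.
  by rewrite leq_add2l.
have X : 2^-1 ^+ K * (`|M| * B) <= e.
  rewrite exprVn [_^-1 * _]mulrC ler_pdivrMr ?exprn_gt0// [e * _]mulrC -ler_pdivrMr//.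
  apply: ltW; apply: (lt_le_trans (truncnS_gt _)); rewrite -natrX ler_nat.
  by apply: (leq_trans NK); apply: ltnW; exact: ltn_expl.
apply: le_trans X; rewrite mulrA; apply: ler_pM => //; last exact: HB.
apply: (le_trans (HM y z K Gy (g0 z gz))); rewrite ler_wpM2l ?ler_norm//.
Qed.

End Fixed.
End HarmonicKernel.

(** * Harmonic approximation with a pole outside the domain *)

Section Poles.
Variable R : realType.
Implicit Types (f : 'rV[R]_4 -> R) (a b x y z w v c p : 'rV[R]_4) (K : nat) (i : 'I_4).

Lemma sq_gt0 a : a != 0 -> 0 < sq a.
Proof. by move=> a0; apply: lt_le_trans (norm_sq_le a); rewrite exprn_gt0// normr_gt0. Qed.

Lemma sqN a : sq (- a) = sq a.
Proof. by apply: eq_bigr => i _; rewrite !mxE mulrNN. Qed.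

(* The expansion of 1/|y-z|^2 around z = p. *)
Lemma pole_kernel p c : harmonic_kernel [set y | y != p] c
  (fun K y z => xk (y - p) (z - p) 1 K) (fun i K y z => - xk1 i K.-1 (y - p) (z - p))
  (fun i K y z => xk2 i K.-2 (y - p) (z - p)) (fun i K y z => - xk3 i K.-2.-1 (y - p) (z - p)) S.
Proof.
have nz y : y != p -> sq (y - p) != 0 by move=> yp; rewrite gt_eqF// sq_gt0// subr_eq0.
split.
- move=> K i y z Dy _; apply: (is_derive_translate (G := fun b => xk (y - p) b 1 K)).
  exact: is_derive_xk_r1 (nz y Dy).
- move=> K i y z Dy _; apply: (is_derive_translate (G := fun b => - xk1 i K.-1 (y - p) b)).
  by apply: (is_derive_eq (is_derive_opp (is_derive_xk1_r _ i K.-1 (nz y Dy)))); rewrite opprK.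
- move=> K i y z Dy _; apply: (is_derive_translate (G := fun b => xk2 i K.-2 (y - p) b)).
  exact: is_derive_xk2_r (nz y Dy).
- move=> K i y z Dy _; rewrite opprK /=; apply: (is_derive_translate (G := fun a => xk a (z - p) 1 K)).
  exact: is_derive_xk_l1 (nz y Dy).
- move=> K i y z Dy _ /=.
  have -> : (fun y => - - xk1 i K (y - p) (z - p)) = (fun y => xk1 i K (y - p) (z - p)).
    by apply/funext => w; rewrite opprK.
  apply: (is_derive_translate (G := fun a => xk1 i K a (z - p))).
  exact: is_derive_xk1_l (nz y Dy).
- by move=> K y z Dy _; exact: xk_laplace (nz y Dy).
- move=> i K y /= Dy; have y0 : 0 < `|y - p| by rewrite normr_gt0 subr_eq0.
  pose a0 := (`|y - p| / 2) ^+ 2; have a00 : 0 < a0 by rewrite exprn_gt0// divr_gt0.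
  pose M := Num.max (2 * `|y - p|) (`|c - p| + 1 / 2).
  have [C0 H0] := xk_bounded M i K a00; have [C1 H1] := xk_bounded M i K.-1 a00.
  have [C2 H2] := xk_bounded M i K.-2 a00; have [C3 H3] := xk_bounded M i K.-2.-1 a00.
  exists (`|y - p| / 2), (Num.max (Num.max C0 C1) (Num.max C2 C3)); split; first by rewrite divr_gt0.
  move=> w z wy zc.
  have n1 : `|y - p| <= `|w - y| + `|w - p| by rewrite (distrC w y) ler_distD.
  have n2 : `|w - p| <= `|w - y| + `|y - p| by exact: ler_distD.
  have n3 : `|z - p| <= `|z - c| + `|c - p| by exact: ler_distD.
  have w1 : `|y - p| / 2 <= `|w - p|.
    have : `|y - p| <= `|y - p| / 2 + `|w - p| by rewrite (le_trans n1)// lerD2r ltW.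
    by move: (`|y - p|) (`|w - p|) => s t; lra.
  have h1 : a0 <= sq (w - p).
    by apply: le_trans (norm_sq_le _); apply: lerXn2r; rewrite ?nnegrE ?divr_ge0.
  have h2 : `|w - p| <= M.
    rewrite /M le_max; apply/orP; left; apply: (le_trans n2).
    have : `|w - y| + `|y - p| <= `|y - p| / 2 + `|y - p| by rewrite lerD2r ltW.
    by move=> /le_trans; apply; move: y0; move: (`|y - p|) => s; lra.
  have h3 : `|z - p| <= M.
    by rewrite /M le_max; apply/orP; right; apply: (le_trans n3); rewrite addrC lerD2l.
  have [g0 _ _ _] := H0 _ _ h1 h2 h3; have [_ g1 _ _] := H1 _ _ h1 h2 h3.
  have [_ _ g2 _] := H2 _ _ h1 h2 h3; have [_ _ _ g3] := H3 _ _ h1 h2 h3.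
  split; first by apply/eqP => wp; move: w1; rewrite wp subrr normr0 leNgt divr_gt0.
  by rewrite !normrN !le_max g0 g1 g2 g3 !orbT.
Qed.

(* The expansion of 1/|y-z|^2 around y = 0, valid for z large, that is, for a pole at infinity. *)
Lemma infinity_kernel c : 1 <= `|c| -> harmonic_kernel setT c
  (fun K y z => xk z y 1 K) (fun i K y z => xk1 i K z y)
  (fun i K y z => xk2 i K z y) (fun i K y z => xk3 i K z y) predn.
Proof.
move=> c1; have zge z : `|z - c| <= 1 / 2 -> 1 / 2 <= `|z|.
  move=> zc; have n1 : `|c| <= `|z| + `|z - c|.
    have E : c = z - (z - c) by rewrite opprB addrC subrK.
    by rewrite [in leLHS]E ler_normB.
  have : 1 <= `|z| + 1 / 2 by rewrite (le_trans c1)// (le_trans n1)// lerD2l.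
  by move: (`|z|) => s; lra.
have zsq z : `|z - c| <= 1 / 2 -> 1 / 4 <= sq z.
  move=> /zge h; apply: le_trans (norm_sq_le _); apply: (@le_trans _ _ ((1 / 2) ^+ 2)); first by lra.
  by apply: lerXn2r; rewrite ?nnegrE.
have nz z : `|z - c| <= 1 / 2 -> sq z != 0.
  by move=> /zsq h; rewrite gt_eqF// (lt_le_trans _ h).
split.
- by move=> K i y z _ /nz h; exact: is_derive_xk_l1.
- by move=> K i y z _ /nz h; exact: is_derive_xk1_l.
- by move=> K i y z _ /nz h; exact: is_derive_xk2_l.
- by move=> K i y z _ /nz h; exact: is_derive_xk_r1.
- move=> K i y z _ /nz h.
  by apply: (is_derive_eq (is_derive_opp (is_derive_xk1_r y i K.-1 h))); rewrite opprK.
- by move=> K y z _ /nz h; exact: xk_laplace.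
- move=> i K y _; pose M := Num.max (`|y| + 1) (`|c| + 1 / 2).
  have q0 : 0 < 1 / 4 :> R by [].
  have [C H] := xk_bounded M i K q0; exists 1, C; split=> // w z wy zc; split=> //.
  apply: H; first exact: zsq.
    rewrite /M le_max; apply/orP; right.
    have E : z = c + (z - c) by rewrite addrC subrK.
    by rewrite [in leLHS]E (le_trans (ler_normD _ _))// lerD2l.
  rewrite /M le_max; apply/orP; left.
  have E : w = y + (w - y) by rewrite addrC subrK.
  by rewrite [in leLHS]E (le_trans (ler_normD _ _))// lerD2l ltW.
Qed.

Lemma sq_sub a b : sq (a - b) = sq a - 2 * dot a b + sq b.
Proof.
rewrite /sq /dot mulr_sumr -sumrB -big_split /=; apply: eq_bigr => i _.
by rewrite !mxE; ring.
Qed.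

(** The ratio 16 in the maximum norm gives |b|^2 <= |a|^2 / 64 for Euclidean lengths. Together with
    2 |a . b| <= |a|^2 / 8 + 8 |b|^2 this yields the hypotheses of [xp_remainder]. *)
Lemma xk_remainder a b K : a != 0 -> 16 * `|b| <= `|a| ->
  `|(sq (a - b))^-1 - xk a b 1 K| <= 2^-1 ^+ K * (4 / `|a| ^+ 2).
Proof.
move=> a0 ba; have A0 := sq_gt0 a0; have na : 0 < `|a| by rewrite normr_gt0.
have h1 : sq b <= sq a / 64.
  apply: (le_trans (sq_le_norm b)).
  apply: (@le_trans _ _ (`|a| ^+ 2 / 64)); last by rewrite ler_pM2r// norm_sq_le.
  have : (16 * `|b|) ^+ 2 <= `|a| ^+ 2 by apply: lerXn2r; rewrite ?nnegrE ?mulr_ge0.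
  rewrite exprMn => h; have {}h : 256 * `|b| ^+ 2 <= `|a| ^+ 2 by apply: le_trans h; rewrite -natrX.
  by rewrite ler_pdivlMr// mulrAC -natrM.
have h2 : `|2 * dot a b| <= sq a / 4.
  apply: (@le_trans _ _ (sq a / 8 + 8 * sq b)); last by move: h1; lra.
  rewrite /dot /sq mulr_sumr mulr_suml mulr_sumr -big_split /=.
  apply: (le_trans (ler_norm_sum _ _ _)); apply: ler_sum => i _.
  rewrite ler_norml; move: (a 0 i) (b 0 i) => s t; apply/andP; split.
    have : 0 <= (s + 8 * t) ^+ 2 by exact: sqr_ge0.
    by rewrite expr2; nra.
  have : 0 <= (s - 8 * t) ^+ 2 by exact: sqr_ge0.
  by rewrite expr2; nra.
rewrite sq_sub; apply: (le_trans (xp_remainder K A0 (sq_ge0 b) h1 h2)).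
apply: ler_wpM2l; first by rewrite exprn_ge0// invr_ge0.
rewrite -invf_div lef_pV2 ?posrE ?divr_gt0 ?exprn_gt0//; last first.
  by move: h2; rewrite ler_norml => /andP[_ ?]; have := sq_ge0 b; lra.
have na2 := norm_sq_le a; move: h2; rewrite ler_norml => /andP[_ h2]; have b0 := sq_ge0 b.
apply: (@le_trans _ _ (sq a / 4)); first by rewrite ler_pM2r.
lra.
Qed.

Definition harmonic_jet (Om : set 'rV[R]_4) (T : seq 'I_4 -> 'rV[R]_4 -> R) :=
  jet Om T /\ forall y, Om y -> \sum_i T [:: i; i] y = 0.

Lemma jet_subset (D Om : set 'rV[R]_4) (T : seq 'I_4 -> 'rV[R]_4 -> R) : Om `<=` D -> jet D T -> jet Om T.
Proof.
by move=> sub jT s; have [d b] := jT s; split=> [i x /sub|x /sub]; [exact: d|exact: b].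
Qed.

(** The truncated potential has p as its only singularity. It is therefore harmonic on all of Om,
    including the support of f, although it is close to the potential only far away. *)
Lemma pole_approx c L f (Om : set 'rV[R]_4) p n (rho e d : R) (G : set 'rV[R]_4) :
  is_mean c L -> testfun c f -> 0 < e -> 0 < d -> ~ Om p -> rho <= 1 / 2 ->
  (forall z, rho < `|z - c| -> f z = 0) ->
  (forall y z, G y -> `|z - c| <= rho -> d <= `|y - p| /\ 16 * `|z - p| <= `|y - p|) ->
  exists2 T, harmonic_jet Om T & forall s y, (size s <= n)%N -> Om y -> G y ->
    `|pot L (pd s f) y - T s y| <= e.
Proof.
move=> HL tf e0 d0 Op rho2 f0 H.
have HK := pole_kernel p c.
have sub : Om `<=` [set y | y != p] by move=> y Oy /=; apply/eqP => yp; apply: Op; rewrite -yp.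
have sgP K : (K <= K.+2)%N by rewrite ltnW.
have d2 : 0 < d / 2 by rewrite divr_gt0.
have [K HKK] : exists K, forall s y, (size s <= n)%N -> (Om `&` G) y ->
    `|pot L (pd s f) y - kpot L (fun K y z => xk (y - p) (z - p) 1 K) (iter (size s) S K) (pd s f) y| <= e.
  have X := (@kpot_approx R c L HL _ _ _ _ _ _ HK f n rho e (4 / d ^+ 2) (d / 2) (Om `&` G) tf e0 d2 sgP _ rho2 f0).
  apply: X.
  - by move=> y [/sub].
  - move=> y z [_ Gy] zc; have [h1 h2] := H y z Gy zc.
    have n1 : `|y - p| <= `|y - z| + `|z - p| by exact: ler_distD.
    by move: h1 h2 n1 (normr_ge0 (z - p)); move: (`|y - p|) (`|y - z|) (`|z - p|) => s t u; lra.
  - move=> y z K [/sub /= yp Gy] zc; have [h1 h2] := H y z Gy zc.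
    have a0 : y - p != 0 by rewrite subr_eq0.
    have -> : y - z = (y - p) - (z - p) by apply/rowP => j; rewrite !mxE; ring.
    apply: (le_trans (xk_remainder K a0 h2)); apply: ler_wpM2l; first by rewrite exprn_ge0// invr_ge0.
    rewrite ler_pM2l// lef_pV2 ?posrE ?exprn_gt0 ?normr_gt0//.
    by apply: lerXn2r; rewrite ?nnegrE ?(ltW d0).
exists (fun s => kpot L (fun K y z => xk (y - p) (z - p) 1 K) (iter (size s) S K) (pd s f)).
  split; first exact: jet_subset sub (kpot_jet HL HK K tf).
  by move=> y /sub Dy; exact: (kpot_laplace HL HK K.+2 Dy tf).
by move=> s y sn Oy Gy; exact: HKK.
Qed.

Lemma infinity_approx c L f (Om : set 'rV[R]_4) n (rho e : R) (G : set 'rV[R]_4) :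
  is_mean c L -> testfun c f -> 0 < e -> 1 <= `|c| -> rho <= 1 / 2 ->
  (forall z, rho < `|z - c| -> f z = 0) ->
  (forall y z, G y -> `|z - c| <= rho -> 1 <= `|z| /\ 16 * `|y| <= `|z|) ->
  exists2 T, harmonic_jet Om T & forall s y, (size s <= n)%N -> Om y -> G y ->
    `|pot L (pd s f) y - T s y| <= e.
Proof.
move=> HL tf e0 c1 rho2 f0 H.
have HK := infinity_kernel c1.
have sub : Om `<=` setT by [].
have sgP K : (K <= K.-1.+1)%N by case: K.
have d2 : 0 < 1 / 2 :> R by [].
have [K HKK] : exists K, forall s y, (size s <= n)%N -> (Om `&` G) y ->
    `|pot L (pd s f) y - kpot L (fun K y z => xk z y 1 K) (iter (size s) predn K) (pd s f) y| <= e.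
  have X := (@kpot_approx R c L HL _ _ _ _ _ _ HK f n rho e 4 (1 / 2) (Om `&` G) tf e0 d2 sgP _ rho2 f0).
  apply: X => //.
  - move=> y z [_ Gy] zc; have [h1 h2] := H y z Gy zc.
    have n1 : `|z| <= `|y| + `|y - z|.
      have E : z = y - (y - z) by rewrite opprB addrC subrK.
      by rewrite [in leLHS]E ler_normB.
    by move: h1 h2 n1 (normr_ge0 y); move: (`|z|) (`|y - z|) (`|y|) => s t u; lra.
  - move=> y z K [_ Gy] zc; have [h1 h2] := H y z Gy zc.
    have a0 : z != 0 by rewrite -normr_gt0 (lt_le_trans _ h1).
    rewrite -sqN opprB; apply: (le_trans (xk_remainder K a0 h2)).
    apply: ler_wpM2l; first by rewrite exprn_ge0// invr_ge0.
    rewrite -[leRHS]mulr1 ler_pM2l// invf_le1 ?exprn_gt0 ?normr_gt0//.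
    by rewrite exprn_ege1.
exists (fun s => kpot L (fun K y z => xk z y 1 K) (iter (size s) predn K) (pd s f)).
  split; first exact: jet_subset sub (kpot_jet HL HK K tf).
  by move=> y _; exact: (kpot_laplace HL HK K.-2 I tf).
by move=> s y sn Oy Gy; exact: HKK.
Qed.

End Poles.

(** * The Poisson equation on an open set *)

Section Bump.
Variable R : realType.
Implicit Types (p : {poly R}) (t x : R).

Lemma is_derive_horner p t : is_derive t 1 (horner p) (p^`()).[t].
Proof. by have := derivableP (@derivable_horner R p t); rewrite -derive1E derivE. Qed.

Lemma horner_growth p : exists (C : R) (k : nat), 0 <= C /\ forall t, 1 <= t -> `|p.[t]| <= C * t ^+ k.
Proof.
elim/poly_ind: p => [|p a [C [k [C0 H]]]].
  by exists 0, 0%N; split=> // t _; rewrite horner0 normr0 mul0r.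
exists (C + `|a|), k.+1; split=> [|t t1]; first by rewrite addr_ge0.
rewrite hornerMXaddC (le_trans (ler_normD _ _))// mulrDl lerD//.
  rewrite normrM exprSr mulrA [`|t|]ger0_norm ?(le_trans _ t1)//.
  by rewrite ler_wpM2r ?(le_trans _ t1)// H.
by rewrite ler_peMr// exprn_ege1.
Qed.

(** With t = 1/h this is a bound by C h^2, exactly what [is_derive_quad] needs for the derivatives
    of the flat function to vanish at 0. *)
Lemma horner_expR_decay p : exists C : R, forall t, 1 <= t -> `|p.[t] * expR (- t)| <= C * t ^- 2.
Proof.
have [C [k [C0 H]]] := horner_growth p.
exists (C * k.+2`!%:R) => t t1; have t0 : 0 < t := lt_le_trans ltr01 t1.
rewrite normrM [`|expR _|]ger0_norm ?expR_ge0// expRN.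
rewrite ler_pdivrMr ?expR_gt0// (le_trans (H t t1))//.
have E : t ^+ k.+2 <= expR t * k.+2`!%:R.
  rewrite -ler_pdivrMr ?ltr0n ?fact_gt0//.
  by apply: le_trans (expR_ge1Dxn k.+1 (ltW t0)); rewrite lerDr.
rewrite -!mulrA; apply: ler_wpM2l => //.
have -> : k.+2`!%:R * (t ^- 2 * expR t) = expR t * k.+2`!%:R / t ^+ 2.
  by move: (expR t) (t ^- 2) (k.+2`!%:R : R) => u v w; ring.
by rewrite ler_pdivlMr ?exprn_gt0// -exprD addn2.
Qed.

(** With w = 1/x, differentiation in x is -w^2 d/dw, which maps p(w) exp(-w) to w^2 (p - p')(w)
    exp(-w). *)
Fixpoint flat_poly (n : nat) : {poly R} :=
  if n is m.+1 then 'X^2 * (flat_poly m - (flat_poly m)^`()) else 1.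

(* the derivatives of exp(-1/x) extended by 0 *)
Definition flat (n : nat) x : R := if 0 < x then (flat_poly n).[x^-1] * expR (- x^-1) else 0.

Lemma smooth1_flat : smooth1 setT flat.
Proof.
move=> n x _; have [x0|x0|<-] := ltgtP 0 x.
- have x00 : x != 0 by rewrite gt_eqF.
  have Dp := is_derive_comp1 (is_derive_horner (flat_poly n) x^-1) (is_derive_invR x00).
  have De := is_derive_comp1 (f := fun y : R => - y^-1) (is_derive_expR (- x^-1)) (is_derive_opp (is_derive_invR x00)).
  have D := is_derive_mul Dp De.
  apply: (@is_derive_near R R (fun y : R => (flat_poly n).[y^-1] * expR (- y^-1)) (flat n) x 1 _ x) => //.
    move=> h hx; rewrite /flat ifT// [h%:A]mulr1.
    by have := ler_norm (- h); rewrite normrN; move: hx; move: (`|h|) => s; lra.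
  apply: (is_derive_eq D); rewrite /flat x0 /= hornerM hornerXn hornerD hornerN.
  set s := (flat_poly n).[x^-1]; set t := (flat_poly n)^`().[x^-1]; set u := expR (- x^-1).
  by move: s t u (x^-1) => s t u w; ring.
- rewrite {2}/flat ltNge ltW//=.
  apply: (@is_derive_near R R (fun=> 0) (flat n) x 1 0 (- x)); first by rewrite oppr_gt0.
    move=> h hx; rewrite /flat ifF// [h%:A]mulr1; apply/negbTE; rewrite -leNgt.
    by have := ler_norm h; move: hx; move: (`|h|) => s; lra.
- rewrite {2}/flat ltxx; have [C HC] := horner_expR_decay (flat_poly n).
  apply: (@is_derive_quad _ _ _ _ _ _ 1 (Num.max C 0)) => // h h1.
  rewrite [h%:A]mulr1 add0r mulr0 subr0 {2}/flat ltxx subr0 /flat.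
  case: ltP => h0; last by rewrite normr0 mulr_ge0 ?sqr_ge0// le_max lexx orbT.
  have hi : 1 <= h^-1.
    by rewrite -invr1 lef_pV2 ?posrE// ltW// (le_lt_trans (ler_norm h)).
  apply: (le_trans (HC _ hi)); rewrite exprVn invrK ler_wpM2r ?sqr_ge0//.
  by rewrite le_max lexx.
Qed.

Lemma flat_le0 x : x <= 0 -> flat 0 x = 0.
Proof. by rewrite /flat leNgt => /negbTE ->. Qed.

Lemma flat_gt0 x : 0 < x -> 0 < flat 0 x.
Proof. by move=> x0; rewrite /flat x0 hornerC mul1r expR_gt0. Qed.

Lemma flat_mono x t : 0 < x -> x <= t -> flat 0 x <= flat 0 t.
Proof.
move=> x0 xt; have t0 := lt_le_trans x0 xt.
by rewrite /flat x0 t0 !hornerC !mul1r ler_expR lerN2 lef_pV2.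
Qed.

Implicit Types (y c : 'rV[R]_4).

(** A smooth step in g from 0 to 1. Nesting the flat function replaces the usual quotient, so the
    only division is by a constant. *)
Definition step (g : 'rV[R]_4 -> R) y : R :=
  (flat 0 (flat 0 1))^-1 * flat 0 (flat 0 1 - flat 0 (1 - g y)).

Lemma smooth_step g : smooth setT g -> smooth setT (step g).
Proof.
move=> sg; have oT : open (setT : set 'rV[R]_4) by exact: openT.
apply: smooth_mul => //; first exact: smooth_cst.
apply: (smooth_comp oT smooth1_flat) => //.
apply: smooth_sub => //; first exact: smooth_cst.
apply: (smooth_comp oT smooth1_flat) => //.
by apply: smooth_sub => //; exact: smooth_cst.
Qed.

Lemma step_le0 g y : g y <= 0 -> step g y = 0.
Proof.
move=> g0; rewrite /step [flat 0 (_ - _)]flat_le0 ?mulr0// subr_le0 flat_mono//.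
by rewrite lerBrDr gerDl.
Qed.

Lemma step_ge1 g y : 1 <= g y -> step g y = 1.
Proof.
move=> g1; rewrite /step [flat 0 (1 - _)]flat_le0 ?subr_le0// subr0 mulVf//.
by rewrite gt_eqF// !flat_gt0.
Qed.

(** Balls of the maximum norm are cubes, so a product of two steps per coordinate, one for each
    face, is enough. *)
Lemma bump_exists c (r : R) : 0 < r -> exists phi : 'rV[R]_4 -> R,
  [/\ smooth setT phi, forall y, `|y - c| <= r -> phi y = 1 &
      forall y, 2 * r < `|y - c| -> phi y = 0].
Proof.
move=> r0; have oT : open (setT : set 'rV[R]_4) by exact: openT.
pose gm i (y : 'rV[R]_4) : R := 2 - r^-1 * (y 0 i - c 0 i).
pose gp i (y : 'rV[R]_4) : R := 2 - r^-1 * (c 0 i - y 0 i).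
have sm i : smooth setT (gm i).
  apply: smooth_sub => //; first exact: smooth_cst.
  apply: smooth_mul => //; first exact: smooth_cst.
  by apply: smooth_sub => //; [exact: smooth_coord|exact: smooth_cst].
have sp i : smooth setT (gp i).
  apply: smooth_sub => //; first exact: smooth_cst.
  apply: smooth_mul => //; first exact: smooth_cst.
  by apply: smooth_sub => //; [exact: smooth_cst|exact: smooth_coord].
exists (fun y => \prod_i (step (gm i) y * step (gp i) y)); split.
- by apply: smooth_prod => // i _; apply: smooth_mul => //; exact: smooth_step.
- move=> y yr; apply: big1 => i _.
  have := le_trans (coord_le_norm (y - c) i) yr; rewrite !mxE ler_norml => /andP[h1 h2].
  have k1 : r^-1 * (y 0 i - c 0 i) <= 1 by rewrite ler_pdivrMl// mulr1.
  have k2 : r^-1 * (c 0 i - y 0 i) <= 1 by rewrite ler_pdivrMl// mulr1 lerNl opprB in h1 *.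
  by rewrite !step_ge1 ?mulr1// /gm /gp; lra.
- move=> y yr; suff [i Hi] : exists i, 2 * r < `|y 0 i - c 0 i|.
    apply/eqP; rewrite prodf_seq_eq0; apply/hasP; exists i; first exact: mem_index_enum.
    rewrite /= mulf_eq0; move: Hi; rewrite lter_normr => /orP[h|h]; apply/orP; [left|right].
      by rewrite step_le0// /gm subr_le0 ler_pdivlMl// mulrC ltW.
    by rewrite step_le0// /gp subr_le0 ler_pdivlMl// mulrC -opprB ltW.
  apply: contrapT => /forallNP H; move: yr; apply/negP; rewrite -leNgt.
  apply: normrV_le => [|i]; first by rewrite mulr_ge0// ltW.
  by rewrite !mxE leNgt; apply/negP; exact: H.
Qed.

End Bump.

(** * Splitting of the source, correction of the pieces and summation *)

Section Poisson.
Variable R : realType.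
Implicit Types (f g h u : 'rV[R]_4 -> R) (x y z p : 'rV[R]_4) (Om : set 'rV[R]_4).

Lemma smooth_union Om Om' f : smooth Om f -> smooth Om' f -> smooth (Om `|` Om') f.
Proof.
move=> s1 s2 k; have := s1 k; have := s2 k.
elim: k f {s1 s2} => [|k IH] f [c2 H2] [c1 H1]; split => //.
- by move=> x [/c1|/c2].
- by move=> x [/c1|/c2].
move=> i; have [d1 k1] := H1 i; have [d2 k2] := H2 i; split; last exact: IH.
by move=> x [/d1|/d2].
Qed.

Lemma rat_approx x (e : R) : 0 < e -> exists q : 'rV[rat]_4, `|x - \row_i ratr (q 0 i)| < e.
Proof.
move=> e0; have e2 : 0 < e / 2 by rewrite divr_gt0.
have /choice[q Hq] : forall i : 'I_4, exists q : rat, `|x 0 i - ratr q| <= e / 2.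
  move=> i; have : x 0 i - e / 2 < x 0 i + e / 2 by lra.
  move=> /rat_in_itvoo[q]; rewrite in_itv /= => /andP[h1 h2]; exists q.
  by rewrite ler_norml; lra.
exists (\row_i q i); apply: (@le_lt_trans _ _ (e / 2)); last by lra.
by apply: normrV_le => [|i]; [exact: ltW|rewrite !mxE].
Qed.

(** Balls with rational centres and radii 1/(16 (k+1)), enumerated through [pickle]. Having the
    eightfold ball in Om keeps every point outside Om far from the twofold ball that will carry a
    piece. *)
Lemma ball_cover Om : open Om -> Om !=set0 ->
  exists (c : nat -> 'rV[R]_4) (r : nat -> R),
  (forall n, [/\ 0 < r n, r n <= 1 / 16 & forall y, `|y - c n| <= 8 * r n -> Om y]) /\
  forall x, Om x -> exists n, `|x - c n| < r n.
Proof.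
move=> oOm [x0 Ox0].
pose good (d : 'rV[R]_4 * R) := [/\ 0 < d.2, d.2 <= 1 / 16 & forall y, `|y - d.1| <= 8 * d.2 -> Om y].
pose P n (d : 'rV[R]_4 * R) := good d /\ forall (q : 'rV[rat]_4) (k : nat), unpickle n = Some (q, k) ->
  good (\row_i ratr (q 0 i), 1 / (16 * k.+1%:R)) -> d = (\row_i ratr (q 0 i), 1 / (16 * k.+1%:R)).
(* The default for indices that code no admissible ball. *)
have [d0 gd0] : exists d, good d.
  have [r r0 Hr] := open_ballP oOm Ox0; exists (x0, Num.min (1 / 16) (r / 16)); split.
  - by rewrite /= lt_min !divr_gt0.
  - by rewrite /= ge_min lexx.
  move=> y /= yx; apply: Hr; apply: (le_lt_trans yx).
  have : Num.min (1 / 16) (r / 16) <= r / 16 by rewrite ge_min lexx orbT.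
  by set m := Num.min _ _; lra.
have /choice[d Hd] : forall n, exists d, P n d.
  move=> n; case E : (unpickle n : option ('rV[rat]_4 * nat)) => [[q k]|]; last by exists d0; split; rewrite // E.
  have [g|ng] := pselect (good (\row_i ratr (q 0 i), 1 / (16 * k.+1%:R))).
    by exists (\row_i ratr (q 0 i), 1 / (16 * k.+1%:R)); split => // q' k'; rewrite E => -[<- <-].
  by exists d0; split => // q' k'; rewrite E => -[<- <-].
exists (fun n => (d n).1), (fun n => (d n).2); split=> [n|x Ox]; first by have [] := Hd n.
have [r r0 Hr] := open_ballP oOm Ox.
pose k := Num.truncn (r^-1); pose s : R := 1 / (16 * k.+1%:R).
have k1 : 1 <= k.+1%:R :> R by rewrite ler1n.
have s0 : 0 < s by rewrite divr_gt0// mulr_gt0.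
have sr : 16 * s < r.
  have -> : 16 * s = k.+1%:R^-1 by rewrite /s; field.
  by rewrite -[ltRHS]invrK ltf_pV2 ?posrE ?invr_gt0// truncnS_gt.
have [q Hq] := rat_approx x s0.
have g : good (\row_i ratr (q 0 i), s).
  split=> //=; first by rewrite /s ler_pM2l// lef_pV2 ?posrE ?mulr_gt0// ler_peMr.
  move=> y yq; apply: Hr.
  have n1 : `|y - x| <= `|y - \row_i ratr (q 0 i)| + `|x - \row_i ratr (q 0 i)| by rewrite (distrC x) ler_distD.
  apply: (le_lt_trans n1); apply: (le_lt_trans (lerD yq (ltW Hq))).
  by apply: le_lt_trans sr; lra.
exists (pickle (q, k)); have [_ /(_ q k)] := Hd (pickle (q, k)).
by rewrite pickleK => /(_ erefl g) ->.
Qed.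

(** A compact exhaustion of Om. A point outside it is large or close to the complement of Om, and
    this decides where the pole of a piece is put. *)
Definition inner Om (J : R) : set 'rV[R]_4 :=
  [set y | `|y| <= J /\ forall p, ~ Om p -> J^-1 <= `|y - p|].

Lemma inner_compact Om J : compact (inner Om J).
Proof.
apply: bounded_closed_compact.
  by exists J; split; [exact: num_real|move=> M JM y [yJ _]; exact: le_trans (ltW JM)].
have -> : inner Om J = [set y | `|y| <= J] `&` \bigcap_(p in ~` Om) [set y | J^-1 <= `|y - p|].
  by apply/seteqP; split => y.
apply: closedI.
  rewrite -[X in closed X]setCK closedC (_ : ~` _ = [set y : 'rV[R]_4 | J < `|y - 0|]); first exact: open_dist_gt.
  by apply/seteqP; split => y /=; rewrite subr0 ltNge => /negP.
apply: closed_bigI => p _; rewrite -[X in closed X]setCK closedC openE => y /= /negP.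
rewrite -ltNge => yp; apply/nbhs_ballP; exists (J^-1 - `|y - p|); first by rewrite /= subr_gt0.
move=> z; rewrite -ball_normE /ball_ /= => yz; apply/negP; rewrite -ltNge.
have n1 : `|z - p| <= `|y - z| + `|y - p| by rewrite (distrC y z) ler_distD.
by apply: (le_lt_trans n1); rewrite -ltrBrDr.
Qed.

Lemma inner_sub Om J : 0 < J -> inner Om J `<=` Om.
Proof.
move=> J0 y [_ H]; apply: contrapT => /H; rewrite subrr normr0.
by rewrite leNgt invr_gt0 J0.
Qed.

(* Where the expansion, around a nearby pole outside [Om] or around infinity, of a small piece
   supported near a point outside [inner Om J] converges. *)
Definition far_inner Om (J : R) : set 'rV[R]_4 :=
  [set y | 64 * `|y| <= J /\ forall p, ~ Om p -> 64 / J <= `|y - p|].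

(** A point z0 where f does not vanish lies outside [inner Om J]. If |z0| > J the expansion is
    around infinity; otherwise some p outside Om is within 1/J of z0 and serves as the pole. *)
Lemma piece_approx c L f Om (r J e : R) n : is_mean c L -> testfun c f -> 2 <= J -> 0 < e ->
  0 < r -> r <= 1 / 16 -> (forall y, `|y - c| <= 8 * r -> Om y) ->
  (forall z, 2 * r < `|z - c| -> f z = 0) -> (forall y, inner Om J y -> f y = 0) ->
  exists2 T, harmonic_jet Om T & forall s y, (size s <= n)%N -> Om y -> far_inner Om J y ->
    `|pot L (pd s f) y - T s y| <= e.
Proof.
move=> HL tf J2 e0 r0 r16 Hr f0 fK.
have J0 : 0 < J by lra.
have rho2 : 2 * r <= 1 / 2 by lra.
have nd (a b d : 'rV[R]_4) : `|a - b| <= `|a - d| + `|d - b| := ler_distD d a b.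
(* The zero piece offers no point z0; its potential is already harmonic and serves as T. *)
have [Z|/existsNP[z0 fz0]] := pselect (forall z, f z = 0).
  exists (fun s => pot L (pd s f)); last by move=> s y _ _ _; rewrite subrr normr0 ltW.
  split; first exact: jet_subset (pot_jet HL tf).
  by move=> y _; rewrite (pot_laplace HL)// Z mulr0.
have z0c : `|z0 - c| <= 2 * r by rewrite leNgt; apply/negP => /f0.
have : ~ inner Om J z0 by move/fK.
move=> /not_andP[/negP|/existsNP[p /not_implyP[Op /negP]]]; rewrite -ltNge.
- move=> Jz.
  have n1 : `|z0| <= `|z0 - c| + `|c|.
    by have := nd z0 0 c; rewrite !subr0.
  have X := @infinity_approx R c L f Om n (2 * r) e (far_inner Om J) HL tf e0 _ rho2 f0.
  apply: X.
    have : J <= 2 * r + `|c| by rewrite ltW// (lt_le_trans Jz)// (le_trans n1)// lerD2r.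
    by move: (`|c|) => s; lra.
  move=> y z [yJ _] zc.
  have n2 : `|z0| <= `|z0 - c| + `|z - c| + `|z|.
    by rewrite -addrA (le_trans n1)// lerD2l distrC; have := nd c 0 z; rewrite !subr0.
  have Jz' : J <= 2 * r + 2 * r + `|z|.
    by rewrite ltW// (lt_le_trans Jz)// (le_trans n2)// lerD2r lerD.
  by move: yJ Jz'; move: (`|y|) (`|z|) => s t yJ Jz'; split; lra.
- move=> zp.
  have J64 : 0 < 64 / J by rewrite divr_gt0.
  have X := @pole_approx R c L f Om p n (2 * r) e (64 / J) (far_inner Om J) HL tf e0 J64 Op rho2 f0.
  apply: X.
  move=> y z [_ yJ] zc; have yp := yJ p Op; split => //; apply: le_trans yp.
  have pc : 8 * r < `|p - c| by rewrite ltNge; apply/negP => /Hr.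
  have n1 := nd p c z0; rewrite (distrC p z0) in n1.
  have n2 := nd z p c; have n3 := nd c p z0; rewrite (distrC c z0) in n3.
  (* Hence r < 1/(6 J) and |z - p| <= 4 r + 1/J < 5/(3 J), so that 16 |z - p| stays below 64/J. *)
  have n4 : 8 * r < J^-1 + 2 * r.
    by apply: (lt_le_trans pc); apply: (le_trans n1); apply: lerD => //; exact: ltW.
  have n5 : `|z - p| <= 2 * r + (2 * r + J^-1).
    apply: (le_trans n2); apply: lerD => //; apply: (le_trans n3); apply: lerD => //; exact: ltW.
  by move: n4 n5; move: (`|z - p|) (J^-1) => s t; lra.
Qed.

Lemma jet_zero Om : jet Om (fun _ _ => 0 : R).
Proof.
move=> s; split=> [i x _|x _]; first exact: is_derive_const.
by exists 1, 0; split=> // y _; rewrite normr0.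
Qed.

Lemma jet_sub_scale Om (F G : seq 'I_4 -> 'rV[R]_4 -> R) (a : R) : jet Om F -> jet Om G ->
  jet Om (fun s y => (F s y - G s y) * a).
Proof.
move=> jF jG s; have [dF bF] := jF s; have [dG bG] := jG s; split=> [i x Ox|x Ox].
  have D := is_derive_mul (is_derive_sub (dF i x Ox) (dG i x Ox)) (is_derive_const a x 'e_i).
  by apply: (is_derive_eq D); rewrite mulr0 addr0.
have [r1 [C1 [r10 H1]]] := bF x Ox; have [r2 [C2 [r20 H2]]] := bG x Ox.
exists (Num.min r1 r2), ((C1 + C2) * `|a|); rewrite lt_min r10; split=> // y.
rewrite lt_min => /andP[y1 y2]; rewrite normrM ler_wpM2r//.
by rewrite (le_trans (ler_normB _ _))// lerD// ?H1 ?H2.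
Qed.

Lemma jet_sum Om (V : nat -> seq 'I_4 -> 'rV[R]_4 -> R) N : (forall n, jet Om (V n)) ->
  jet Om (fun s y => \sum_(0 <= n < N) V n s y).
Proof.
move=> jV; elim: N => [|N IH] s.
  have [d b] := jet_zero Om s; split=> [i x Ox|x Ox].
    have E (t : seq 'I_4) : (fun y => \sum_(0 <= n < 0) V n t y) = (fun=> 0) by apply/funext => y; rewrite big_nil.
    by rewrite big_nil E; exact: is_derive_const.
  by have [r [C [r0 H]]] := b x Ox; exists r, C; split=> // y /H; rewrite big_nil.
have [d b] := IH s; have [d' b'] := jV N s; split=> [i x Ox|x Ox].
  rewrite big_nat_recr//=.
  have -> : (fun y => \sum_(0 <= n < N.+1) V n s y) = (fun y => \sum_(0 <= n < N) V n s y + V N s y).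
    by apply/funext => y; rewrite big_nat_recr.
  by apply: is_derive_add; [exact: d|exact: d'].
have [r1 [C1 [r10 H1]]] := b x Ox; have [r2 [C2 [r20 H2]]] := b' x Ox.
exists (Num.min r1 r2), (C1 + C2); rewrite lt_min r10; split=> // y.
rewrite lt_min => /andP[y1 y2]; rewrite big_nat_recr//= (le_trans (ler_normD _ _))//.
by rewrite lerD ?H1 ?H2.
Qed.

Lemma half_sum_le N k : \sum_(N <= n < N + k) 2^-1 ^+ n <= 2 :> R.
Proof.
have E : \sum_(N <= n < N + k) 2^-1 ^+ n = 2 * 2^-1 ^+ N - 2 * 2^-1 ^+ (N + k) :> R.
  elim: k => [|k IH]; first by rewrite addn0 big_geq// subrr.
  by rewrite addnS big_nat_recr ?leq_addr//= IH exprS; field.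
rewrite E (@le_trans _ _ (2 * 2^-1 ^+ N))//.
  by rewrite gerBl mulr_ge0// exprn_ge0// invr_ge0.
by rewrite ler_piMr// exprn_ile1 ?invr_ge0// invf_le1// ler1n.
Qed.

(** The n-th term is controlled only up to order n. For a fixed derivative finitely many terms
    escape the bound, and these are absorbed by the local boundedness of a finite sum of jets. *)
Lemma jet_series Om (V : nat -> seq 'I_4 -> 'rV[R]_4 -> R) : open Om -> (forall n, jet Om (V n)) ->
  (forall x, Om x -> exists (r : R) (N : nat), 0 < r /\ forall n, (N <= n)%N ->
     forall s y, (size s <= n)%N -> `|y - x| < r -> Om y /\ `|V n s y| <= 2^-1 ^+ n) ->
  exists2 G, jet Om G & forall s x, Om x -> (fun N => \sum_(0 <= n < N) V n s x) @ \oo --> G s x.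
Proof.
move=> oOm jV H.
have cv s x : Om x -> exists l : R, (fun N => \sum_(0 <= n < N) V n s x) @ \oo --> l.
  move=> Ox; have [r [N [r0 HN]]] := H x Ox; pose M := maxn N (size s).
  have xx : `|x - x| < r by rewrite subrr normr0.
  suff cau k : `|\sum_(0 <= n < k.+1 + M) V n s x - \sum_(0 <= n < k + M) V n s x| <= 1 * 2^-1 ^+ k.
    have [l cl _] := geometric_cauchy (x := fun k => \sum_(0 <= n < k + M) V n s x) cau.
    by exists l; rewrite -(cvg_shiftn M).
  rewrite addSn big_nat_recr//= addrAC subrr add0r mul1r.
  have [_ h] := HN (k + M)%N (leq_trans (leq_maxl N (size s)) (leq_addl k M)) s x
    (leq_trans (leq_maxr N (size s)) (leq_addl k M)) xx.
  apply: (le_trans h); rewrite exprD ler_piMr ?exprn_ge0 ?invr_ge0//.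
  by rewrite exprn_ile1 ?invr_ge0// invf_le1// ler1n.
have /choice[G HG] : forall s : seq 'I_4, exists Gs : 'rV[R]_4 -> R, forall x, Om x ->
    (fun N => \sum_(0 <= n < N) V n s x) @ \oo --> Gs x.
  move=> s; have /choice[Gs HGs] : forall x, exists l : R, Om x -> (fun N => \sum_(0 <= n < N) V n s x) @ \oo --> l.
    by move=> x; have [/(cv s)[l]|nO] := pselect (Om x); [exists l|exists 0].
  by exists Gs.
exists G => //.
apply: (@jet_lim R 4 Om (fun N s y => \sum_(0 <= n < N) V n s y)) => // s x Ox.
have [r [N [r0 HN]]] := H x Ox; pose M := maxn N (size s).
have [_ b] := jet_sum M jV s; have [r1 [C1 [r10 H1]]] := b x Ox.
exists (Num.min r r1), (C1 + 2), M; rewrite lt_min r0; split=> // K MK y.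
rewrite lt_min => /andP[yr yr1].
have [Oy _] := HN M (leq_maxl _ _) s y (leq_maxr _ _) yr.
split; last by move=> i; have [d _] := jet_sum K jV s; exact: d.
rewrite (big_cat_nat (n := M))//= (le_trans (ler_normD _ _))// lerD ?H1//.
apply: (le_trans (ler_norm_sum _ _ _)).
apply: (@le_trans _ _ (\sum_(M <= n < K) 2^-1 ^+ n)); last by rewrite -(subnKC MK) half_sum_le.
apply: ler_sum_nat => n /andP[Mn _].
by have [] := HN n (leq_trans (leq_maxl _ _) Mn) s y (leq_trans (leq_maxr _ _) Mn) yr.
Qed.

Lemma inner_finite_cover Om (c : nat -> 'rV[R]_4) (r : nat -> R) J : 0 < J ->
  (forall x, Om x -> exists n, `|x - c n| < r n) ->
  exists N, forall x, inner Om J x -> exists2 n, (n < N)%N & `|x - c n| < r n.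
Proof.
move=> J0 H; have := @inner_compact Om J; rewrite compact_cover.
move=> /(_ nat setT (fun n => [set x | `|x - c n| < r n])) [].
- move=> n _; rewrite openE => x /= xr; apply/nbhs_ballP; exists (r n - `|x - c n|); first by rewrite /= subr_gt0.
  move=> y; rewrite -ball_normE /ball_ /= => xy.
  have n1 : `|y - c n| <= `|x - y| + `|x - c n| by rewrite (distrC x y) ler_distD.
  by apply: (le_lt_trans n1); rewrite -ltrBrDr.
- by move=> x /(inner_sub J0) /H[n Hn]; exists n.
move=> D _ HD; exists (\max_(n <- finmap.enum_fset D) n).+1 => x /HD[n /= nD xn]; exists n => //.
by rewrite ltnS; apply: leq_bigmax_seq.
Qed.

Lemma far_inner_mono Om (J J' : R) : 0 < J -> J <= J' -> far_inner Om J `<=` far_inner Om J'.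
Proof.
move=> J0 JJ y [h1 h2]; split=> [|p /h2]; first exact: le_trans JJ.
by apply: le_trans; rewrite ler_pM2l// lef_pV2 ?posrE// (lt_le_trans J0).
Qed.

(** The correction must not depend on j, so it is built for the largest admissible j up to n; the
    estimates for smaller j follow because [far_inner] grows with its parameter. *)
Lemma piece_solution Om f c (r : R) n : (0 < r) -> r <= 1 / 16 ->
  (forall y, `|y - c| <= 8 * r -> Om y) -> smooth setT f -> (forall z, 2 * r < `|z - c| -> f z = 0) ->
  exists V : seq 'I_4 -> 'rV[R]_4 -> R, [/\ jet Om V,
    forall y, Om y -> \sum_i V [:: i; i] y = f y &
    forall j, (j <= n)%N -> (forall y, inner Om j.+2%:R y -> f y = 0) ->
      forall s y, (size s <= n)%N -> Om y -> far_inner Om j.+2%:R y -> `|V s y| <= 2^-1 ^+ n].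
Proof.
move=> r0 r16 Hr sf f0; have [L HL] := exists_mean c.
have tf : testfun c f by split=> // z zc; apply: f0; apply: le_lt_trans zc; lra.
set kappa := L (fun z => dens 1 (c - z)).
have k0 : kappa < 0 := mass_lt0 HL.
have e0 : 0 < 2^-1 ^+ n * `|kappa| by rewrite mulr_gt0 ?exprn_gt0 ?invr_gt0// normr_gt0 lt_eqF.
have [T [jT lT] HT] : exists2 T, harmonic_jet Om T & forall j, (j <= n)%N ->
    (forall y, inner Om j.+2%:R y -> f y = 0) -> forall s y, (size s <= n)%N -> Om y ->
    far_inner Om j.+2%:R y -> `|pot L (pd s f) y - T s y| <= 2^-1 ^+ n * `|kappa|.
  (* The shift [j.+2] provides the parameter at least 2 that [piece_approx] requires. If no j
     qualifies, nothing has to be estimated and T = 0 will do. *)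
  pose P j := (j <= n)%N && `[< forall y, inner Om j.+2%:R y -> f y = 0 >].
  have [[j0 Pj0]|nP] := pselect (exists j, P j); last first.
    exists (fun _ _ => 0); first by split=> [|y _]; [exact: jet_zero|rewrite big1].
    by move=> j jn Hj; exfalso; apply: nP; exists j; rewrite /P jn; apply/asboolP.
  have [j /andP[jn /asboolP Hj] jmax] := ex_maxnP (ex_intro P j0 Pj0) (fun k (Pk : P k) => proj1 (andP Pk)).
  have J2 : 2 <= j.+2%:R :> R by rewrite ler_nat.
  have [T hT HT] := piece_approx n HL tf J2 e0 r0 r16 Hr f0 Hj.
  exists T => // k kn Hk s y sn Oy yk; apply: HT => //.
  apply: far_inner_mono yk => //; rewrite ler_nat !ltnS; apply: jmax.
  by rewrite /P kn; apply/asboolP.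
exists (fun s y => (pot L (pd s f) y - T s y) * kappa^-1); split.
- by apply: jet_sub_scale => //; exact: jet_subset (pot_jet HL tf).
- move=> y Oy; rewrite -mulr_suml sumrB lT// subr0.
  by rewrite (pot_laplace HL y tf) mulrAC divff ?mul1r// lt_eqF.
- move=> j jn Hj s y sn Oy yj; rewrite normrM normfV ler_pdivrMr ?normr_gt0 ?lt_eqF//.
  exact: HT Hj _ _ sn Oy yj.
Qed.

(** The factor [rest n] makes a piece vanish on all earlier balls. Finitely many balls cover
    [inner Om J], so all but finitely many pieces vanish there, and their corrected potentials are
    at most 2^(-n) near any given point of Om. *)
Theorem poisson Om f : open Om -> smooth Om f ->
  exists2 u, smooth Om u & forall x, Om x -> \sum_i partial i (partial i (u : _ -> R)) x = f x.
Proof.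
move=> oOm sf; have [nO|/nonemptyPn En] := pselect (Om !=set0); last first.
  by exists f => // x; rewrite En.
have [c [r [Hcr cover]]] := ball_cover oOm nO.
have oT : open (setT : set 'rV[R]_4) by exact: openT.
have /choice[phi Hphi] : forall n, exists phi : 'rV[R]_4 -> R,
    [/\ smooth setT phi, forall y, `|y - c n| <= r n -> phi y = 1 &
      forall y, 2 * r n < `|y - c n| -> phi y = 0].
  by move=> n; apply: bump_exists; have [] := Hcr n.
pose rest n y : R := \prod_(0 <= m < n) (1 - phi m y).
pose F n y : R := f y * (phi n y * rest n y).
have srest n : smooth setT (rest n).
  apply: smooth_prod => // m _; apply: smooth_sub => //; first exact: smooth_cst.
  by have [] := Hphi m.
have F0 n z : 2 * r n < `|z - c n| -> F n z = 0.
  by have [_ _ h] := Hphi n; move=> /h Z; rewrite /F Z mul0r mulr0.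
(* f is smooth on Om only, but the piece is zero beyond distance 2 r from the centre; this open
   region and Om cover the space. *)
have sF n : smooth setT (F n).
  have oD := @open_dist_gt R (c n) (2 * r n).
  have [r0 _ Hr] := Hcr n; have [sp _ _] := Hphi n.
  have -> : setT = Om `|` [set z : 'rV[R]_4 | 2 * r n < `|z - c n|].
    apply/esym; rewrite -subTset => z _; have [h|h] := leP `|z - c n| (2 * r n); [left|by right].
    by apply: Hr; apply: (le_trans h); lra.
  apply: smooth_union; last first.
    by apply: smooth_eq (smooth_cst _ 0) => // z /F0.
  apply: smooth_mul => //; apply: smooth_mul => //; first exact: smooth_subset sp.
  exact: smooth_subset (srest n).
have /choice[V HV] : forall n, exists V : seq 'I_4 -> 'rV[R]_4 -> R, [/\ jet Om V,
    forall y, Om y -> \sum_i V [:: i; i] y = F n y &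
    forall j, (j <= n)%N -> (forall y, inner Om j.+2%:R y -> F n y = 0) ->
      forall s y, (size s <= n)%N -> Om y -> far_inner Om j.+2%:R y -> `|V s y| <= 2^-1 ^+ n].
  by move=> n; have [r0 r16 Hr] := Hcr n; apply: (piece_solution n r0 r16 Hr (sF n) (@F0 n)).
have rest0 n m y : (m < n)%N -> `|y - c m| < r m -> rest n y = 0.
  move=> mn ym; rewrite /rest (big_cat_nat (n := m))//=; last exact: ltnW.
  have [_ h _] := Hphi m; rewrite [X in _ * X]big_ltn// h ?ltW//.
  by rewrite subrr mul0r mulr0.
have jV n : jet Om (V n) by have [] := HV n.
have [|G jG HG] := jet_series oOm jV.
  move=> x Ox; have [r0 r00 Hr0] := open_ballP oOm Ox.
  (* Chosen so that the ball of radius r0/2 around x lies in [far_inner Om J] for J >= B: the first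
     summand bounds 64 |y|, the second makes 64/J at most r0/2. *)
  pose B : R := 64 * (`|x| + r0) + 128 / r0.
  pose j := Num.truncn B.
  have JB : B <= j.+2%:R by rewrite (le_trans (ltW (truncnS_gt B)))// ler_nat.
  have J0 : 0 < j.+2%:R :> R by [].
  have [N HN] := inner_finite_cover (Om := Om) J0 cover.
  exists (r0 / 2), (maxn N j); split=> [|n]; first by rewrite divr_gt0.
  rewrite geq_max => /andP[Nn jn] s y sn yx.
  have Oy : Om y by apply: Hr0; apply: (lt_trans yx); rewrite ltr_pdivrMr// ltr_pMr// ltr1n.
  split=> //; have [_ _ Hb] := HV n; apply: (Hb j) => //.
    move=> z /HN[m mN zm]; rewrite /F (rest0 n m)// ?mulr0//.
    exact: leq_trans mN Nn.
  have q0 : 0 <= 128 / r0 by rewrite divr_ge0// ltW.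
  split.
    apply: le_trans JB; rewrite /B.
    have n1 : `|y| <= `|y - x| + `|x| by have := ler_distD x y 0; rewrite !subr0.
    apply: (@le_trans _ _ (64 * (`|x| + r0))); last by rewrite lerDl.
    rewrite ler_pM2l// (le_trans n1)// addrC lerD2l ltW// (lt_trans yx)//.
    by rewrite ltr_pdivrMr// ltr_pMr// ltr1n.
  move=> p Op; have xp : r0 <= `|x - p|.
    by rewrite leNgt distrC; apply/negP => /Hr0.
  have n1 : `|x - p| <= `|y - x| + `|y - p| by rewrite (distrC y x) ler_distD.
  have yp : r0 / 2 <= `|y - p|.
    have : r0 <= r0 / 2 + `|y - p| by rewrite (le_trans xp)// (le_trans n1)// lerD2r ltW.
    by move: (`|y - p|) => s'; lra.
  apply: le_trans yp; rewrite ler_pdivrMr//.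
  have h : 128 / r0 <= j.+2%:R.
    by apply: le_trans JB; rewrite /B lerDr mulr_ge0// addr_ge0// ltW.
  by rewrite ler_pdivrMr// in h; move: h; move: (j.+2%:R : R) => t; nra.
exists (G [::]); first exact: jet_smooth jG.
move=> x Ox.
have -> : \sum_i partial i (partial i (G [::])) x = \sum_i G [:: i; i] x.
  by apply: eq_bigr => i _; exact: (jet_pd oOm jG [:: i; i] Ox).
have cl : (fun N => \sum_(0 <= n < N) F n x) @ \oo --> \sum_i G [:: i; i] x.
  have -> : (fun N => \sum_(0 <= n < N) F n x) = (fun N => \sum_i \sum_(0 <= n < N) V n [:: i; i] x).
    apply/funext => N; rewrite exchange_big; apply: eq_bigr => n _.
    by have [_ ->] := HV n.
  by apply: cvg_sumR => i; exact: HG.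
apply: (cvg_unique _ cl) => //.
(* The pieces telescope, and the product vanishes as soon as a ball containing x has occurred. *)
have tele N : \sum_(0 <= n < N) F n x = f x * (1 - rest N x).
  elim: N => [|N IH]; first by rewrite big_nil /rest big_nil subrr mulr0.
  rewrite big_nat_recr//= IH /F /rest big_nat_recr//= -/(rest N x).
  by move: (f x) (rest N x) (phi N x) => a b d; ring.
have [m xm] := cover x Ox.
apply: cvg_near_cst; exists m.+1 => // N /= mN.
by rewrite tele (rest0 N m)// subr0 mulr1.
Qed.

End Poisson.

Lemma sum4 (V : nmodType) (F : 'I_4 -> V) : \sum_i F i = F 0 + F 1 + F 2 + F 3.
Proof.
rewrite !big_ord_recl big_ord0 addr0 !addrA.
by congr (F _ + F _ + F _ + F _); apply: val_inj.
Qed.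

Lemma forall_I4 (P : 'I_4 -> Prop) : P 0 -> P 1 -> P 2 -> P 3 -> forall i, P i.
Proof.
move=> P0 P1 P2 P3 [[|[|[|[|//]]]] ilt]; [move: P0|move: P1|move: P2|move: P3];
  by congr P; apply: val_inj.
Qed.

(** * Rules for partial derivatives and the function 1/|x|^2 *)

Section Partials.
Variable R : realType.
Implicit Types (f g h u : 'rV[R]_4 -> R) (x y z p : 'rV[R]_4) (Om : set 'rV[R]_4).

Section Rules.
Variables (Om : set 'rV[R]_4) (f g : 'rV[R]_4 -> R) (i : 'I_4) (x : 'rV[R]_4).
Hypotheses (sf : smooth Om f) (sg : smooth Om g) (Ox : Om x).

Lemma partial_add : partial i (fun y => f y + g y) x = partial i (f : _ -> R) x + partial i (g : _ -> R) x.
Proof. by apply: is_derive_partial; apply: is_derive_add; exact: (smooth_is_derive i _ Ox). Qed.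

Lemma partial_opp : partial i (fun y => - f y) x = - partial i (f : _ -> R) x.
Proof. by apply: is_derive_partial; apply: is_derive_opp; exact: (smooth_is_derive i _ Ox). Qed.

Lemma partial_scale (c : R) : partial i (fun y => c * f y) x = c * partial i (f : _ -> R) x.
Proof.
apply: is_derive_partial.
apply: (is_derive_eq (is_derive_mul (is_derive_const c x _) (smooth_is_derive i sf Ox))).
by rewrite mul0r add0r.
Qed.

End Rules.

Lemma partial_eq Om f g i x : open Om -> (forall y, Om y -> f y = g y) -> smooth Om f -> Om x ->
  partial i (f : _ -> R) x = partial i (g : _ -> R) x.
Proof. by move=> oOm fg sf Ox; exact: (pd_eq [:: i] oOm fg sf Ox). Qed.

Lemma is_derive_invX n (s : R) : s != 0 ->
  is_derive s 1 (fun s : R => s^-1 ^+ n) (- n%:R * s^-1 ^+ n.+1).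
Proof.
move=> s0; elim: n => [|n IH].
  by apply: (is_derive_eq (is_derive_const _ _ _)); rewrite oppr0 mul0r.
have -> : (fun s : R => s^-1 ^+ n.+1) = (fun s => s^-1 * s^-1 ^+ n).
  by apply/funext => t; rewrite exprS.
apply: (is_derive_eq (is_derive_mul (is_derive_invR s0) IH)).
by rewrite -natr1 !exprS; move: (s^-1 ^+ n) (s^-1) (n%:R : R) => a b c; ring.
Qed.

Lemma smooth1_inv : smooth1 [set s : R | s != 0]
  (fun k s => \prod_(0 <= j < k) (- j.+1%:R) * s^-1 ^+ k.+1).
Proof.
move=> k s s0; have D := is_derive_mul (is_derive_const (\prod_(0 <= j < k) (- j.+1%:R : R)) s 1)
  (is_derive_invX k.+1 s0).
by apply: (is_derive_eq D); rewrite mul0r add0r big_nat_recr//= mulrA.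
Qed.

Lemma smooth_inv_sq Om : open Om -> ~ Om 0 -> smooth Om (fun y : 'rV[R]_4 => (sq y)^-1).
Proof.
move=> oOm n0.
have sqn0 x : Om x -> sq x != 0.
  move=> Ox; rewrite gt_eqF// sq_gt0//; apply/eqP => x0; apply: n0.
  by rewrite -x0.
apply: smooth_eq (smooth_comp (f := @sq R) oOm smooth1_inv sqn0 _) => //.
  by move=> x _ /=; rewrite big_geq// mul1r expr1.
apply: smooth_sum => // i _; apply: smooth_mul => //; exact: smooth_coord.
Qed.

Lemma partial_inv_sq i x : x != 0 ->
  partial i (fun y : 'rV[R]_4 => (sq y)^-1) x = - 2 * x 0 i * (sq x)^-1 * (sq x)^-1.
Proof.
move=> x0; have s0 : sq x != 0 by rewrite gt_eqF// sq_gt0.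
apply: is_derive_partial; apply: (is_derive_eq (is_derive_comp1 (is_derive_invR s0) (is_derive_sq x i))).
by move: (x 0 i) ((sq x)^-1) => a b; ring.
Qed.

End Partials.

(** * The decomposition *)

Section Cohomology.
Variable R : realType.
Implicit Types (f g h u : 'rV[R]_4 -> R) (x y z p : 'rV[R]_4) (Om : set 'rV[R]_4).

(** It turns the exponents of the signs in [ext_d] into expressions that are computed for each of
    the finitely many indices. *)
Lemma card_below (J : {set 'I_4}) (j : 'I_4) : #|[set l in J | (l < j)%N]%SET| =
  ((((0 : 'I_4)%R \in J) && (0 < j)) + (((1 : 'I_4)%R \in J) && (1 < j)) + (((2 : 'I_4)%R \in J) && (2 < j)) + (((3 : 'I_4)%R \in J) && (3 < j)))%N.
Proof.
rewrite -sum1_card big_mkcond/= sum4 !inE /=.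
by do 4![case: ifP => ?].
Qed.

(** Hodge duality: W becomes the 3-form with coefficient (-1)^i W_i on the complement of i, closed
    because W is divergence free. A primitive 2-form, relabelled by complements of pairs with
    suitable signs, is the antisymmetric matrix p. *)
Lemma exact3_divergence Om (W : 'I_4 -> 'rV[R]_4 -> R) : open Om -> deRham_vanishes 3 Om ->
  (forall i, smooth Om (W i)) -> (forall x, Om x -> \sum_i partial i (W i : _ -> R) x = 0) ->
  exists p : 'I_4 -> 'I_4 -> 'rV[R]_4 -> R, [/\ forall i j, smooth Om (p i j),
    forall i j, p i j = fun y => - p j i y &
    forall i x, Om x -> W i x = \sum_j partial j (p i j : _ -> R) x].
Proof.
move=> oOm H3 sW dW.
(* At most one i contributes; the sum expresses the inverse of taking complements and is 0 on sets
   of another size. *)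
pose w (I : {set 'I_4}) (y : 'rV[R]_4) : R :=
  \sum_(i | I == (~: [set i])%SET) (-1) ^+ i * W i y.
have wC i : w (~: [set i])%SET = fun y => (-1) ^+ i * W i y.
  apply/funext => y; rewrite /w (big_pred1 i)// => j /=.
  by rewrite (inj_eq (@finset.setC_inj _)) (inj_eq (@finset.set1_inj _)) eq_sym.
have [|J cJ x Ox|v sv Hv] := H3 w.
- move=> I _; apply: smooth_sum => // i _; apply: smooth_mul => //; exact: smooth_cst.
- have -> : J = [set: 'I_4]%SET by apply/eqP; rewrite eqEcard finset.subsetT cardsT card_ord cJ.
  rewrite /ext_d; apply: etrans (dW x Ox); apply: eq_big => [j|j _]; first by rewrite inE.
  rewrite finset.setTD wC (partial_scale _ (sW j) Ox) mulrA -exprD.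
  suff -> : #|[set l in [set: 'I_4]%SET | (l < j)%N]%SET| = j by rewrite addnn -signr_odd odd_double mul1r.
  by rewrite card_below !inE; move: j; apply: forall_I4.
pose V i j := v (~: [set i] :\ j)%SET.
have VC i j : V i j = V j i by rewrite /V !finset.setDE finset.setIC.
have sV i j : i != j -> smooth Om (V i j).
  move=> ij; apply: sv; have := cardsD1 j (~: [set i])%SET.
  by rewrite cardsC1 card_ord !inE eq_sym ij => -[].
(* Exchanging i and j flips the last summand, hence the sign. The diagonal must be cut off: there
   [V i i] is a coefficient of v on a set of three elements, about which nothing is known. *)
pose s (i j : 'I_4) : R := (if i == j then 0 else (-1) ^+ (i + j + (i < j))%N).
exists (fun i j y => s i j * V i j y); split.
- move=> i j; rewrite /s; case: eqVneq => [_|ij].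
    by apply: smooth_eq (smooth_cst _ 0) => // y _; rewrite mul0r.
  by apply: smooth_mul => //; [exact: smooth_cst|exact: sV].
- move=> i j; apply/funext => y /=; rewrite (VC i) -mulNr; congr (_ * _); rewrite /s eq_sym.
  case: eqVneq => [_|ij]; first by rewrite oppr0.
  have /orP[h|h] : ((i < j) || (j < i))%N by rewrite -neq_ltn eq_sym.
    by rewrite h ltnNge (ltnW h) addn0 addn1 exprS mulN1r addnC.
  by rewrite h ltnNge (ltnW h) addn0 addn1 exprS mulN1r opprK addnC.
- move=> i x Ox; have := Hv (~: [set i])%SET; rewrite cardsC1 card_ord => /(_ erefl x Ox).
  rewrite wC /ext_d big_mkcond /= => E.
  have -> : W i x = (-1) ^+ i * ((-1) ^+ i * W i x) by rewrite signrMK.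
  rewrite E mulr_sumr; apply: eq_bigr => j _; rewrite !inE; case: (eqVneq j i) => [->|ji].
    rewrite mulr0; apply/esym; apply: is_derive_partial; rewrite /s eqxx.
    have -> : (fun y => 0 * V i i y) = fun=> 0 by apply/funext => y; rewrite mul0r.
    exact: is_derive_const.
  rewrite (partial_scale _ (sV i j _) Ox) ?(eq_sym i)// mulrA; congr (_ * _).
  rewrite /s eq_sym (negbTE ji) -exprD -signr_odd -[RHS]signr_odd; congr (_ ^+ nat_of_bool _).
  rewrite card_below !inE; move: ji; move: i j {E}; apply: forall_I4; apply: forall_I4 => //.
Qed.
End Cohomology.

(** * Removal of the self-dual part *)

Section AntiSelfDual.
Variable R : realType.
Implicit Types (f g h u : 'rV[R]_4 -> R) (x y z : 'rV[R]_4) (Om : set 'rV[R]_4).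
Local Notation d i f := (partial i (f : 'rV[R]_4 -> R)).

Ltac smooth_tac := repeat (first [assumption | apply: smooth_add | apply: smooth_opp | apply: smooth_mul
  | apply: smooth_partial | exact: smooth_coord | exact: smooth_cst]).

(** g is, up to sign, the formal adjoint of the self-dual part of d applied to (S, T, U). In the
    composition the mixed derivatives cancel and the Laplacian acts on each component, so three
    Poisson equations suffice. *)
Lemma selfdual_correction Om (r1 r2 r3 : 'rV[R]_4 -> R) : open Om ->
  smooth Om r1 -> smooth Om r2 -> smooth Om r3 ->
  exists g : 'I_4 -> 'rV[R]_4 -> R, (forall i, smooth Om (g i)) /\
  forall x, Om x -> [/\ d 0 (g 1) x - d 1 (g 0) x + (d 2 (g 3) x - d 3 (g 2) x) = r1 x,
    d 0 (g 2) x - d 2 (g 0) x + (d 3 (g 1) x - d 1 (g 3) x) = r2 x &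
    d 0 (g 3) x - d 3 (g 0) x + (d 1 (g 2) x - d 2 (g 1) x) = r3 x].
Proof.
move=> oOm s1 s2 s3.
have [S sS HS] := poisson oOm s1; have [T sT HT] := poisson oOm s2; have [U sU HU] := poisson oOm s3.
pose g0 (y : 'rV[R]_4) : R := - d 1 S y - d 2 T y - d 3 U y.
pose g1 (y : 'rV[R]_4) : R := d 0 S y - d 2 U y + d 3 T y.
pose g2 (y : 'rV[R]_4) : R := d 0 T y + d 1 U y - d 3 S y.
pose g3 (y : 'rV[R]_4) : R := d 0 U y - d 1 T y + d 2 S y.
exists (fun i => nth g0 [:: g0; g1; g2; g3] i); split.
  by apply: forall_I4 => /=; rewrite /g0 /g1 /g2 /g3; smooth_tac.
move=> x Ox /=.
pose A i j := d i (d j S) x; pose B i j := d i (d j T) x; pose C i j := d i (d j U) x.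
have dA i j : is_derive x 'e_i (d j S) (A i j) := smooth_is_derive i (smooth_partial j sS) Ox.
have dB i j : is_derive x 'e_i (d j T) (B i j) := smooth_is_derive i (smooth_partial j sT) Ox.
have dC i j : is_derive x 'e_i (d j U) (C i j) := smooth_is_derive i (smooth_partial j sU) Ox.
have CA i j : A i j = A j i := schwarz i j oOm sS Ox.
have CB i j : B i j = B j i := schwarz i j oOm sT Ox.
have CC i j : C i j = C j i := schwarz i j oOm sU Ox.
have e0 i : d i g0 x = - A i 1 - B i 2 - C i 3.
  exact: is_derive_partial (is_derive_sub (is_derive_sub (is_derive_opp (dA i 1)) (dB i 2)) (dC i 3)).
have e1 i : d i g1 x = A i 0 - C i 2 + B i 3.
  exact: is_derive_partial (is_derive_add (is_derive_sub (dA i 0) (dC i 2)) (dB i 3)).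
have e2 i : d i g2 x = B i 0 + C i 1 - A i 3.
  exact: is_derive_partial (is_derive_sub (is_derive_add (dB i 0) (dC i 1)) (dA i 3)).
have e3 i : d i g3 x = C i 0 - B i 1 + A i 2.
  exact: is_derive_partial (is_derive_add (is_derive_sub (dC i 0) (dB i 1)) (dA i 2)).
have HA : A 0 0 + A 1 1 + A 2 2 + A 3 3 = r1 x by rewrite -(HS x Ox) sum4.
have HB : B 0 0 + B 1 1 + B 2 2 + B 3 3 = r2 x by rewrite -(HT x Ox) sum4.
have HC : C 0 0 + C 1 1 + C 2 2 + C 3 3 = r3 x by rewrite -(HU x Ox) sum4.
rewrite -HA -HB -HC !e0 !e1 !e2 !e3.
have := (CC 0 1, CC 0 2, CC 0 3, CC 1 2, CC 1 3, CC 2 3).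
have := (CB 0 1, CB 0 2, CB 0 3, CB 1 2, CB 1 3, CB 2 3).
have := (CA 0 1, CA 0 2, CA 0 3, CA 1 2, CA 1 3, CA 2 3).
clearbody A B C.
move: (A 0 0) (A 0 1) (A 0 2) (A 0 3) (A 1 0) (A 1 1) (A 1 2) (A 1 3) => a00 a01 a02 a03 a10 a11 a12 a13.
move: (A 2 0) (A 2 1) (A 2 2) (A 2 3) (A 3 0) (A 3 1) (A 3 2) (A 3 3) => a20 a21 a22 a23 a30 a31 a32 a33.
move: (B 0 0) (B 0 1) (B 0 2) (B 0 3) (B 1 0) (B 1 1) (B 1 2) (B 1 3) => b00 b01 b02 b03 b10 b11 b12 b13.
move: (B 2 0) (B 2 1) (B 2 2) (B 2 3) (B 3 0) (B 3 1) (B 3 2) (B 3 3) => b20 b21 b22 b23 b30 b31 b32 b33.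
move: (C 0 0) (C 0 1) (C 0 2) (C 0 3) (C 1 0) (C 1 1) (C 1 2) (C 1 3) => c00 c01 c02 c03 c10 c11 c12 c13.
move: (C 2 0) (C 2 1) (C 2 2) (C 2 3) (C 3 0) (C 3 1) (C 3 2) (C 3 3) => c20 c21 c22 c23 c30 c31 c32 c33.
move=> [[[[[? ?] ?] ?] ?] ?] [[[[[? ?] ?] ?] ?] ?] [[[[[? ?] ?] ?] ?] ?]; subst.
by split; ring.
Qed.

(** Adding the Hodge dual of dg to the matrix p does not change its divergence, by symmetry of
    second derivatives; g is chosen to cancel p_01 + p_23 and its two cyclic analogues. *)
Lemma antiselfdual_potential Om (W : 'I_4 -> 'rV[R]_4 -> R) : open Om -> deRham_vanishes 3 Om ->
  (forall i, smooth Om (W i)) -> (forall x, Om x -> \sum_i d i (W i) x = 0) ->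
  exists a b c : 'rV[R]_4 -> R, [/\ smooth Om a, smooth Om b, smooth Om c & forall x, Om x ->
    [/\ W 0 x = d 1 a x + d 2 b x + d 3 c x, W 1 x = - d 0 a x - d 2 c x + d 3 b x,
        W 2 x = - d 0 b x + d 1 c x - d 3 a x & W 3 x = - d 0 c x - d 1 b x + d 2 a x]].
Proof.
move=> oOm H3 sW dW; have [p [sp pN Hp]] := exact3_divergence oOm H3 sW dW.
have sr (i j k l : 'I_4) : smooth Om (fun y => - p i j y - p k l y).
  by apply: smooth_sub => //; exact: smooth_opp.
have [g [sg Hg]] := selfdual_correction oOm (sr 0 1 2 3) (sr 0 2 3 1) (sr 0 3 1 2).
pose a (y : 'rV[R]_4) : R := p 0 1 y + (d 2 (g 3) y - d 3 (g 2) y).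
pose b (y : 'rV[R]_4) : R := p 0 2 y + (d 3 (g 1) y - d 1 (g 3) y).
pose c (y : 'rV[R]_4) : R := p 0 3 y + (d 1 (g 2) y - d 2 (g 1) y).
(* [a] and [a'] are the 01 entry and minus the 23 entry of the corrected matrix, equal on Om by the
   choice of g. Each component of the divergence uses the form in which its entries occur. *)
pose a' (y : 'rV[R]_4) : R := - p 2 3 y - (d 0 (g 1) y - d 1 (g 0) y).
pose b' (y : 'rV[R]_4) : R := - p 3 1 y - (d 0 (g 2) y - d 2 (g 0) y).
pose c' (y : 'rV[R]_4) : R := - p 1 2 y - (d 0 (g 3) y - d 3 (g 0) y).
have sdg i j : smooth Om (d i (g j)) by exact: smooth_partial.
have s_ i j k l m n : smooth Om (fun y => p i j y + (d k (g l) y - d m (g n) y)).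
  by apply: smooth_add => //; exact: smooth_sub.
have sa : smooth Om a by exact: s_.
have sb : smooth Om b by exact: s_.
have sc : smooth Om c by exact: s_.
have lin (u v w z : R) : w + z = - u - v -> u + z = - v - w by lra.
exists a, b, c; split => // x Ox.
pose P i j k := d i (p j k) x; pose G i j k := d i (d j (g k)) x.
have dP i j k : is_derive x 'e_i (p j k) (P i j k) := smooth_is_derive i (sp j k) Ox.
have dG i j k : is_derive x 'e_i (d j (g k)) (G i j k) := smooth_is_derive i (sdg j k) Ox.
have CG i j k : G i j k = G j i k := schwarz i j oOm (sg k) Ox.
have NP i j k : P i j k = - P i k j by rewrite /P (pN j) (partial_opp _ (sp k j) Ox).
have D i (j k l m n o : 'I_4) : d i (fun y => p j k y + (d l (g m) y - d n (g o) y)) x =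
    P i j k + (G i l m - G i n o).
  exact: is_derive_partial (is_derive_add (dP i j k) (is_derive_sub (dG i l m) (dG i n o))).
have D' i (j k l m n o : 'I_4) : d i (fun y => - p j k y - (d l (g m) y - d n (g o) y)) x =
    - P i j k - (G i l m - G i n o).
  exact: is_derive_partial (is_derive_sub (is_derive_opp (dP i j k)) (is_derive_sub (dG i l m) (dG i n o))).
have da i : d i a x = P i 0 1 + (G i 2 3 - G i 3 2) by exact: D.
have db i : d i b x = P i 0 2 + (G i 3 1 - G i 1 3) by exact: D.
have dc i : d i c x = P i 0 3 + (G i 1 2 - G i 2 1) by exact: D.
have da' i : d i a x = - P i 2 3 - (G i 0 1 - G i 1 0).
  rewrite (partial_eq (g := a') i oOm _ sa Ox); first exact: D'.
  by move=> y Oy; have [h _ _] := Hg y Oy; exact: lin h.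
have db' i : d i b x = - P i 3 1 - (G i 0 2 - G i 2 0).
  rewrite (partial_eq (g := b') i oOm _ sb Ox); first exact: D'.
  by move=> y Oy; have [_ h _] := Hg y Oy; exact: lin h.
have dc' i : d i c x = - P i 1 2 - (G i 0 3 - G i 3 0).
  rewrite (partial_eq (g := c') i oOm _ sc Ox); first exact: D'.
  by move=> y Oy; have [_ _ h] := Hg y Oy; exact: lin h.
have P0 i j : P i j j = 0 by have := NP i j j; move: (P i j j) => t; lra.
have HW i : W i x = P 0 i 0 + P 1 i 1 + P 2 i 2 + P 3 i 3 by rewrite (Hp i x Ox) sum4.
split; rewrite HW P0.
- rewrite da db dc (CG 1 2) (CG 1 3) (CG 2 3); clearbody P G.
  move: (P 1 0 1) (P 2 0 2) (P 3 0 3) (G 2 1 3) (G 3 1 2) (G 3 2 1) => *; ring.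
- rewrite da dc' db' (NP 0) (NP 3) (CG 0 2) (CG 0 3) (CG 2 3); clearbody P G.
  move: (P 0 0 1) (P 2 1 2) (P 3 3 1) (G 2 0 3) (G 3 0 2) (G 3 2 0) => *; ring.
- rewrite db dc' da' (NP 0) (NP 1) (CG 0 3) (CG 0 1) (CG 1 3); clearbody P G.
  move: (P 0 0 2) (P 1 1 2) (P 3 2 3) (G 3 0 1) (G 1 0 3) (G 3 1 0) => *; ring.
- rewrite dc db' da' (NP 0) (NP 2) (CG 0 1) (CG 0 2) (CG 1 2); clearbody P G.
  move: (P 0 0 3) (P 1 3 1) (P 2 2 3) (G 1 0 2) (G 2 0 1) (G 2 1 0) => *; ring.
Qed.

End AntiSelfDual.

(** * The field p for a real harmonic function *)

Section RealDecomposition.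
Variable R : realType.
Implicit Types (f g u : 'rV[R]_4 -> R) (x y z : 'rV[R]_4) (Om : set 'rV[R]_4).
Local Notation d i f := (partial i (f : 'rV[R]_4 -> R)).

(** The contraction of v with x is orthogonal to x, so x . p = h N |x|^2 = h. Its divergence is x .
    W = -2 h N - N x . grad h, opposite to that of h N x. The Lie derivative of v along x stays
    anti-self-dual, so by Cartan's formula the self-dual part of d of the contraction depends on W
    only through W wedge x; as grad N is radial, this is -N dh wedge x, and it cancels the
    contribution of h N x. *)
Lemma harmonic_decomposition Om (h : 'rV[R]_4 -> R) : open Om -> ~ Om 0 -> deRham_vanishes 3 Om ->
  smooth Om h -> (forall x, Om x -> \sum_i d i (d i h) x = 0) ->
  exists p0 p1 p2 p3 : 'rV[R]_4 -> R,
    [/\ smooth Om p0, smooth Om p1, smooth Om p2 & smooth Om p3] /\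
    forall x, Om x -> [/\ x 0 0 * p0 x + x 0 1 * p1 x + x 0 2 * p2 x + x 0 3 * p3 x = h x,
      d 0 p0 x + d 1 p1 x + d 2 p2 x + d 3 p3 x = 0,
      d 0 p1 x - d 1 p0 x + (d 2 p3 x - d 3 p2 x) = 0,
      d 0 p2 x - d 2 p0 x + (d 3 p1 x - d 1 p3 x) = 0 &
      d 0 p3 x - d 3 p0 x + (d 1 p2 x - d 2 p1 x) = 0].
Proof.
move=> oOm n0 H3 sh hh.
pose N (y : 'rV[R]_4) : R := (sq y)^-1.
have sN : smooth Om N := smooth_inv_sq oOm n0.
have x0 x : Om x -> x != 0 by move=> Ox; apply/eqP => E; apply: n0; rewrite -E.
have dN i x (Ox : Om x) : is_derive x 'e_i N (- 2 * x 0 i * N x * N x).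
  by rewrite -(partial_inv_sq i (x0 x Ox)); exact: smooth_is_derive.
have sx i : smooth Om (fun y : 'rV[R]_4 => y 0 i) by exact: smooth_coord.
pose W (k : 'I_4) (y : 'rV[R]_4) : R := h y * (- 2 * y 0 k * N y * N y) - N y * d k h y.
have nsq x : Om x -> N x * (x 0 0 * x 0 0 + x 0 1 * x 0 1 + x 0 2 * x 0 2 + x 0 3 * x 0 3) = 1.
  by move=> Ox; rewrite -(sum4 (fun i => x 0 i * x 0 i)) mulVf// gt_eqF// (sq_gt0 (x0 x Ox)).
have [k|x Ox|a [b [c [sa sb sc HW]]]] := antiselfdual_potential (W := W) oOm H3.
- apply: smooth_sub => //; apply: smooth_mul => //; do ?[exact: smooth_partial].
  by do ?[apply: smooth_mul => //]; exact: smooth_cst.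
- have dW k : d k (W k) x = - 2 * h x * N x * N x + 8 * h x * N x * N x * N x * (x 0 k * x 0 k)
      - N x * d k (d k h) x.
    have D := is_derive_sub (is_derive_mul (smooth_is_derive k sh Ox) (is_derive_mul (is_derive_mul
      (is_derive_mul (is_derive_const (- 2) x _) (is_derive_coord k k x)) (dN k x Ox)) (dN k x Ox)))
      (is_derive_mul (dN k x Ox) (smooth_is_derive k (smooth_partial k sh) Ox)).
    rewrite (is_derive_partial D) eqxx /= -/(N x).
    by move: (h x) (N x) (x 0 k) (d k h x) (d k (d k h) x) => *; ring.
  rewrite sum4 !dW; have := hh x Ox; have := nsq x Ox; rewrite sum4.
  move: (d 0 (d 0 h) x) (d 1 (d 1 h) x) (d 2 (d 2 h) x) (d 3 (d 3 h) x) => h0 h1 h2 h3 E1 E2.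
  have -> : h3 = - h0 - h1 - h2 by lra.
  move: (x 0 0) (x 0 1) (x 0 2) (x 0 3) (h x) (N x) E1 => y0 y1 y2 y3 H n E1.
  (* What remains is h times the Laplacian of 1/|x|^2, zero because N |x|^2 = 1. *)
  transitivity (8 * H * n * n * (n * (y0 * y0 + y1 * y1 + y2 * y2 + y3 * y3) - 1)); first by ring.
  by rewrite E1 subrr mulr0.
pose q (y : 'rV[R]_4) : R := h y * N y.
have sq_ : smooth Om q by exact: smooth_mul.
pose p0 (y : 'rV[R]_4) : R := q y * y 0 0 - y 0 1 * a y - y 0 2 * b y - y 0 3 * c y.
pose p1 (y : 'rV[R]_4) : R := q y * y 0 1 + y 0 0 * a y + y 0 2 * c y - y 0 3 * b y.
pose p2 (y : 'rV[R]_4) : R := q y * y 0 2 + y 0 0 * b y - y 0 1 * c y + y 0 3 * a y.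
pose p3 (y : 'rV[R]_4) : R := q y * y 0 3 + y 0 0 * c y + y 0 1 * b y - y 0 2 * a y.
exists p0, p1, p2, p3; split.
  by split; do ?[apply: smooth_sub => // | apply: smooth_add => //]; exact: smooth_mul.
move=> x Ox.
have dq i : is_derive x 'e_i q (d i h x * N x + h x * (- 2 * x 0 i * N x * N x)).
  exact: is_derive_mul (smooth_is_derive i sh Ox) (dN i x Ox).
have dqx i j := is_derive_mul (dq i) (is_derive_coord i j x).
have dxf i j f (sf : smooth Om f) := is_derive_mul (is_derive_coord i j x) (smooth_is_derive i sf Ox).
have d0 i := is_derive_partial (is_derive_sub (is_derive_sub (is_derive_sub
  (dqx i 0) (dxf i 1 a sa)) (dxf i 2 b sb)) (dxf i 3 c sc)).
have d1 i := is_derive_partial (is_derive_sub (is_derive_add (is_derive_add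
  (dqx i 1) (dxf i 0 a sa)) (dxf i 2 c sc)) (dxf i 3 b sb)).
have d2 i := is_derive_partial (is_derive_add (is_derive_sub (is_derive_add
  (dqx i 2) (dxf i 0 b sb)) (dxf i 1 c sc)) (dxf i 3 a sa)).
have d3 i := is_derive_partial (is_derive_sub (is_derive_add (is_derive_add
  (dqx i 3) (dxf i 0 c sc)) (dxf i 1 b sb)) (dxf i 2 a sa)).
rewrite !d0 !d1 !d2 !d3 {d0 d1 d2 d3 dqx dxf dq}.
have neq : [/\ forall i : 'I_4, (i == i)%:R = 1 :> R &
    forall i j : 'I_4, val i != val j -> (i == j)%:R = 0 :> R].
  by split=> [i|i j /negbTE E]; rewrite ?eqxx// -val_eqE E.
rewrite !(proj1 neq) !(proj2 neq)//.
have [W0 W1 W2 W3] := HW x Ox; have := nsq x Ox.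
rewrite /p0 /p1 /p2 /p3 /q; move: W0 W1 W2 W3; rewrite /W.
move: (d 0 h x) (d 1 h x) (d 2 h x) (d 3 h x) => h0 h1 h2 h3.
move: (d 0 a x) (d 1 a x) (d 2 a x) (d 3 a x) => a0 a1 a2 a3.
move: (d 0 b x) (d 1 b x) (d 2 b x) (d 3 b x) => b0 b1 b2 b3.
move: (d 0 c x) (d 1 c x) (d 2 c x) (d 3 c x) => c0 c1 c2 c3.
move: (x 0 0) (x 0 1) (x 0 2) (x 0 3) (h x) (N x) (a x) (b x) (c x) => x_0 x_1 x_2 x_3 H n A B C.
move=> W0 W1 W2 W3 E.
(* Each of the four equations for W is solved for one derivative of the potential. Then the first
   two claims need N |x|^2 = 1, and the self-dual equations become polynomial identities. *)
have Ea1 : a1 = H * (- 2 * x_0 * n * n) - n * h0 - b2 - c3 by lra.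
have Ea0 : a0 = - (H * (- 2 * x_1 * n * n) - n * h1) - c2 + b3 by lra.
have Eb0 : b0 = - (H * (- 2 * x_2 * n * n) - n * h2) + c1 - a3 by lra.
have Ec0 : c0 = - (H * (- 2 * x_3 * n * n) - n * h3) - b1 + a2 by lra.
clear W0 W1 W2 W3; subst a0 a1 b0 c0; split.
- transitivity (H * (n * (x_0 * x_0 + x_1 * x_1 + x_2 * x_2 + x_3 * x_3))); first by ring.
  by rewrite E mulr1.
- transitivity (4 * H * n * (1 - n * (x_0 * x_0 + x_1 * x_1 + x_2 * x_2 + x_3 * x_3))); first by ring.
  by rewrite E subrr mulr0.
- by ring.
- by ring.
- by ring.
Qed.

End RealDecomposition.

Local Open Scope complex_scope.

(** * 1-regularity and the Cauchy-Fueter equation in real form *)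

Section RegularPair.
Variable R : realType.
Implicit Types (x y z : 'rV[R]_4) (Om : set 'rV[R]_4).
Local Notation d i f := (partial i (f : 'rV[R]_4 -> R)).

Lemma partial_mkquat Om (f : 'I_4 -> 'rV[R]_4 -> R) i x :
  (forall j, smooth Om (f j)) -> Om x ->
  partial i (fun y => mkquat (f 0 y) (f 1 y) (f 2 y) (f 3 y)) x =
  mkquat (d i (f 0) x) (d i (f 1) x) (d i (f 2) x) (d i (f 3) x).
Proof.
move=> sf Ox; pose M (y : 'rV[R]_4) := mkquat (f 0 y) (f 1 y) (f 2 y) (f 3 y).
have E (k : 'I_1) j : (fun y => M y k j) = f j.
  by move: j; apply: forall_I4; apply/funext => y; rewrite mxE.
have dM : derivable M x 'e_i.
  by apply/derivable_mxP => k j; rewrite E; have [] := smooth_is_derive i (sf j) Ox.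
apply: etrans (derive_mx dM) _; apply/rowP => j; rewrite !mxE E.
by move: j; apply: forall_I4.
Qed.

(** Both notions of regularity amount to the same four real equations: the real and imaginary parts
    of the two nabla equations are, up to sign, the four components of D(j f0 - f1) = 0. *)
Lemma regular_pair Om (A B C E : 'rV[R]_4 -> R) : open Om -> smooth Om A -> smooth Om B -> smooth Om C -> smooth Om E ->
  (forall x, Om x -> [/\ d 3 B x - d 2 A x + (d 1 E x - d 0 C x) = 0,
    d 3 A x + d 2 B x + (d 1 C x + d 0 E x) = 0,
    d 0 A x + d 1 B x - (d 2 C x + d 3 E x) = 0 & d 0 B x - d 1 A x + (d 3 C x - d 2 E x) = 0]) ->
  let f0 y := A y +i* B y in let f1 y := C y +i* E y in
  [/\ csmooth Om f0, csmooth Om f1, regular1 Om (fun y => (f0 y, f1 y)) &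
    forall x, Om x -> cauchy_fueter (fun y => qmul (qj R) (quat_of_complex (f0 y)) - quat_of_complex (f1 y)) x = 0].
Proof.
move=> oOm sA sB sC sE H f0 f1.
have c0 : csmooth Om f0 by [].
have c1 : csmooth Om f1 by [].
have p0 i x : cpartial i f0 x = d i A x +i* d i B x by [].
have p1 i x : cpartial i f1 x = d i C x +i* d i E x by [].
split=> // [|x Ox].
  split=> // a x Ox; have [H1 H2 H3 H4] := H x Ox.
  have [|] : a = 0 \/ a = 1 by case: a => -[|[|//]] ha; [left|right]; exact: val_inj.
    move=> ->; change (- cpartial 2 f0 x - 'i * cpartial 3 f0 x + (- cpartial 0 f1 x - 'i * cpartial 1 f1 x) = 0).
    rewrite !p0 !p1; apply/eqP; rewrite eq_complex /=; move: H1 H2 {H3 H4}.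
    move: (d 3 B x) (d 2 A x) (d 1 E x) (d 0 C x) (d 3 A x) (d 2 B x) (d 1 C x) (d 0 E x) => *.
    by apply/andP; split; apply/eqP; lra.
  move=> ->; change (cpartial 0 f0 x - 'i * cpartial 1 f0 x + (- cpartial 2 f1 x + 'i * cpartial 3 f1 x) = 0).
  rewrite !p0 !p1; apply/eqP; rewrite eq_complex /=; move: H3 H4 {H1 H2}.
  move: (d 0 A x) (d 1 B x) (d 2 C x) (d 3 E x) (d 0 B x) (d 1 A x) (d 3 C x) (d 2 E x) => *.
  by apply/andP; split; apply/eqP; lra.
(* The components of j f0 - f1, as j (A + B i) = A j - B k. *)
pose f (i : 'I_4) : 'rV[R]_4 -> R := nth A [:: fun y => - C y; fun y => - E y; A; fun y => - B y] i.
have sf i : smooth Om (f i) by move: i; apply: forall_I4; [exact: smooth_opp oOm sC|exact: smooth_opp oOm sE|exact: sA|exact: smooth_opp oOm sB].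
have -> : (fun y => qmul (qj R) (quat_of_complex (f0 y)) - quat_of_complex (f1 y)) =
    (fun y => mkquat (f 0 y) (f 1 y) (f 2 y) (f 3 y)).
  apply/funext => y; apply/rowP; apply: forall_I4; rewrite !mxE /=.
  - by rewrite -[f 0 y]/(- C y); ring.
  - by rewrite -[f 1 y]/(- E y); ring.
  - by rewrite -[f 2 y]/(A y); ring.
  - by rewrite -[f 3 y]/(- B y); ring.
have pf i : partial i (fun y => mkquat (f 0 y) (f 1 y) (f 2 y) (f 3 y)) x =
    mkquat (- d i C x) (- d i E x) (d i A x) (- d i B x).
  rewrite (partial_mkquat i sf Ox); congr mkquat;
    [exact: (partial_opp i sC Ox)|exact: (partial_opp i sE Ox)|exact: (partial_opp i sB Ox)].
rewrite /cauchy_fueter !pf; have [] := H x Ox.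
move: (d 0 A x) (d 1 A x) (d 2 A x) (d 3 A x) (d 0 B x) (d 1 B x) (d 2 B x) (d 3 B x).
move=> a0 a1 a2 a3 b0 b1 b2 b3.
move: (d 0 C x) (d 1 C x) (d 2 C x) (d 3 C x) (d 0 E x) (d 1 E x) (d 2 E x) (d 3 E x).
move=> g0 g1 g2 g3 e0 e1 e2 e3 H1 H2 H3 H4.
apply/rowP; apply: forall_I4; rewrite !mxE /=; lra.
Qed.
End RegularPair.

Ltac generalize_partials := repeat match goal with
  |- context [@partial ?R ?n ?W ?i ?f ?x] => generalize (@partial R n W i f x); intro end.

Theorem theorem1p2 (R : realType) (Omega : set 'rV[R]_4)
  (domain_Omega : domain Omega) (H3_Omega : deRham_vanishes 3 Omega)
  (Omega_n0 : ~ Omega 0)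
  (h : 'rV[R]_4 -> R[i]) (smooth_h : csmooth Omega h)
  (harmonic_h : harmonic_on Omega h) :
  exists f0 f1 g0 g1 : 'rV[R]_4 -> R[i],
    let f y := (f0 y, f1 y) in
    let g y := (g0 y, g1 y) in
    [/\ [/\ csmooth Omega f0, csmooth Omega f1,
            csmooth Omega g0 & csmooth Omega g1],
        regular1 Omega f /\ regular1 Omega g,
        forall x, Omega x -> h x = L0 f x + L1 g x,
        forall x, Omega x ->
          h x = (x 0 2 +i* x 0 3) * f0 x + (x 0 0 +i* x 0 1) * f1 x
              + ((- x 0 0) +i* x 0 1) * g0 x + (x 0 2 -i* x 0 3) * g1 x &
        forall x, Omega x ->
          cauchy_fueter (fun y => qmul (qj R) (quat_of_complex (f0 y))
                                  - quat_of_complex (f1 y)) x = 0 /\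
          cauchy_fueter (fun y => qmul (qj R) (quat_of_complex (g0 y))
                                  - quat_of_complex (g1 y)) x = 0].
Proof.
have [oOm _ _] := domain_Omega.
pose hr y : R := complex.Re (h y); pose hi y : R := complex.Im (h y).
have sr : smooth Omega hr by move=> k; have [] := smooth_h k.
have si : smooth Omega hi by move=> k; have [] := smooth_h k.
have Lr x : Omega x -> \sum_i partial i (partial i (hr : _ -> R) : _ -> R) x = 0.
  by move=> Ox; have := f_equal (@complex.Re R) (harmonic_h x Ox); rewrite !sum4.
have Li x : Omega x -> \sum_i partial i (partial i (hi : _ -> R) : _ -> R) x = 0.
  by move=> Ox; have := f_equal (@complex.Im R) (harmonic_h x Ox); rewrite !sum4.
have [p0 [p1 [p2 [p3 [[s0 s1 s2 s3] Hp]]]]] := harmonic_decomposition oOm Omega_n0 H3_Omega sr Lr.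
have [r0 [r1 [r2 [r3 [[t0 t1 t2 t3] Hr]]]]] := harmonic_decomposition oOm Omega_n0 H3_Omega si Li.
(* With P_k = p_k + i r_k, z = x_0 + i x_1 and w = x_2 + i x_3, the function h = sum of x_k P_k is
   expanded in w, z and their conjugates. The coefficients are f0 = (P_2 - i P_3)/2, f1 = (P_0 - i
   P_1)/2, g0 = -(P_0 + i P_1)/2 and g1 = (P_2 + i P_3)/2, the sign of g0 coming from -x_0 + i x_1.
   Their real and imaginary parts are half sums of this form. *)
pose lc (c e : R) (u v : 'rV[R]_4 -> R) (y : 'rV[R]_4) : R := 2^-1 * (c * u y + e * v y).
have sl c e u v : smooth Omega u -> smooth Omega v -> smooth Omega (lc c e u v).
  move=> su sv; apply: (smooth_mul oOm (smooth_cst _ _)); apply: (smooth_add oOm).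
    exact: smooth_mul oOm (smooth_cst _ _) su.
  exact: smooth_mul oOm (smooth_cst _ _) sv.
have dl c e u v i x : smooth Omega u -> smooth Omega v -> Omega x ->
    partial i (lc c e u v) x = 2^-1 * (c * partial i (u : _ -> R) x + e * partial i (v : _ -> R) x).
  move=> su sv Ox; rewrite -(partial_scale i su Ox) -(partial_scale i sv Ox).
  have su' := smooth_mul oOm (smooth_cst Omega c) su; have sv' := smooth_mul oOm (smooth_cst Omega e) sv.
  rewrite -(partial_add i su' sv' Ox).
  exact: (partial_scale i (smooth_add oOm su' sv') Ox 2^-1).
have [|cf0 cf1 rf Df] := regular_pair oOm (sl 1 1 _ _ s2 t3) (sl 1 (-1) _ _ t2 s3)
    (sl 1 1 _ _ s0 t1) (sl 1 (-1) _ _ t0 s1).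
  move=> x Ox; have [_ P1 P2 P3 P4] := Hp x Ox; have [_ R1 R2 R3 R4] := Hr x Ox.
  rewrite !dl//; clear -P1 P2 P3 P4 R1 R2 R3 R4; move: P1 P2 P3 P4 R1 R2 R3 R4.
  generalize_partials.
  by move=> *; split; lra.
have [|cg0 cg1 rg Dg] := regular_pair oOm (sl (-1) 1 _ _ s0 t1) (sl (-1) (-1) _ _ t0 s1)
    (sl 1 (-1) _ _ s2 t3) (sl 1 1 _ _ t2 s3).
  move=> x Ox; have [_ P1 P2 P3 P4] := Hp x Ox; have [_ R1 R2 R3 R4] := Hr x Ox.
  rewrite !dl//; clear -P1 P2 P3 P4 R1 R2 R3 R4; move: P1 P2 P3 P4 R1 R2 R3 R4.
  generalize_partials.
  by move=> *; split; lra.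
have Hh x : Omega x -> h x = (x 0 2 +i* x 0 3) * (lc 1 1 p2 r3 x +i* lc 1 (-1) r2 p3 x)
    + (x 0 0 +i* x 0 1) * (lc 1 1 p0 r1 x +i* lc 1 (-1) r0 p1 x)
    + ((- x 0 0) +i* x 0 1) * (lc (-1) 1 p0 r1 x +i* lc (-1) (-1) r0 p1 x)
    + (x 0 2 -i* x 0 3) * (lc 1 (-1) p2 r3 x +i* lc 1 1 r2 p3 x).
  move=> Ox; have [Hp0 _ _ _ _] := Hp x Ox; have [Hr0 _ _ _ _] := Hr x Ox.
  apply/eqP; rewrite eq_complex /= -/(hr x) -/(hi x) -Hp0 -Hr0 /lc.
  move: (x 0 0) (x 0 1) (x 0 2) (x 0 3) (p0 x) (p1 x) (p2 x) (p3 x) (r0 x) (r1 x) (r2 x) (r3 x).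
  by move=> *; apply/andP; split; apply/eqP; field.
exists (fun y => lc 1 1 p2 r3 y +i* lc 1 (-1) r2 p3 y), (fun y => lc 1 1 p0 r1 y +i* lc 1 (-1) r0 p1 y),
  (fun y => lc (-1) 1 p0 r1 y +i* lc (-1) (-1) r0 p1 y), (fun y => lc 1 (-1) p2 r3 y +i* lc 1 1 r2 p3 y).
split=> //.
  by move=> x Ox; rewrite (Hh x Ox) /L0 /L1 /= !addrA.
by move=> x Ox; split; [exact: Df|exact: Dg].
Qed.
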